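(* Work in the setting of the context. Assume: (i) $G(\theta,\cdot)$ is $\mathbb P^Z$-integrable for every $\theta\in\Theta$, and $G(\theta_k,\cdot)\to G(\theta,\cdot)$ in $\mathbb P^Z$-probability whenever $\theta_k\to\theta$ in $\Theta$. (ii) There is a strictly positive square $\mathbb P^Z$-integrable $\xi^G:\mathbb R^d\to\mathbb R$ with $\sup_{\theta\in\Theta}|G(\theta,z)|\le\xi^G(z)$ for all $z\in\mathbb R^d$. (iii) $H(\theta,t,\cdot)$ is Borel measurable for all $(\theta,t)\in\Theta\times\mathbb R$, and $H(\theta,\overline\psi(\theta),\cdot)$ is $\mathbb P^Z$-integrable for all $\theta\in\Theta$. (iv) There are nonnegative square $\mathbb P^Z$-integrable $L_1,L_2$ with $|H(\theta,t,z)-H(\vartheta,s,z)|^2\le L_1(z)^2|G(\theta,z)-G(\vartheta,z)|^2+L_2(z)^2|t-s|^2$ for all $\theta,\vartheta\in\Theta$, $t,s\in\mathbb R$, $z\in\mathbb R^d$. (v) $\psi_{H,\Theta}$ has a unique minimizer $\theta^*$ over $\Theta$, and there is $M_1>0$ with $\psi_{H,\Theta}(\theta)-\psi_{H,\Theta}(\theta^* )\ge M_1\|\theta-\theta^*\|_m^2$ for all $\theta\in\Theta$. (vi) For every $\delta>0$ there exist an at most countable $\mathcal C(\mathcal U_\delta)\subseteq\mathcal U_\delta$ and $(\mathbb P^Z)^n$-null sets $N_n^\delta$ ($n\in\mathbb N$) such that $\inf_{\vartheta\in\mathcal C(\mathcal U_\delta)}\{\mathbb E[|G(\theta,Z_1)-G(\vartheta,Z_1)|]+\max_{1\le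 j\le n}|G(\theta,z_j)-G(\vartheta,z_j)|\}=0$ for all $\theta\in\mathcal U_\delta$, $n\in\mathbb N$, $(z_1,\dots,z_n)\in\mathbb R^{dn}\setminus N_n^\delta$. (vii) There exist $\beta\in\,]0,1]$, $\overline M_1,\overline M^1>0$ and square $\mathbb P^Z$-integrable positive envelopes $\xi^G_\delta$ of $\mathbb F^\Theta_\delta$ ($\delta\in\,]0,\Delta(\Theta)]$) such that $\|(L_1\vee1)\xi^G_\delta\|_{\mathbb P^Z,2}\le\overline M_1\delta^\beta$ and $J(\mathbb F^\Theta_\delta,\xi^G_\delta,1/8)\vee J(\mathbb F^\Theta,\xi^G,1/8)\le\overline M^1$ for all $\delta\in\,]0,\Delta(\Theta)]$. (viii) There exist $\delta_1>0$, $K_{\delta_1}\ge0$ and a Borel measurable $m_{\Theta\times\mathbb R}:\Theta\times\mathbb R\to\mathbb R$ such that $|m_{\Theta\times\mathbb R}(\theta,\overline\psi(\theta)+x)-m_{\Theta\times\mathbb R}(\theta^*,\overline\psi(\theta^* )+x)|\le K_{\delta_1}\|(\theta-\theta^*,\overline\psi(\theta)-\overline\psi(\theta^* ))\|_{m+1}$ for all $(\theta,x)\in\Theta\times[-\delta_1,\delta_1]$, and $\mathbb E[H(\theta,t,Z_1)]-\mathbb E[H(\theta,s,Z_1)]=\int_s^t m_{\Theta\times\mathbb R}(\theta,u)\,du$ for all $\theta\in\Theta$ and $t>s$. Let $a,b,\varepsilon>0$ with $a\,2^{\beta+1/2}\le b\,\varepsilon^{\beta+1/2}$, put $\delta_{nk}:=2^kn^{-1/(4-2\beta)}$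 ($k\in\mathbb Z$, $n\in\mathbb N$) and write $\mathfrak l_2:=\mathbf 1_{]0,\infty[}(\mathbb E[L_2(Z_1)])$. If $n\in\mathbb N$ satisfies $n\ge n(a,b,\beta)$ and $t>0$ satisfies $$2^{K_\varepsilon(2-\beta)-K_\varepsilon^+/2}>\frac{4\big[M_{a,b}\,\mathfrak l_2+\overline M_b\big(1+2(t+1)\widehat\eta\big)\big]}{M_1},$$ then $$\mathbb P\big(\{n^{1/(4-2\beta)}\|\widehat\theta_n-\theta^*\|_m>\varepsilon\}\big)\le P_1^{t,\varepsilon}+P_{n2}^\varepsilon+P_{n3}^\varepsilon+\mathbb P(\Omega\setminus\Omega_{n,a}),$$ where $$P_1^{t,\varepsilon}:=\exp\Big(\frac{\mathfrak l_2\,M_{a,b}\,\mathfrak g(t)}{(\sqrt\varepsilon\wedge1)\,b\,\|L_2\|_{\mathbb P^Z,2}}\Big)\cdot\frac{2^{4-\beta}\,\overline M_b}{(3/2-\beta)\ln(2)\,M_1\,\varepsilon^{3/2-\beta}\sqrt{\varepsilon\wedge2}}\exp\Big(-\frac{\varepsilon^{3/2-\beta}\sqrt{\varepsilon\wedge2}\,M_1\,\mathfrak g(t)}{2^{4-\beta}\,\overline M_b}\Big)$$ (the first exponential factor being $1$ when $\mathfrak l_2=0$), and $$P_{n2}^\varepsilon:=\sum_{\substack{k\ge K_\varepsilon+1\\ \delta_{n(k-1)}\le\Delta(\Theta)}}\mathbb P\big(\Omega\setminus\Omega^n_{\delta_{nk}\wedge\Delta(\Theta),\,\sqrt2^{\,k}b}\big),\qquad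 P_{n3}^\varepsilon:=\sum_{\substack{k\ge K_\varepsilon+1\\ \delta_{n(k-1)}\le\Delta(\Theta)}}\mathbb P\big(\Omega\setminus B_n^{\xi^G_{a,\sqrt2^{\,k}b,[\delta_{nk}\wedge\Delta(\Theta)]}}\big).$$
   Context: Setting. $(\Omega,\mathcal F,\mathbb P)$ is a complete atomless probability space and $(Z_j)_{j\in\mathbb N}$ are i.i.d. $d$-dimensional random vectors on it with common distribution $\mathbb P^Z$. $\Theta\subset\mathbb R^m$ is compact with Euclidean diameter $\Delta(\Theta)>0$; $\|\cdot\|_k$ is the Euclidean norm on $\mathbb R^k$. $x\wedge y$, $x\vee y$ denote min and max, $x^+=x\vee0$. $\|f\|_{\mathbb Q,2}=(\int f^2\,d\mathbb Q)^{1/2}$. $G:\Theta\times\mathbb R^d\to\mathbb R$ and $H:\Theta\times\mathbb R\times\mathbb R^d\to\mathbb R$ are mappings, $\overline\psi(\theta):=\mathbb E[G(\theta,Z_1)]$, $\psi_{H,\Theta}(\theta):=\mathbb E[H(\theta,\overline\psi(\theta),Z_1)]$. $(\widehat\theta_n)_{n\in\mathbb N}$ is a sequence of $\Theta$-valued random vectors such that $\widehat\theta_n$ minimizes (for each realization) $\theta\mapsto\frac1n\sum_{j=1}^nH\big(\theta,\frac1n\sum_{k=1}^nG(\theta,Z_k),Z_j\big)$ over $\Theta$. Notation. $\mathcal U_\delta:=\{\theta\in\Theta:\|\theta-\theta^*\|_m\le\delta\}$; $\mathbb F^\Theta:=\{G(\theta,\cdot):\theta\in\Theta\}$; $\mathbb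 F^\Theta_\delta:=\{G(\theta,\cdot)-G(\theta^*,\cdot):\theta\in\mathcal U_\delta\}$. For $\varepsilon>0$, $K_\varepsilon$ is the largest integer not exceeding $\ln(\varepsilon)/\ln(2)$. $(\mathbb P_n-\mathbb P)(f):=\frac1n\sum_{j=1}^n(f(Z_j)-\mathbb E[f(Z_j)])$. Entropy. A positive envelope of a class $\mathbb F$ of Borel functions on $\mathbb R^d$ is a strictly positive Borel function $C_{\mathbb F}$ with $\sup_{h\in\mathbb F}|h|\le C_{\mathbb F}$. $N(\eta,\mathbb F,L^2(\mathbb Q))$ is the minimal number of closed $L^2(\mathbb Q)$-balls of radius $\eta$ with centers in $\mathbb F$ needed to cover $\mathbb F$ ($\infty$ if no finite cover exists). $\mathcal M_{\rm fin}$ is the set of probability measures on $\mathcal B(\mathbb R^d)$ with finite support. $J(\mathbb F,C_{\mathbb F},\delta):=\int_0^\delta\sup_{\mathbb Q\in\mathcal M_{\rm fin}}\sqrt{\ln\big(2N(\varepsilon\|C_{\mathbb F}\|_{\mathbb Q,2},\mathbb F,L^2(\mathbb Q))\big)}\,d\varepsilon$. Events (with $\beta$ from (vii)). $\Omega_{n,a}:=\{\sup_{\theta\in\Theta}|(\mathbb P_n-\mathbb P)(G(\theta,\cdot))|\le a/\sqrt n\}$; $\Omega^n_{\delta,b}:=\{\sup_{\theta\in\mathcal U_\delta}|(\mathbb P_n-\mathbb P)(G(\theta,\cdot)-G(\theta^*,\cdot))|\le b\delta^\beta/\sqrt n\}$; for square $\mathbb P^Z$-integrable $\xi$, $B_n^\xi:=\{\frac1n\sum_{j=1}^n\xi(Z_j)^2\le2\,\mathbb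 E[\xi(Z_1)^2]\}$. Functions and constants. $\xi^G_{a,b,\delta}:=\sqrt{(L_1\vee1)^2(\xi^G_\delta)^2+L_2^2\,(b+\overline M_1)^2\,\delta^{2\beta}}$; $M_{a,b}:=K_{\delta_1}a[\Delta(\Theta)^{1-\beta}+\overline M_1]+b\,\mathbb E[L_2(Z_1)]$; $\overline M_b:=\overline M_1(1+\|L_2\|_{\mathbb P^Z,2})+b\|L_2\|_{\mathbb P^Z,2}$; $\mathfrak g(t):=\frac{t^2}{8(t+1)(5t+28)}$; $\widehat\eta:=64\sqrt2\,(\overline M^1+0.7)$; $n(a,b,\beta):=\frac{\overline M_b^2\Delta(\Theta)^{2\beta}}2\vee\frac{\mathbf 1_{]0,\infty[}(\mathbb E[L_2(Z_1)])\,a^2}{\delta_1^2}\vee\big[\overline M_b^2\Delta(\Theta)^{2\beta+1}\big]^{\frac{4-2\beta}{3-2\beta}}$. *)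

(* Defs.v *)
From HB Require Import structures.
From mathcomp Require Import all_boot all_order all_algebra.
From mathcomp Require Import all_classical all_reals all_analysis.

Set Implicit Arguments.
Unset Strict Implicit.
Unset Printing Implicit Defensive.

Import Order.TTheory GRing.Theory Num.Theory.
Import numFieldTopology.Exports numFieldNormedType.Exports.

Local Open Scope classical_set_scope.
Local Open Scope ring_scope.

(* the Borel sigma-algebra of R^k *)
Notation borel_rV R k := (g_sigma_algebraType (@open 'rV[R]_k)).

Section Euclidean.
Context {R : realType}.

(* the norm of the library on 'rV[R]_k is the sup norm *)
Definition enorm k (x : 'rV[R]_k) : R := Num.sqrt (\sum_(i < k) x 0 i ^+ 2).

Definition ediam k (A : set 'rV[R]_k) : R :=
  sup [set enorm (x - y) | x in A & y in A].

(* U_delta *)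
Definition eball_in k (Theta : set 'rV[R]_k) (x : 'rV[R]_k) (delta : R) :
  set 'rV[R]_k := [set y | Theta y /\ enorm (y - x) <= delta].

End Euclidean.

Section Probability.
Context {R : realType}.

Definition atomless d (T : measurableType d) (P : probability T R) : Prop :=
  forall A, measurable A -> (0 < P A)%E ->
    exists B, [/\ measurable B, B `<=` A, (0 < P B)%E & (P B < P A)%E].

Definition mutually_independent d d' (T : measurableType d)
    (T' : measurableType d') (P : probability T R)
    (X : nat -> {RV P >-> T'}) : Prop :=
  forall (s : seq nat) (A : nat -> set T'), uniq s ->
    (forall j, measurable (A j)) ->
    P (\bigcap_(j in [set` s]) (X j @^-1` A j)) =
    (\prod_(j <- s) P (X j @^-1` A j))%E.

Definition iid_with_law d d' (T : measurableType d)
    (T' : measurableType d') (P : probability T R)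
    (X : nat -> {RV P >-> T'}) (Q : probability T' R) : Prop :=
  mutually_independent X /\
  forall j A, measurable A -> distribution P (X j) A = Q A.

Definition cvg_in_probability d (T : measurableType d) (Q : probability T R)
    (f_ : nat -> T -> R) (f : T -> R) : Prop :=
  forall e, 0 < e ->
    Q [set x | e < `|f_ k x - f x|] @[k --> \oo] --> 0%E.

Section TuplePower.
Context d (T : measurableType d) (n : nat).

Definition tuple_cons (x : T * n.-tuple T) : n.+1.-tuple T :=
  [tuple of x.1 :: x.2].

Lemma measurable_tuple_cons : measurable_fun setT tuple_cons.
Proof. exact: measurable_cons. Qed.

HB.instance Definition _ :=
  isMeasurableFun.Build _ _ _ _ tuple_cons measurable_tuple_cons.

End TuplePower.

(* the n-fold product measure Q^n *)
Fixpoint power_probability d (T : measurableType d) (Q : probability T R)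
    (n : nat) : probability (n.-tuple T) R :=
  if n is n'.+1 then
    distribution (Q \x power_probability Q n')%E (@tuple_cons _ T n')
  else \d_[tuple].

End Probability.

Section Entropy.
Context {R : realType} d (T : measurableType d).
Implicit Types (F : set (T -> R)) (C : T -> R) (Q : probability T R).
Local Open Scope ereal_scope.

Definition positive_envelope F C : Prop :=
  [/\ measurable_fun setT C, (forall z, 0 < C z)%R &
      forall f z, F f -> (`|f z| <= C z)%R].

(* the minimal number of closed L2(Q)-balls of radius eta centered in F *)
Definition covering_number Q F (eta : \bar R) : \bar R :=
  ereal_inf [set k%:R%:E | k in [set k : nat | exists c : 'I_k -> T -> R,
    (forall i, F (c i)) /\
    (forall f, F f -> exists i, 'N[Q]_2%:E[EFin \o (f \- c i)%R] <= eta)]].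

Definition finitely_supported : set (probability T R) :=
  [set Q | exists A, finite_set A /\ Q A = 1].

Definition entropy_integral F C (delta : R) : \bar R :=
  \int[lebesgue_measure]_(e in `[0%R, delta])
    ereal_sup [set lne (2%:E * covering_number Q F
                                (e%:E * 'N[Q]_2%:E[EFin \o C])) `^ 2^-1
              | Q in finitely_supported].

End Entropy.

Section Setting.
Context {R : realType} d (Omega : measurableType d) (P : probability Omega R).
Context (m k : nat) (Z : nat -> {RV P >-> borel_rV R k}).
Context (Theta : set 'rV[R]_m).
Context (G : 'rV[R]_m -> borel_rV R k -> R).
Context (H : 'rV[R]_m -> R -> borel_rV R k -> R).

(* E[f(Z_1)]; the sequence Z is indexed from 0 *)
Definition expect (f : borel_rV R k -> R) : R := (\int[P]_w f (Z 0 w))%R.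

Definition psi_bar (theta : 'rV[R]_m) : R := expect (G theta).

Definition psi_H (theta : 'rV[R]_m) : R := expect (H theta (psi_bar theta)).

Definition empirical_objective (n : nat) (w : Omega) (theta : 'rV[R]_m) : R :=
  n%:R^-1 * \sum_(j < n)
    H theta (n%:R^-1 * \sum_(i < n) G theta (Z i w)) (Z j w).

(* (P_n - P)(f) *)
Definition empirical_deviation (n : nat) (f : borel_rV R k -> R) (w : Omega) :
  R := n%:R^-1 * \sum_(j < n) (f (Z j w) - (\int[P]_w' f (Z j w'))%R).

Definition F_Theta : set (borel_rV R k -> R) := [set G theta | theta in Theta].

Definition F_Theta_delta (theta_star : 'rV[R]_m) (delta : R) :
    set (borel_rV R k -> R) :=
  [set (G theta \- G theta_star) | theta in eball_in Theta theta_star delta].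

(* Omega_{n,a} *)
Definition event_Theta (n : nat) (a : R) : set Omega :=
  [set w | (ereal_sup [set `|empirical_deviation n (G theta) w|%:E
                      | theta in Theta] <= (a / Num.sqrt n%:R)%:E)%E].

(* Omega^n_{delta,b} *)
Definition event_delta (theta_star : 'rV[R]_m) (beta : R) (n : nat)
    (delta b : R) : set Omega :=
  [set w | (ereal_sup
      [set `|empirical_deviation n (G theta \- G theta_star) w|%:E
      | theta in eball_in Theta theta_star delta]
    <= (b * delta `^ beta / Num.sqrt n%:R)%:E)%E].

(* B_n^xi *)
Definition event_B (n : nat) (xi : borel_rV R k -> R) : set Omega :=
  [set w | n%:R^-1 * \sum_(j < n) xi (Z j w) ^+ 2
           <= 2 * expect (fun z => xi z ^+ 2)].

End Setting.

Section Constants.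
Context {R : realType}.

(* xi^G_{a,b,delta}, which does not depend on a; xi is xi^G_delta *)
Definition xi_bdelta (T : Type) (L1 L2 xi : T -> R)
    (Mbar_lo beta b delta : R) (z : T) : R :=
  Num.sqrt (Num.max (L1 z) 1 ^+ 2 * xi z ^+ 2 +
            L2 z ^+ 2 * (b + Mbar_lo) ^+ 2 * delta `^ (2 * beta)).

(* M_{a,b}; Mbar_lo is \overline M_1 and EL2 is E[L_2(Z_1)] *)
Definition M_ab (K_d1 Delta Mbar_lo beta EL2 a b : R) : R :=
  K_d1 * a * (Delta `^ (1 - beta) + Mbar_lo) + b * EL2.

(* \overline M_b, with nL2 the L2-norm of L_2 *)
Definition Mbar_b (Mbar_lo nL2 b : R) : R := Mbar_lo * (1 + nL2) + b * nL2.

Definition gfrak (t : R) : R := t ^+ 2 / (8 * (t + 1) * (5 * t + 28)).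

(* Mbar_up is \overline M^1 *)
Definition eta_hat (Mbar_up : R) : R := 64 * Num.sqrt 2 * (Mbar_up + 7 / 10).

(* l2 is the indicator of E[L_2(Z_1)] > 0 *)
Definition n_ab (Mb Delta delta1 l2 beta a : R) : R :=
  Num.max (Num.max (Mb ^+ 2 * Delta `^ (2 * beta) / 2)
                   (l2 * a ^+ 2 / delta1 ^+ 2))
          ((Mb ^+ 2 * Delta `^ (2 * beta + 1))
             `^ ((4 - 2 * beta) / (3 - 2 * beta))).

Definition K_eps (eps : R) : int := Num.floor (ln eps / ln 2).

Definition delta_nk (beta : R) (n : nat) (k : int) : R :=
  2 ^ k * n%:R `^ (- (4 - 2 * beta)^-1).

(* When l2 = 0 the first exponential factor is expR 0 = 1. *)
Definition P_1 (M1 beta l2 Mab Mb nL2 b t eps : R) : R :=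
  expR (l2 * Mab * gfrak t / (Num.min (Num.sqrt eps) 1 * b * nL2)) *
  (2 `^ (4 - beta) * Mb /
     ((3 / 2 - beta) * ln 2 * M1 * eps `^ (3 / 2 - beta)
      * Num.sqrt (Num.min eps 2))) *
  expR (- (eps `^ (3 / 2 - beta) * Num.sqrt (Num.min eps 2) * M1 * gfrak t /
           (2 `^ (4 - beta) * Mb))).

(* the index set of the sums P_{n2} and P_{n3} *)
Definition peeling_indices (Delta beta : R) (n : nat) (eps : R) : set int :=
  [set k | K_eps eps + 1 <= k /\ delta_nk beta n (k - 1) <= Delta].

End Constants.

(* Main.v *)
(* Cut the complement of a small neighbourhood of theta_star into dyadic shells
   delta_(n,k-1) < |theta - theta_star| <= delta_(n,k).  If theta_hat lies in the k-th shell, the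
   quadratic growth of psi_H there has to be compensated by the bias, which the Lipschitz function
   mTR and the events event_Theta and event_delta control, and by a centered empirical sum of
   functions H theta (s + u rho) - H theta_star s with |s - psi_bar theta_star| <= a / sqrt n
   and |u| <= 1.  On event_B this sum exceeds its level with probability at most
   4 exp(-(s_k / 32)^2), where s_k grows geometrically in k and s_k >= 256 (Mbar_up + 0.7).
   This is obtained from symmetrization with a ghost sample and sub-Gaussian chaining for the
   Rademacher sums, the nets coming from the entropy integral; the class is indexed by
   (theta, y, u), and the two real parameters only cost grids with 2^(l+3) points at level l.
   The sub-Gaussian tails leave enough room to sum over all shells and to stay below P_1, whose
   rate gfrak only has linear growth. *)

From HB Require Import structures.
Require Import Defs.
From mathcomp Require Import all_boot all_order all_algebra.
From mathcomp Require Import all_classical all_reals all_analysis.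
From mathcomp Require Import measurable_realfun zify ring lra.

Set Implicit Arguments.
Unset Strict Implicit.
Unset Printing Implicit Defensive.

Import Order.TTheory GRing.Theory Num.Theory.
Import numFieldTopology.Exports numFieldNormedType.Exports.

Local Open Scope classical_set_scope.
Local Open Scope ring_scope.

(** * Rademacher sums and chaining *)

(** The inner mean is random, so the objective evaluates [H] at a random second argument and no
    deviation inequality for a fixed class applies to it. On [event_Theta] and [event_delta] this
    argument stays in known intervals; rescaling them to [-1, 1] by [y] and [u] gives a fixed class
    that contains every realization. The range of [u] is of order delta^beta, like the envelope, so
    the real parameters and the functions are discretized on the same relative scale. The entropy
    hypothesis concerns [G] under finitely supported measures, not [H]. Masses proportional to the
    square of max(L1, 1) at the sample points turn empirical distances of [H] into L2 distances of
    [G]; this is why the envelope is weighted by that maximum. For a fixed sample, a probability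
    over Rademacher signs is a proportion of sign patterns, so that stage is finite counting.
    Suprema over uncountable sets are the remaining obstacle: concentration is proved along a
    countable subfamily and extended by approximation off a null set. *)

Lemma card_le_sum (T J : finType) (A : pred T) (B : J -> pred T) :
  (forall e, A e -> exists j, B j e) -> (#|A| <= \sum_j #|B j|)%N.
Proof.
move=> AB; under eq_bigr do rewrite -sum1_card.
rewrite -sum1_card [leqRHS](eq_bigr (fun j => \sum_e B j e)%N); last first.
  by move=> j _; rewrite big_mkcond; apply: eq_bigr => e _; case: ifP; rewrite unfold_in => ->.
rewrite exchange_big big_mkcond leq_sum// => e _.
case: ifP => // /AB[j hj]; by rewrite (bigD1 j)//= hj.
Qed.

Section GeometricSums.
Context {R : realType}.

Lemma sum_half_pow L : \sum_(l < L) 2 ^- l = 2 - 2 / 2 ^+ L :> R.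
Proof.
elim: L => [|L IH]; first by rewrite big_ord0 expr0; field.
by rewrite big_ord_recr/= IH exprS; field; rewrite expf_neq0.
Qed.

Lemma sum_half_pow_index L : \sum_(l < L) 2 ^- l * l.+1%:R <= 4 :> R.
Proof.
suff -> : \sum_(l < L) 2 ^- l * l.+1%:R = 4 - (2 * L%:R + 4) / 2 ^+ L :> R.
  by rewrite gerBl divr_ge0// exprn_ge0.
elim: L => [|L IH]; first by rewrite big_ord0 expr0; field.
by rewrite big_ord_recr/= IH exprS -natr1; field; rewrite expf_neq0.
Qed.

End GeometricSums.

Section Rademacher.
Context {R : realType}.
Implicit Types (x y u : R).

(** The signs form a finite function, so that for a fixed sample the probability of an event over
    independent Rademacher signs is its number of sign patterns divided by [2 ^+ n]. *)
Definition signed_sum n (e : {ffun 'I_n -> bool}) (w : 'I_n -> R) : R :=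
  \sum_(j < n) (-1) ^+ (e j) * w j.

Lemma signed_sumB n (e : {ffun 'I_n -> bool}) (v w : 'I_n -> R) :
  signed_sum e (fun j => v j - w j) = signed_sum e v - signed_sum e w.
Proof. by rewrite /signed_sum -sumrB; apply: eq_bigr => j _; rewrite mulrBr. Qed.

Lemma signed_sumZ n (e : {ffun 'I_n -> bool}) (c : R) (w : 'I_n -> R) :
  signed_sum e (fun j => c * w j) = c * signed_sum e w.
Proof. by rewrite /signed_sum mulr_sumr; apply: eq_bigr => j _; rewrite mulrCA. Qed.

(** Distributivity of products over sums plays the part of the independence of the signs. *)
Lemma sum_expR_signed_sum n (w : 'I_n -> R) :
  \sum_(e : {ffun 'I_n -> bool}) expR (signed_sum e w) =
  \prod_(j < n) (expR (w j) + expR (- w j)).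
Proof.
transitivity (\prod_(j < n) \sum_(b : bool) expR ((-1) ^+ b * w j)).
  rewrite bigA_distr_bigA; apply: eq_bigr => e _.
  by rewrite /signed_sum expR_sum.
by apply: eq_bigr => j _; rewrite big_bool /= expr0 mul1r expr1 mulN1r addrC.
Qed.

(* cosh y - 1 = e^-y (e^y - 1)^2 / 2, and e^y - 1 <= y e^y *)
Lemma cosh_le_small y : 0 <= y <= 1 / 9 ->
  (expR y + expR (- y)) / 2 <= expR (9 / 16 * y ^+ 2).
Proof.
move=> /andP[y0 y9].
apply: le_trans (expR_ge1Dx _).
have h := expR_ge1Dx (- y); have p := expRxMexpNx_1 y.
have := expR_ge1Dx y; have := expR_gt0 (- y).
set E := expR y in p *; set F := expR (- y) in h p * => F0 E1.
have Eub : E <= 9 / 8.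
  have : E * (1 - y) <= 1 by rewrite -p ler_pM2l ?expR_gt0//; lra.
  nra.
have E2 : E - 1 <= y * E by have : E * (1 - y) <= 1; [rewrite -p ler_pM2l ?expR_gt0//; lra|nra].
have -> : (E + F) / 2 = 1 + F * (E - 1) ^+ 2 / 2.
  have -> : F * (E - 1) ^+ 2 = (E * F) * E - 2 * (E * F) + F by ring.
  by rewrite p; field.
suff : F * (E - 1) ^+ 2 <= 9 / 8 * y ^+ 2 by lra.
have : F * (E - 1) ^+ 2 <= F * (y * E) ^+ 2.
  by rewrite ler_pM2l// ler_sqr ?nnegrE; [|lra|nra].
have -> : F * (y * E) ^+ 2 = (E * F) * E * y ^+ 2 by ring.
rewrite p mul1r => h2; apply: le_trans h2 _.
by apply: ler_wpM2r => //; exact: sqr_ge0.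
Qed.

(** Here cosh 2y = 2 cosh^2 y - 1, and with U = [expR (9 / 16 * y ^+ 2)] one has 2 U^2 - 1 <= U^4
    because (U^2 - 1)^2 >= 0. *)
Lemma cosh_le_double y :
  (expR y + expR (- y)) / 2 <= expR (9 / 16 * y ^+ 2) ->
  (expR (2 * y) + expR (- (2 * y))) / 2 <= expR (9 / 16 * (2 * y) ^+ 2).
Proof.
have -> : 9 / 16 * (2 * y) ^+ 2 = 4%:R * (9 / 16 * y ^+ 2) by ring.
have -> : - (2 * y) = 2%:R * (- y) by ring.
rewrite !expRM_natl; have := expRxMexpNx_1 y.
have := expR_gt0 y; have := expR_gt0 (- y); have := expR_ge1Dx (9 / 16 * y ^+ 2).
have := sqr_ge0 y.
set E := expR y; set F := expR (- y); set U := expR _ => y2 U1 F0 E0 p h.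
have -> : (E ^+ 2 + F ^+ 2) / 2 = 2 * ((E + F) / 2) ^+ 2 - E * F by field.
rewrite p.
have h2 : ((E + F) / 2) ^+ 2 <= U ^+ 2 by rewrite ler_sqr ?nnegrE; lra.
have := sqr_ge0 (U ^+ 2 - 1); rewrite sqrrB1 -exprM /=; nra.
Qed.

(** The sharp constant is 1/2. The value 9/16 leaves room for an elementary bound on [0, 1/9], which
    repeated doubling carries to every argument. *)
Lemma cosh_le_expR x : (expR x + expR (- x)) / 2 <= expR (9 / 16 * x ^+ 2).
Proof.
wlog x0 : x / 0 <= x => [hw|].
  have [/hw//|x0] := leP 0 x; have := hw (- x); rewrite opprK sqrrN addrC; apply.
  by rewrite oppr_ge0 ltW.
suff H N : forall y, 0 <= y <= 2 ^+ N / 9 ->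
    (expR y + expR (- y)) / 2 <= expR (9 / 16 * y ^+ 2).
  have [N hN] : exists N : nat, 9 * x <= 2 ^+ N.
    exists (Num.bound (9 * x)); apply: le_trans (ltW (archi_boundP _)) _; first lra.
    by rewrite -natrX ler_nat ltnW// ltn_expl.
  by apply: (H N); rewrite x0/=; lra.
elim: N => [|N IH] y /andP[y0 yN].
  by apply: cosh_le_small; move: yN; rewrite expr0 y0.
have -> : y = 2 * (y / 2) by field.
by apply/cosh_le_double/IH; move: yN; rewrite exprS; lra.
Qed.

Lemma card_signs n : (#|{ffun 'I_n -> bool}|%:R : R) = 2 ^+ n.
Proof. by rewrite card_ffun card_bool card_ord natrX. Qed.

Lemma sum_expR_signed_sum_le n (w : 'I_n -> R) :
  \sum_(e : {ffun 'I_n -> bool}) expR (signed_sum e w) <=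
  2 ^+ n * expR (9 / 16 * \sum_(j < n) w j ^+ 2).
Proof.
rewrite sum_expR_signed_sum mulr_sumr expR_sum.
have -> : 2 ^+ n = \prod_(j < n) (2 : R) by rewrite prodr_const card_ord.
rewrite -big_split/=; apply: ler_prod => j _.
rewrite addr_ge0 ?expR_ge0//=.
have := cosh_le_expR (w j); lra.
Qed.

Lemma card_signed_sum_gt n (w : 'I_n -> R) (r q : R) : 0 <= r -> 0 <= q ->
  \sum_(j < n) w j ^+ 2 <= r ^+ 2 ->
  #|[pred e | 3 / 2 * q * r < signed_sum e w]|%:R <= 2 ^+ n * expR (- q ^+ 2).
Proof.
move=> r0 q0 wr; have [r_gt0|r_le0] := ltP 0 r; last first.
  have r00 : r = 0 by lra.
  rewrite (eq_card0 (A := [pred e | _])); last first.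
    move=> e; rewrite !inE r00 mulr0 /signed_sum big1 ?ltxx// => j _.
    have : w j ^+ 2 <= 0.
      apply: le_trans (_ : _ <= \sum_(i < n) w i ^+ 2) _; last by move: wr; rewrite r00 expr0n.
      by rewrite (bigD1 j)//= lerDl sumr_ge0// => i _; exact: sqr_ge0.
    by rewrite le_eqVlt ltNge sqr_ge0 orbF sqrf_eq0 => /eqP ->; rewrite mulr0.
  by rewrite mulr_ge0 ?expR_ge0 ?exprn_ge0.
(* This [l] minimizes 9/16 l^2 r^2 - 3/2 l q r in the Chernoff bound; the minimum is q^2 - 2 q^2 = -
   q^2. *)
pose l := 4 / 3 * q / r.
have l0 : 0 <= l by rewrite !mulr_ge0 ?invr_ge0// ltW.
have markov : #|[pred e | 3 / 2 * q * r < signed_sum e w]|%:R * expR (2 * q ^+ 2)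
    <= \sum_(e : {ffun 'I_n -> bool}) expR (signed_sum e (fun j => l * w j)).
  rewrite (bigID [pred e | 3 / 2 * q * r < signed_sum e w])/=.
  rewrite -[leLHS]addr0 lerD//; last by apply: sumr_ge0 => e _; exact: expR_ge0.
  rewrite mulrC -sum1_card natr_sum mulr_sumr; apply: ler_sum => e he.
  rewrite mulr1 ler_expR signed_sumZ.
  have -> : 2 * q ^+ 2 = l * (3 / 2 * q * r) by rewrite /l; field; lra.
  by rewrite ler_wpM2l// ltW.
have -> : - q ^+ 2 = q ^+ 2 - 2 * q ^+ 2 by ring.
rewrite expRB mulrA ler_pdivlMr ?expR_gt0//.
apply: le_trans markov _; apply: le_trans (sum_expR_signed_sum_le _) _.
rewrite ler_wpM2l ?exprn_ge0// ler_expR.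
under eq_bigr do rewrite exprMn.
rewrite -mulr_sumr.
have -> : q ^+ 2 = 9 / 16 * (l ^+ 2 * r ^+ 2) by rewrite /l; field; lra.
by rewrite !ler_wpM2l ?sqr_ge0.
Qed.

Lemma card_abs_signed_sum_gt n (w : 'I_n -> R) (r q : R) : 0 <= r -> 0 <= q ->
  \sum_(j < n) w j ^+ 2 <= r ^+ 2 ->
  #|[pred e | 3 / 2 * q * r < `|signed_sum e w|]|%:R
    <= 2 ^+ n * (2 * expR (- q ^+ 2)).
Proof.
move=> r0 q0 wr.
have h1 := card_signed_sum_gt r0 q0 wr.
have h2 : #|[pred e | 3 / 2 * q * r < signed_sum e (fun j => -1 * w j)]|%:R
    <= 2 ^+ n * expR (- q ^+ 2).
  apply: card_signed_sum_gt => //.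
  by under eq_bigr do rewrite exprMn sqrrN expr1n mul1r.
apply: le_trans (_ : _ <= 2 ^+ n * expR (- q ^+ 2) + 2 ^+ n * expR (- q ^+ 2)) _; last lra.
apply: le_trans (lerD h1 h2).
rewrite -natrD ler_nat -cardUI; apply: leq_trans (leq_addr _ _).
apply: subset_leq_card; apply/fintype.subsetP => e.
by rewrite !inE signed_sumZ mulN1r lter_normr.
Qed.

(* At level l the threshold is sqrt (ln (2 #|K l|)) + (l + 1) u: the square root
   pays for the number of centers, and (l + 1) u makes the failure
   probabilities of the levels summable. *)
Lemma card_signed_sum_chaining (I : Type) n (v : I -> 'I_n -> R) (D A u : R)
    (K : nat -> finType) (c : forall l, K l -> I) : 0 <= D -> 1 <= u ->
  (forall i, \sum_(j < n) v i j ^+ 2 <= D ^+ 2) ->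
  (forall l i, exists p, \sum_(j < n) (v i j - v (c l p) j) ^+ 2
                           <= (2 ^- l * D / 2) ^+ 2) ->
  (forall L, \sum_(l < L) 2 ^- l * Num.sqrt (ln (2 * #|K l|%:R)) <= A) ->
  #|[pred e | `[< exists i, D * (3 / 2 * A + 6 * u + 1) < `|signed_sum e (v i)| >]]|%:R
    <= 2 ^+ n * (2 * expR (- u ^+ 2)).
Proof.
move=> D0 u1 vD net Abound.
have [pi piP] : exists pi : forall l, I -> K l, forall l i,
    \sum_(j < n) (v i j - v (c l (pi l i)) j) ^+ 2 <= (2 ^- l * D / 2) ^+ 2.
  exists (fun l i => sval (cid (net l i))) => l i; exact: (svalP (cid (net l i))).
pose q l := Num.sqrt (ln (2 * #|K l|%:R)) + l.+1%:R * u.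
have q0 l : 0 <= q l by rewrite addr_ge0 ?sqrtr_ge0// mulr_ge0//; lra.
(* The coarser end of a link is nearest to the center [c l p] itself, not to the index being
   chained. Level [l] thus has only [#|K l|] links, and the union bound counts each center once. *)
pose link l (p : K l) : 'I_n -> R :=
  if l is l'.+1 then fun j => v (c l p) j - v (c l' (pi l' (c l p))) j
  else v (c l p).
have link_le l p : \sum_(j < n) link l p j ^+ 2 <= (2 ^- l * D) ^+ 2.
  case: l p => [|l] p /=; first by rewrite expr0 invr1 mul1r.
  apply: le_trans (piP _ _) _; rewrite le_eqVlt; apply/orP; left; apply/eqP.
  by rewrite [2 ^+ l.+1]exprS; field; rewrite expf_neq0.
pose bad l p := [pred e | 3 / 2 * q l * (2 ^- l * D) < `|signed_sum e (link l p)|].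
have good_chain (e : {ffun 'I_n -> bool}) l (p : K l) :
    (forall i (r : K i), (i <= l)%N -> e \notin bad i r) ->
    `|signed_sum e (v (c l p))| <= 3 / 2 * D * \sum_(i < l.+1) 2 ^- i * q i.
  elim: l p => [|l IH] p hb.
    have := hb 0%N p (leqnn _); rewrite inE -leNgt /= big_ord_recl big_ord0 addr0.
    by rewrite expr0 invr1 !mul1r mulrAC.
  have := hb l.+1 p (leqnn _); rewrite inE -leNgt /= signed_sumB => h1.
  have h2 := IH (pi l (c l.+1 p)) (fun i r il => hb i r (leqW il)).
  rewrite big_ord_recr/= mulrDr.
  have -> : 3 / 2 * D * (2 ^- l.+1 * q l.+1) = 3 / 2 * q l.+1 * (2 ^- l.+1 * D) by ring.
  apply: le_trans (lerD h2 h1).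
  by apply: le_trans (ler_normD _ _); rewrite addrC subrK.
(* At depth [n] every coordinate of the remainder is at most 2^-n D / 2, so its [n] signed terms add
   up to at most [D] for every sign pattern. This is the summand 1 in the threshold. *)
pose L := n.
have rest (e : {ffun 'I_n -> bool}) i :
    `|signed_sum e (fun j => v i j - v (c L (pi L i)) j)| <= D.
  set w := fun j => _.
  have hw : \sum_(j < n) w j ^+ 2 <= (2 ^- n * D / 2) ^+ 2 := piP L i.
  have wj j : `|w j| <= 2 ^- n * D / 2.
    rewrite -ler_sqr ?nnegrE ?mulr_ge0 ?invr_ge0 ?exprn_ge0// real_normK ?num_real//.
    apply: le_trans hw.
    by rewrite (bigD1 j)//= lerDl sumr_ge0// => j' _; exact: sqr_ge0.
  apply: le_trans (ler_norm_sum _ _ _) _.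
  under eq_bigr do rewrite normrM normrX normrN1 expr1n mul1r.
  apply: le_trans (ler_sum _ (fun j _ => wj j)) _.
  rewrite sumr_const card_ord -[leLHS]mulr_natl.
  have n2 : n%:R <= 2 ^+ n :> R by rewrite -natrX ler_nat ltnW// ltn_expl.
  rewrite [leLHS](_ : _ = (n%:R / 2 ^+ n) * D / 2); last by ring.
  have : n%:R / 2 ^+ n <= 1 :> R by rewrite ler_pdivrMr ?exprn_gt0// mul1r.
  have : 0 <= n%:R / 2 ^+ n :> R by rewrite divr_ge0 ?exprn_ge0.
  nra.
have qsum : \sum_(l < L.+1) 2 ^- l * q l <= A + 4 * u.
  under eq_bigr do rewrite mulrDr mulrA.
  rewrite big_split/=; apply: lerD; first exact: Abound.
  rewrite -mulr_suml ler_wpM2r//; first lra.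
  exact: sum_half_pow_index.
have incl e : `[< exists i, D * (3 / 2 * A + 6 * u + 1) < `|signed_sum e (v i)| >] ->
    exists l : 'I_L.+1, [exists p : K l, bad l p e].
  move=> /asboolP[i]; apply: contraPP => hb; apply/negP.
  rewrite -leNgt.
  have h1 : `|signed_sum e (v (c L (pi L i)))| <= 3 / 2 * D * \sum_(i < L.+1) 2 ^- i * q i.
    apply: good_chain => l r lL; apply: contra_notN hb => he.
    by exists (Ordinal (lL : (l < L.+1)%N)); apply/existsP; exists r.
  have h2 := rest e i; rewrite signed_sumB in h2.
  have h3 : `|signed_sum e (v i)| <= D + 3 / 2 * D * \sum_(i < L.+1) 2 ^- i * q i.
    by apply: le_trans (lerD h2 h1); apply: le_trans (ler_normD _ _); rewrite subrK.
  apply: le_trans h3 _.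
  have : D * \sum_(l < L.+1) 2 ^- l * q l <= D * (A + 4 * u) by rewrite ler_wpM2l.
  lra.
have bad_card l p : #|bad l p|%:R <= 2 ^+ n * (2 * expR (- q l ^+ 2)).
  by apply: card_abs_signed_sum_gt => //; rewrite mulr_ge0// invr_ge0 exprn_ge0.
(* [q l ^+ 2] dominates the logarithm of [2 * #|K l|%:R] plus u^2 + l, because (l + 1)^2 u^2 >= u^2
   + l for u >= 1. The proportion of failures at level [l] is then at most exp(- u^2) e^-l, and e^-l
   <= 2^-l sums to at most 2. *)
have level l : (\sum_(p : K l) #|bad l p|)%:R <= 2 ^+ n * (expR (- u ^+ 2) * 2 ^- l).
  rewrite natr_sum; apply: le_trans (ler_sum _ (fun p _ => bad_card l p)) _.
  rewrite sumr_const -mulrnAr ler_wpM2l ?exprn_ge0// -[leLHS]mulr_natl.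
  have [->|k0] := posnP #|K l|; first by rewrite mul0r mulr_ge0 ?expR_ge0 ?invr_ge0 ?exprn_ge0.
  have k1 : 1 <= #|K l|%:R :> R by rewrite ler1n.
  have ln0 : 0 <= ln (2 * #|K l|%:R) :> R by rewrite ln_ge0//; lra.
  have q2 : ln (2 * #|K l|%:R) + u ^+ 2 + l%:R <= q l ^+ 2.
    rewrite -{1}(sqr_sqrtr ln0) /q -[l.+1%:R]natr1.
    have := sqrtr_ge0 (ln (2 * #|K l|%:R) : R); have : 0 <= l%:R :> R by [].
    set s := Num.sqrt _; set l' := l%:R => l0 s0.
    have h1 : 0 <= s * ((l' + 1) * u) by rewrite !mulr_ge0//; lra.
    have h2 : 0 <= l' * (u ^+ 2 - 1) by rewrite mulr_ge0// subr_ge0 expr_ge1//; lra.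
    have h3 : 0 <= (l' ^+ 2) * u ^+ 2 by rewrite mulr_ge0 ?sqr_ge0.
    have -> : (s + (l' + 1) * u) ^+ 2 = s ^+ 2 + 2 * (s * ((l' + 1) * u))
        + (l' ^+ 2 * u ^+ 2 + 2 * (l' * (u ^+ 2 - 1)) + 2 * l' + u ^+ 2) by ring.
    lra.
  rewrite mulrA [_ * 2]mulrC.
  apply: le_trans (_ : _ <= (2 * #|K l|%:R) * expR (- (ln (2 * #|K l|%:R) + u ^+ 2 + l%:R))) _.
    by rewrite ler_wpM2l ?ler_expR ?lerN2//; lra.
  have -> : expR (- (ln (2 * #|K l|%:R) + u ^+ 2 + l%:R)) =
      (expR (ln (2 * #|K l|%:R)))^-1 * (expR (- u ^+ 2) * expR (- l%:R)) :> R.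
    by rewrite -expRN -!expRD; congr expR; ring.
  rewrite lnK ?posrE; last lra.
  rewrite mulrA divff ?mul1r; last by rewrite gt_eqF//; lra.
  rewrite ler_wpM2l ?expR_ge0//.
  rewrite expRN lef_pV2 ?posrE ?expR_gt0 ?exprn_gt0//.
  rewrite -[l%:R]mulr1 expRM_natl lerXn2r ?nnegrE ?expR_ge0//.
  by have := expR_ge1Dx (1 : R); lra.
apply: le_trans (_ : _ <= (\sum_(l < L.+1) \sum_(p : K l) #|bad l p|)%:R) _.
  rewrite ler_nat; apply: leq_trans (card_le_sum incl) _.
  apply: leq_sum => l _; apply: card_le_sum => e /existsP[p hp]; by exists p.
rewrite natr_sum; apply: le_trans (ler_sum _ (fun (l : 'I_L.+1) _ => level l)) _.
rewrite -mulr_sumr -mulr_sumr ler_wpM2l ?exprn_ge0// mulrC ler_wpM2r ?expR_ge0//.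
by rewrite sum_half_pow gerBl divr_ge0// exprn_ge0.
Qed.

End Rademacher.

(** * Independent samples *)

Section IidSample.
Context {R : realType} d d' (Omega : measurableType d) (T : measurableType d').
Context (P : probability Omega R) (Z : nat -> {RV P >-> T}).
Context (Q : probability T R).

(** The positions [s] are arbitrary, so that exchanging observations with their ghost copies only
    changes [s]. *)
Definition sample n (s : n.-tuple nat) (w : Omega) : n.-tuple T :=
  [tuple Z (tnth s j) w | j < n].

Lemma measurable_sample n (s : n.-tuple nat) : measurable_fun setT (sample s).
Proof.
apply/measurable_fun_tnthP => i.
rewrite (_ : _ \o _ = Z (tnth s i)); first exact: measurable_funPT.
by apply/funext => w /=; rewrite tnth_mktuple.
Qed.

HB.instance Definition _ n (s : n.-tuple nat) :=
  isMeasurableFun.Build _ _ _ _ (sample s) (measurable_sample s).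

Definition rectangle (s : seq nat) (A : nat -> set T) : set Omega :=
  \bigcap_(j in [set` s]) (Z j @^-1` A j).

Lemma rectangle_cons x s A :
  rectangle (x :: s) A = Z x @^-1` A x `&` rectangle s A.
Proof.
apply/seteqP; split=> w h; first split.
  by apply: h; rewrite /= mem_head.
- by move=> j js; apply: h => /=; rewrite inE js orbT.
case: h => hx hs j /=; rewrite inE => /orP[/eqP->//|]; exact: hs.
Qed.

Lemma measurable_rectangle s A : (forall j, measurable (A j)) ->
  measurable (rectangle s A).
Proof.
move=> mA; apply: fin_bigcap_measurable => // j _.
by rewrite -[X in measurable X]setTI; exact: measurable_funPT.
Qed.

(** The event [E] carries the induction: the condition on the first coordinate is absorbed into it
    before the remaining ones are treated. Conditioning on [E] gives a measure on pairs that agrees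
    with the product on rectangles, hence everywhere. *)
Lemma independent_sample (E : set Omega) n (s : n.-tuple nat) B :
  measurable E -> uniq s ->
  (forall A, (forall j, measurable (A j)) ->
    P (E `&` rectangle s A) = (P E * \prod_(j <- s) Q (A j))%E) ->
  measurable B ->
  P (E `&` sample s @^-1` B) = (P E * power_probability Q n B)%E.
Proof.
elim: n => [|n IH] in E s B *.
  move=> mE _ _ mB; rewrite /= diracE.
  have [h|h] := boolP ([tuple] \in B).
    rewrite mule1 (_ : sample s @^-1` B = setT) ?setIT//.
    by apply/seteqP; split=> // w _ /=; rewrite [sample s w]tuple0; exact/set_mem.
  rewrite mule0 (_ : sample s @^-1` B = set0) ?setI0 ?measure0//.
  apply/seteqP; split=> // w /=; rewrite [sample s w]tuple0 => hB.
  by move: h; rewrite notin_setE; exact.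
case/tupleP: s => x s mE /= /andP[xs us] hE mB.
have [PE0|PE0] := eqVneq (P E) 0%E.
  rewrite PE0 mul0e; apply/eqP; rewrite -measure_le0 -PE0 le_measure ?inE//.
  by apply: measurableI => //; rewrite -[X in measurable X]setTI; exact: measurable_sample.
have PEfin : P E \is a fin_num by exact: fin_num_measure.
have PEgt0 : 0 < fine (P E).
  by rewrite fine_gt0// lt0e PE0 measure_ge0/= ltey_eq PEfin.
pose phi w := (Z x w, sample s w).
have mphi : measurable_fun setT phi.
  by apply/measurable_fun_pair => //; exact: measurable_sample.
(* Dividing by the probability of [E] turns the image of [P] restricted to [E] into a candidate for
   the product measure; the case of a null [E] has been set aside. *)
pose r : {nonneg R} := NngNum (ltW (divr_gt0 (@ltr01 R) PEgt0)).
pose m'_ : measure (T * n.-tuple T)%type R := mscale r (pushforward (mrestr P mE) phi).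
pose m' := m'_ mphi.
have hm' : forall A C, measurable A -> measurable C ->
    m' (A `*` C) = (Q A * power_probability Q n C)%E.
  move=> A C mA mC.
  have mEA : measurable (E `&` Z x @^-1` A).
    by apply: measurableI => //; rewrite -[X in measurable X]setTI; exact: measurable_funPT.
  have hx A' : measurable A' -> P (E `&` Z x @^-1` A') = (P E * Q A')%E.
    move=> mA'; have := hE (fun j => if j == x then A' else setT).
    rewrite rectangle_cons eqxx big_cons eqxx.
    rewrite (_ : rectangle s _ = setT) ?setIT; last first.
      apply/seteqP; split=> // w _ j /= js.
      by case: eqVneq js xs => // -> ->.
    rewrite big1_seq ?mule1 => [->//|j /andP[_ js]]; first by move=> j; case: ifP.
    by case: eqVneq js xs => [-> ->//|_ _ _]; rewrite probability_setT.
  rewrite [m' _](_ : _ = r%:num%:E * P (phi @^-1` (A `*` C) `&` E))%E//.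
  rewrite (_ : _ `&` E = (E `&` Z x @^-1` A) `&` sample s @^-1` C); last first.
    by rewrite setIC -setIA.
  rewrite IH// => [|A_ mA_].
    rewrite hx// -(fineK PEfin) !muleA -EFinM /= mul1r mulVf ?mul1e// gt_eqF//.
  rewrite hx//.
  have := hE (fun j => if j == x then A else A_ j).
  rewrite rectangle_cons eqxx big_cons eqxx setIA.
  have -> : rectangle s (fun j => if j == x then A else A_ j) = rectangle s A_.
    by apply: eq_bigcapr => j /= js; case: eqVneq js xs => // -> ->.
  move=> ->; last by move=> j; case: ifP.
  rewrite muleA; congr (_ * _)%E; apply: eq_big_seq => j js.
  by case: eqVneq js xs => // -> ->.
have mB' : measurable (@tuple_cons _ T n @^-1` B).
  by rewrite -[X in measurable X]setTI; exact: measurable_tuple_cons.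
have prodE := product_measure_unique hm' mB'.
transitivity (P E * (r%:num%:E * P (phi @^-1` (@tuple_cons _ T n @^-1` B) `&` E)))%E;
  last by congr (_ * _)%E; exact: esym prodE.
rewrite muleA -{1}(fineK PEfin) -EFinM /= mul1r mulfV ?mul1e ?gt_eqF// setIC.
congr (P (_ `&` _)); apply/seteqP; split=> w /=; rewrite [tuple_cons _](_ : _ = sample [tuple of x :: s] w)//.
  all: apply: eq_from_tnth => i; rewrite tnth_mktuple.
  all: by case: (unliftP ord0 i) => [j|] ->; rewrite ?tnth0// !tnthS tnth_mktuple.
Qed.

Context (Ziid : iid_with_law Z Q).

Lemma iid_rectangle s A : uniq s -> (forall j, measurable (A j)) ->
  P (rectangle s A) = (\prod_(j <- s) Q (A j))%E.
Proof.
case: Ziid => ind law us mA; rewrite /rectangle ind//.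
by apply: eq_bigr => j _; exact: law.
Qed.

Lemma sample_law n (s : n.-tuple nat) B : uniq s -> measurable B ->
  P (sample s @^-1` B) = power_probability Q n B.
Proof.
move=> us mB; rewrite -[_ @^-1` _]setTI independent_sample//.
  by rewrite probability_setT mul1e.
by move=> A mA; rewrite setTI iid_rectangle// probability_setT mul1e.
Qed.

(** [independent_sample] is used twice: the outer use takes for [E] the event on [s], and its
    condition on rectangles follows from an inner use in which [E] is a rectangle over [s']. *)
Lemma sample_independent n n' (s : n.-tuple nat) (s' : n'.-tuple nat) A B :
  uniq (s ++ s') -> measurable A -> measurable B ->
  P (sample s @^-1` A `&` sample s' @^-1` B) =
  (power_probability Q n A * power_probability Q n' B)%E.
Proof.
rewrite cat_uniq => /and3P[us /hasPn ss' us'] mA mB.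
have mpre n'' (s'' : n''.-tuple nat) C : measurable C -> measurable (sample s'' @^-1` C).
  by move=> mC; rewrite -[X in measurable X]setTI; exact: measurable_sample.
rewrite independent_sample ?sample_law//; first exact: mpre.
move=> A' mA'; rewrite setIC independent_sample//; first by rewrite muleC iid_rectangle.
  exact: measurable_rectangle.
move=> A'' mA''.
have -> : rectangle s' A' `&` rectangle s A'' =
    rectangle (s' ++ s) (fun j => if j \in tval s' then A' j else A'' j).
  apply/seteqP; split=> w.
    case=> h1 h2 j /=; rewrite mem_cat; case: ifPn => js'; first by move=> _; exact: h1.
    by move=> /= js; exact: h2.
  move=> h; split=> j /= js; first by have := h j; rewrite /= mem_cat js; exact.
  have := h j; rewrite /= mem_cat js orbT => /(_ isT).
  case: ifPn => // js'; by have := ss' _ js'; rewrite js.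
rewrite !iid_rectangle//; last 2 first.
- by rewrite cat_uniq us us' andbT/=; apply/hasPn => j js; apply: contraL js => /ss'.
- by move=> j; case: ifP.
rewrite big_cat/=; congr (_ * _)%E; apply: eq_big_seq => j js.
  by rewrite js.
by case: ifPn => // /ss'; rewrite js.
Qed.

End IidSample.

(** * Moments of sums of i.i.d. observations *)

Section SquareIntegrable.
Context {R : realType} d (T : measurableType d) (mu : probability T R).

Lemma Lfun2P (f : T -> R) :
  f \in Lfun mu 2%:E <->
  measurable_fun setT f /\ ('N[mu]_2%:E[EFin \o f] < +oo)%E.
Proof.
split => [/andP[h1 h2]|[h1 h2]]; first by move: h1 h2; rewrite !inE.
by apply/andP; split; rewrite inE.
Qed.
Lemma Lfun2_integrable (f : T -> R) :
  f \in Lfun mu 2%:E -> mu.-integrable setT (EFin \o f).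
Proof.
move=> f2; have f1 := Lfun_subset12 (fin_num_measure mu _ measurableT) f2.
exact/Lfun1_integrable.
Qed.

Lemma Lfun2_sum (s : seq nat) (f : nat -> T -> R) :
  (forall j, f j \in Lfun mu 2%:E) ->
  (fun w => \sum_(j <- s) f j w) \in Lfun mu 2%:E.
Proof.
move=> f2; elim: s => [|x s IH].
  rewrite (_ : (fun w => _) = cst 0); first exact: Lfun_cst.
  by apply/funext => w; rewrite big_nil.
rewrite (_ : (fun w => _) = f x \+ (fun w => \sum_(j <- s) f j w)).
  by rewrite rpredD ?lee1n//; exact: IH.
by apply/funext => w; rewrite big_cons.
Qed.

End SquareIntegrable.

Section IidMoments.
Context {R : realType} d d' (Omega : measurableType d) (T : measurableType d').
Context (P : probability Omega R) (Z : nat -> {RV P >-> T}).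
Context (Q : probability T R) (Ziid : iid_with_law Z Q).

Lemma ge0_integral_iid j (g : T -> \bar R) : measurable_fun setT g ->
  (forall x, (0 <= g x)%E) -> (\int[P]_w g (Z j w) = \int[Q]_x g x)%E.
Proof.
move=> mg g0; have := ge0_integral_distribution (P := P) (Z j) mg g0.
move=> <-; apply: eq_measure_integral => A mA _; exact: Ziid.2.
Qed.

Lemma integrable_iid (j : nat) (g : T -> \bar R) :
  Q.-integrable setT g -> P.-integrable setT (g \o Z j).
Proof.
move=> /integrableP[mg gfin]; apply/integrableP; split.
  by apply: measurableT_comp => //; exact: measurable_funPT.
rewrite (ge0_integral_iid j (g := fun x => `|g x|%E))//.
exact: measurableT_comp.
Qed.

Lemma integral_iid j (g : T -> \bar R) : Q.-integrable setT g ->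
  (\int[P]_w g (Z j w) = \int[Q]_x g x)%E.
Proof.
move=> ig; have mg := measurable_int _ ig.
have := integral_distribution (P := P) (X := Z j) mg (integrable_iid j ig).
move=> <-; apply: eq_measure_integral => A mA _; exact: Ziid.2.
Qed.

Lemma Rintegral_iid j (g : T -> R) : Q.-integrable setT (EFin \o g) ->
  \int[P]_w g (Z j w) = \int[Q]_x g x.
Proof. by move=> ig; rewrite /Rintegral (integral_iid j ig). Qed.

Lemma Lnorm2_iid j (f : T -> R) : measurable_fun setT f ->
  'N[P]_2%:E[EFin \o (f \o Z j)]%E = 'N[Q]_2%:E[EFin \o f]%E.
Proof.
move=> mf; rewrite unlock /=; congr (_ `^ _)%E.
rewrite (ge0_integral_iid j (g := fun x => (`|(f x)%:E| `^ 2)%E))//.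
  apply: (measurableT_comp (measurable_poweR 2)).
  by apply: (measurableT_comp (abse_measurable (D := setT))); exact/measurable_EFinP.
by move=> x; exact: poweR_ge0.
Qed.

Lemma Lfun2_iid j (f : T -> R) : f \in Lfun Q 2%:E -> f \o Z j \in Lfun P 2%:E.
Proof.
move=> /Lfun2P[mf fin]; apply/Lfun2P; split; last by rewrite Lnorm2_iid.
by apply: measurableT_comp => //; exact: measurable_funPT.
Qed.

(** Independence identifies the joint law of [Z i] and [Z j] with [Q \x Q], first on rectangles and
    then everywhere; Fubini splits the integral. *)
Lemma integral_iid_mul i j (f g : T -> R) : i != j ->
  f \in Lfun Q 2%:E -> g \in Lfun Q 2%:E ->
  (\int[P]_w (f (Z i w) * g (Z j w))%:E =
   \int[Q]_x (f x)%:E * \int[Q]_x (g x)%:E)%E.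
Proof.
move=> ij f2 g2.
have mf := (Lfun2P _ _).1 f2; have mg := (Lfun2P _ _).1 g2.
have if1 := Lfun2_integrable f2; have ig1 := Lfun2_integrable g2.
pose phi w := (Z i w, Z j w).
have mphi : measurable_fun setT phi by apply/measurable_fun_pair; exact: measurable_funPT.
pose phim : {mfun Omega >-> (T * T)%type} :=
  HB.pack phi (isMeasurableFun.Build _ _ _ _ phi mphi).
have law A : measurable A -> (Q \x Q)%E A = distribution P phim A.
  move=> mA; apply: product_measure_unique => // B C mB mC.
  have [ind law] := Ziid.
  have := ind [:: i; j] (fun k => if k == i then B else C).
  rewrite !big_cons big_nil mule1 eqxx [j == i]eq_sym (negbTE ij) /= => h.
  transitivity (P (\bigcap_(k in [set` [:: i; j]]) (Z k @^-1` (if k == i then B else C)))).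
    rewrite /distribution /pushforward; congr (P _); apply/seteqP; split => w /=.
      by move=> [hB hC] k /=; rewrite !inE => /orP[|] /eqP ->; rewrite ?eqxx// [j == i]eq_sym (negbTE ij).
    move=> h'; split; first by have := h' i; rewrite /= !inE eqxx; exact.
    by have := h' j; rewrite /= !inE eqxx orbT [j == i]eq_sym (negbTE ij); exact.
  rewrite h; last 2 first.
  - by rewrite /= inE ij.
  - by move=> k; case: ifP.
  by congr (_ * _)%E; exact: law.
pose F (z : T * T) := (f z.1 * g z.2)%:E.
have mF : measurable_fun setT F.
  apply/measurable_EFinP; apply: measurable_funM; apply: measurableT_comp => //.
  exact: mf.1. exact: mg.1.
have iFP : P.-integrable setT (F \o phim).
  by apply/Lfun1_integrable; apply: Lfun2_mul_Lfun1; exact: Lfun2_iid.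
have iF : (Q \x Q)%E.-integrable setT F.
  apply/integrableP; split => //.
  rewrite (eq_measure_integral (distribution P phim)); last by move=> A mA _; exact: law.
  rewrite ge0_integral_distribution//; last exact: (measurableT_comp (abse_measurable (D := setT)) mF).
  by have /integrableP[] := iFP.
transitivity (\int[Q \x Q]_z F z)%E.
  rewrite (eq_measure_integral (distribution P phim)); last by move=> A mA _; exact: law.
  by rewrite integral_distribution.
rewrite -integral12_prod_meas1//.
transitivity (\int[Q]_x ((f x)%:E * \int[Q]_y (g y)%:E))%E.
  apply: eq_integral => x _; rewrite /fubini_F /F /=.
  under eq_integral do rewrite EFinM.
  by rewrite integralZl.
rewrite -(fineK (integrable_fin_num _ ig1))//.
by rewrite integralZr.
Qed.

Lemma covariance_sum_iid (s : seq nat) x (f : T -> R) : f \in Lfun Q 2%:E -> x \notin s ->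
  covariance P (f \o Z x) (fun w => \sum_(j <- s) f (Z j w)) = 0%E.
Proof.
move=> f2; have fZ j := Lfun2_iid j f2.
have Pfin := fin_num_measure P _ measurableT.
have fZ1 j := Lfun_subset12 Pfin (fZ j).
elim: s => [|y s IH]; first by rewrite [X in covariance _ _ X](_ : _ = cst 0)
  ?covariance_cst_r//; apply/funext => w; rewrite big_nil.
rewrite inE negb_or => /andP[xy xs].
rewrite [X in covariance _ _ X](_ : _ = (f \o Z y) \+ (fun w => \sum_(j <- s) f (Z j w)));
  last by apply/funext => w; rewrite big_cons.
rewrite covarianceDr//; last exact: (Lfun2_sum _ fZ).
rewrite IH// adde0 covarianceE//; last exact: Lfun2_mul_Lfun1.
rewrite unlock [X in (X - _)%E](integral_iid_mul xy f2 f2).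
have if1 := Lfun2_integrable f2.
rewrite (integral_iid x if1) (integral_iid y if1) subee//.
by rewrite fin_numM// integrable_fin_num.
Qed.

Lemma variance_sum_iid (s : seq nat) (f : T -> R) : f \in Lfun Q 2%:E -> uniq s ->
  ('V_P[(fun w => \sum_(j <- s) f (Z j w))%R]
   <= (size s)%:R%:E * \int[Q]_x (f x ^+ 2)%:E)%E.
Proof.
move=> f2; have fZ j := Lfun2_iid j f2.
elim: s => [_|x s IH /= /andP[xs us]].
  rewrite (_ : (fun w => _) = cst 0); first by rewrite variance_cst mul0e.
  by apply/funext => w; rewrite big_nil.
rewrite (_ : (fun w => _) = (f \o Z x) \+ (fun w => \sum_(j <- s) f (Z j w)));
  last by apply/funext => w; rewrite big_cons.
rewrite varianceD//; last exact: (Lfun2_sum _ fZ).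
rewrite covariance_sum_iid// mule0 adde0 -natr1 EFinD addrC muleDl//; last first.
  by apply: (integrable_fin_num _ (Lfun2_integrable_sqr f2)).
rewrite mul1e leeD ?IH// varianceE// unlock.
have if2 := Lfun2_integrable_sqr f2.
rewrite [X in (X - _)%E](integral_iid x if2) leeBlDr; last first.
  by rewrite fin_numX// integrable_fin_num//; exact: (Lfun2_integrable (fZ x)).
by rewrite leeDl// sqre_ge0.
Qed.

Lemma expectation_sum_iid (s : seq nat) (f : T -> R) : f \in Lfun Q 2%:E ->
  ('E_P[(fun w => \sum_(j <- s) f (Z j w))%R] = ((size s)%:R * \int[Q]_x f x)%R%:E)%E.
Proof.
move=> f2; have fZ j := Lfun2_iid j f2.
have Pfin := fin_num_measure P _ measurableT.
have fZ1 j := Lfun_subset12 Pfin (fZ j).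
have if1 := Lfun2_integrable f2.
elim: s => [|x s IH].
  rewrite (_ : (fun w => _) = cst 0); first by rewrite expectation_cst mul0r.
  by apply/funext => w; rewrite big_nil.
rewrite (_ : (fun w => _) = (f \o Z x) \+ (fun w => \sum_(j <- s) f (Z j w)));
  last by apply/funext => w; rewrite big_cons.
rewrite expectationD//; last exact: (Lfun_subset12 Pfin (Lfun2_sum _ fZ)).
rewrite IH unlock [X in (X + _)%E](integral_iid x if1) /= -natr1 mulrDl mul1r addrC EFinD.
by rewrite fineK// integrable_fin_num.
Qed.

(** The threshold is twice the bound sqrt n X on the standard deviation of the sum, whence 1/4. *)
Lemma chebyshev_iid n (s : n.-tuple nat) (f : T -> R) (X : R) : (0 < n)%N -> 0 < X ->
  f \in Lfun Q 2%:E -> uniq s -> (\int[Q]_x (f x ^+ 2)%:E <= (X ^+ 2)%:E)%E ->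
  (P [set w | (2 * Num.sqrt n%:R * X <=
       `|\sum_(j <- s) f (Z j w) - n%:R * \int[Q]_x f x|)%R] <= (1 / 4)%:E)%E.
Proof.
move=> n0 X0 f2 us fX.
have fZ j := Lfun2_iid j f2.
have S2 := Lfun2_sum s fZ.
pose S : {mfun Omega >-> R} := HB.pack (fun w => \sum_(j <- s) f (Z j w))
  (isMeasurableFun.Build _ _ _ _ _ ((Lfun2P P _).1 S2).1).
have ES : fine ('E_P[S])%E = n%:R * \int[Q]_x f x.
  by rewrite expectation_sum_iid//= size_tuple.
have e0 : 0 < 2 * Num.sqrt n%:R * X by rewrite !mulr_gt0// sqrtr_gt0 ltr0n.
rewrite -ES; apply: le_trans (chebyshev S e0) _.
have V : ('V_P[S] <= (n%:R * X ^+ 2)%:E)%E.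
  apply: le_trans (variance_sum_iid f2 us) _; rewrite size_tuple EFinM.
  by rewrite lee_pmul2l// lte_fin ltr0n.
apply: le_trans (lee_wpmul2l _ V) _; first by rewrite lee_fin invr_ge0 exprn_ge0// ltW.
rewrite -EFinM lee_fin !exprMn sqr_sqrtr ?ler0n//.
rewrite le_eqVlt; apply/orP; left; apply/eqP; field.
by rewrite gt_eqF//= pnatr_eq0 -lt0n n0.
Qed.

End IidMoments.

(** * Symmetrization *)

Section MeasurableComparison.
Context {R : realType} d (T : measurableType d).
Implicit Types (f : T -> R) (c : R).

Lemma measurable_set_le f c : measurable_fun setT f -> measurable [set x | f x <= c].
Proof.
move=> mf; rewrite (_ : [set x | _] = setT `&` f @^-1` `]-oo, c]); first exact: mf.
by rewrite setTI; apply/seteqP; split=> x /=; rewrite in_itv.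
Qed.

Lemma measurable_set_lt f c : measurable_fun setT f -> measurable [set x | c < f x].
Proof.
move=> mf; rewrite (_ : [set x | _] = setT `&` f @^-1` `]c, +oo[); first exact: mf.
by rewrite setTI; apply/seteqP; split=> x /=; rewrite in_itv/= andbT.
Qed.

Lemma measurable_fun_sum_tnth n (g : T -> R) : measurable_fun setT g ->
  measurable_fun setT (fun x : n.-tuple T => \sum_(j < n) g (tnth x j)).
Proof.
move=> mg; apply: measurable_sum => j.
exact: (measurableT_comp mg (measurable_tnth j)).
Qed.

End MeasurableComparison.

Section Symmetrization.
Context {R : realType} d d' (Omega : measurableType d) (T : measurableType d').
Context (P : probability Omega R) (Z : nat -> {RV P >-> T}).
Context (Q : probability T R) (Ziid : iid_with_law Z Q).
Context (n : nat) (n_gt0 : (0 < n)%N).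

(** Where [e j] holds, observation [j] and its ghost [n + j] trade places. The positions remain
    distinct, so the resulting sample has the same law for every [e]. *)
Definition swap_tuple (e : {ffun 'I_n -> bool}) : (n + n).-tuple nat :=
  [tuple match fintype.split k with
         | inl j => if e j then (n + j)%N else nat_of_ord j
         | inr j => if e j then nat_of_ord j else (n + j)%N
         end | k < n + n].

Lemma swap_tuple_uniq e : uniq (swap_tuple e).
Proof.
apply/tuple_uniqP => k k'; rewrite !tnth_mktuple.
have := ltn_ord k; have := ltn_ord k'.
case: fintype.splitP => j hj; case: fintype.splitP => j' hj' k'n kn h; apply/val_inj => /=.
all: have jn := ltn_ord j; have j'n := ltn_ord j'; move: h; rewrite hj hj'.
all: case: ifPn => ej; case: ifPn => ej' h.
all: try lia.
all: have E : j = j' by apply/val_inj => /=; lia.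
all: by move: ej ej'; rewrite E; case: (e j').
Qed.

Lemma sample_swap_lshift e j w :
  tnth (sample Z (swap_tuple e) w) (lshift n j) = Z (if e j then (n + j)%N else j) w.
Proof. by rewrite !tnth_mktuple (unsplitK (inl j)). Qed.

Lemma sample_swap_rshift e j w :
  tnth (sample Z (swap_tuple e) w) (rshift n j) = Z (if e j then nat_of_ord j else (n + j)%N) w.
Proof. by rewrite !tnth_mktuple (unsplitK (inr j)). Qed.

Context (h : nat -> T -> R) (Xi : T -> R) (X y p : R).
Context (h2 : forall i, h i \in Lfun Q 2%:E) (Xi2 : Xi \in Lfun Q 2%:E).
Context (hXi : forall i z, `|h i z| <= Xi z) (X_gt0 : 0 < X) (p_ge0 : 0 <= p).
Context (XiX : (\int[Q]_x (Xi x ^+ 2)%:E <= (X ^+ 2)%:E)%E).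
Context (rademacher : forall x x' : 'I_n -> T,
  \sum_(j < n) Xi (x j) ^+ 2 + \sum_(j < n) Xi (x' j) ^+ 2 <= 6 * n%:R * X ^+ 2 ->
  #|[pred e | `[< exists i, y < `|signed_sum e (fun j => h i (x j) - h i (x' j))| >]]|%:R
    <= 2 ^+ n * p).

Let mh i : measurable_fun setT (h i) := ((Lfun2P _ _).1 (h2 i)).1.
Let mXi : measurable_fun setT Xi := ((Lfun2P _ _).1 Xi2).1.
Let mXi2 : measurable_fun setT (fun z => Xi z ^+ 2).
Proof. exact: measurable_funX. Qed.

(** The first [n] coordinates are the sample, the last [n] the ghost. The bound 6 n X^2 adds the 2 n
    X^2 granted to the sample to the 4 n X^2 granted to the ghost; the sum it controls is invariant
    under swaps. *)
Definition pair_event : set ((n + n).-tuple T) :=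
  [set x | \sum_(j < n) Xi (tnth x (lshift n j)) ^+ 2
           + \sum_(j < n) Xi (tnth x (rshift n j)) ^+ 2 <= 6 * n%:R * X ^+ 2] `&`
  \bigcup_i [set x | y < `|\sum_(j < n) (h i (tnth x (lshift n j)) - h i (tnth x (rshift n j)))|].

Lemma measurable_pair_event : measurable pair_event.
Proof.
apply: measurableI.
  apply: measurable_set_le; apply: measurable_funD; apply: measurable_sum => j;
  exact: (measurableT_comp mXi2 (measurable_tnth _)).
apply: bigcup_measurable => i _; apply: measurable_set_lt.
apply: (measurableT_comp (@normr_measurable R setT)); apply: measurable_sum => j; apply: measurable_funB;
exact: (measurableT_comp (mh i) (measurable_tnth _)).
Qed.

(** All swapped events have the same probability, which is therefore the expected proportion of sign
    patterns that are bad for the observed pair of samples. The Rademacher bound controls this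
    proportion pointwise. *)
Lemma pair_event_le : (P (sample Z (swap_tuple [ffun=> false]) @^-1` pair_event) <= p%:E)%E.
Proof.
pose E e := sample Z (swap_tuple e) @^-1` pair_event.
have mE e : measurable (E e).
  by rewrite -[X in measurable X]setTI; apply: measurable_sample => //; exact: measurable_pair_event.
have PE e : P (E e) = P (E [ffun=> false]).
  by rewrite /E !(sample_law Ziid) ?swap_tuple_uniq//; exact: measurable_pair_event.
have count w : #|[pred e | w \in E e]|%:R <= 2 ^+ n * p.
  have sumE (e : {ffun 'I_n -> bool}) :
      \sum_(j < n) Xi (tnth (sample Z (swap_tuple e) w) (lshift n j)) ^+ 2
      + \sum_(j < n) Xi (tnth (sample Z (swap_tuple e) w) (rshift n j)) ^+ 2 =
      \sum_(j < n) Xi (Z j w) ^+ 2 + \sum_(j < n) Xi (Z (n + j)%N w) ^+ 2.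
    rewrite -!big_split/=; apply: eq_bigr => j _.
    by rewrite sample_swap_lshift sample_swap_rshift; case: (e j) => //; rewrite addrC.
  have [small|large] := leP (\sum_(j < n) Xi (Z j w) ^+ 2 + \sum_(j < n) Xi (Z (n + j)%N w) ^+ 2)
      (6 * n%:R * X ^+ 2); last first.
    rewrite (eq_card0 (A := [pred e | _])) ?mulr_ge0 ?exprn_ge0// => e.
    apply/negbTE/negP => /set_mem []/=.
    by rewrite sumE leNgt large.
  apply: le_trans (rademacher small); rewrite ler_nat; apply: subset_leq_card.
  apply/fintype.subsetP => e /set_mem [_ [i _ /= hi]].
  apply/asboolP; exists i; apply: lt_le_trans hi _; rewrite le_eqVlt; apply/orP; left.
  apply/eqP; congr (`| _ |); apply: eq_bigr => j _.
  rewrite sample_swap_lshift sample_swap_rshift; case: (e j); last by rewrite mul1r.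
  by rewrite expr1 mulN1r opprB.
have sumP : (\sum_(e : {ffun 'I_n -> bool}) P (E e) <= (2 ^+ n * p)%:E)%E.
  rewrite [leLHS](eq_bigr (fun e => \int[P]_(w in setT) (\1_(E e) w)%:E)%E); last first.
    by move=> e _; rewrite integral_indic// setIT.
  rewrite -ge0_integral_sum//; last by move=> e; apply/measurable_EFinP; exact: measurable_indic.
  rewrite -[leRHS]mule1 -(probability_setT P) -integral_cst//.
  apply: ge0_le_integral => //.
  - by move=> w _; apply: sume_ge0 => e _; rewrite lee_fin.
  - apply: emeasurable_sum => e; apply/measurable_EFinP; exact: measurable_indic.
  move=> w _; rewrite sumEFin lee_fin; apply: le_trans (count w).
  rewrite le_eqVlt; apply/orP; left; apply/eqP.
  rewrite -sum1_card natr_sum [RHS]big_mkcond; apply: eq_bigr => e _.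
  by rewrite indicE inE; case: (w \in E e).
have PE0fin : P (E [ffun=> false]) \is a fin_num by exact: fin_num_measure.
move: sumP; under eq_bigr do rewrite PE.
rewrite -(fineK PE0fin) sumEFin sumr_const !lee_fin -[leLHS]mulr_natl card_signs.
by rewrite ler_pM2l// exprn_gt0.
Qed.

Definition ghost_good i : set (n.-tuple T) :=
  [set x | `|\sum_(j < n) h i (tnth x j) - n%:R * \int[Q]_z h i z| < 2 * Num.sqrt n%:R * X] `&`
  [set x | \sum_(j < n) Xi (tnth x j) ^+ 2 <= 4 * n%:R * X ^+ 2].

Lemma measurable_deviation i :
  measurable_fun setT (fun x : n.-tuple T =>
    `|\sum_(j < n) h i (tnth x j) - n%:R * \int[Q]_z h i z|).
Proof.
apply: (measurableT_comp (@normr_measurable R setT)).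
by apply: measurable_funB => //; exact: measurable_fun_sum_tnth.
Qed.

Lemma measurable_ghost_good i : measurable (ghost_good i).
Proof.
apply: measurableI; last first.
  by apply: measurable_set_le; exact: (measurable_fun_sum_tnth mXi2).
rewrite (_ : [set x | _] = ~` [set x | 2 * Num.sqrt n%:R * X <=
    `|\sum_(j < n) h i (tnth x j) - n%:R * \int[Q]_z h i z|]).
  apply: measurableC.
  rewrite (_ : [set x | _] = setT `&` (fun x : n.-tuple T => `|\sum_(j < n) h i (tnth x j)
      - n%:R * \int[Q]_z h i z|) @^-1` `[2 * Num.sqrt n%:R * X, +oo[).
    exact: measurable_deviation.
  by rewrite setTI; apply/seteqP; split=> x /=; rewrite in_itv/= andbT.
by apply/seteqP; split=> x /=; rewrite ltNge => /negP.
Qed.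

(** Chebyshev bounds the failure of the first condition by 1/4. Markov, applied to a sum of mean at
    most n X^2 and the threshold 4 n X^2, does the same for the second. *)
Lemma ghost_ge_half i (s : n.-tuple nat) : uniq s ->
  ((1 / 2)%:E <= P (sample Z s @^-1` ghost_good i))%E.
Proof.
move=> us.
have sumE (f : T -> R) w : \sum_(j < n) f (tnth (sample Z s w) j) = \sum_(j <- s) f (Z j w).
  by rewrite big_tuple; apply: eq_bigr => j _; rewrite tnth_mktuple.
have mG : measurable (sample Z s @^-1` ghost_good i).
  by rewrite -[X in measurable X]setTI; apply: measurable_sample => //; exact: measurable_ghost_good.
pose U1 := [set w | 2 * Num.sqrt n%:R * X <=
    `|\sum_(j <- s) h i (Z j w) - n%:R * \int[Q]_z h i z|].
pose S w := \sum_(j <- s) Xi (Z j w) ^+ 2.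
pose a := 4 * n%:R * X ^+ 2.
have n0 : 0 < n%:R :> R by rewrite ltr0n.
have a0 : 0 < a by rewrite !mulr_gt0// exprn_gt0.
have mS : measurable_fun setT S.
  apply: measurable_sum => j; apply: (measurableT_comp mXi2); exact: measurable_funPT.
have S0 w : 0 <= S w by apply: sumr_ge0 => j _; exact: sqr_ge0.
pose U2 := [set w | a%:E <= `|(S w)%:E| ]%E.
have mU2 : measurable U2.
  rewrite (_ : U2 = setT `&` S @^-1` `[a, +oo[); first exact: mS.
  rewrite setTI; apply/seteqP; split=> w /=; rewrite in_itv/= andbT /U2/= lee_fin.
    by rewrite ger0_norm.
  by rewrite ger0_norm.
have PU1 : (P U1 <= (1 / 4)%:E)%E.
  apply: (chebyshev_iid Ziid n_gt0 X_gt0 (h2 i) us); apply: le_trans XiX.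
  apply: ge0_le_integral => //.
  - by move=> z _; rewrite lee_fin sqr_ge0.
  - by apply/measurable_EFinP; apply: measurable_funX.
  - by apply/measurable_EFinP.
  - by move=> z _; rewrite lee_fin -[h i z ^+ 2]real_normK ?num_real// ler_sqr ?nnegrE ?(le_trans _ (hXi i z)).
have mU1 : measurable U1.
  rewrite (_ : U1 = setT `&` (fun w => `|\sum_(j <- s) h i (Z j w) - n%:R * \int[Q]_z h i z|)
      @^-1` `[2 * Num.sqrt n%:R * X, +oo[).
    have : measurable_fun setT (fun w => `|\sum_(j <- s) h i (Z j w) - n%:R * \int[Q]_z h i z|).
      apply: (measurableT_comp (@normr_measurable R setT)).
      apply: measurable_funB => //; apply: measurable_sum => j.
      exact: (measurableT_comp (mh i) (measurable_funPT _)).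
    exact.
  by rewrite setTI; apply/seteqP; split=> x /=; rewrite in_itv/= andbT.
have PU2 : (P U2 <= (1 / 4)%:E)%E.
  have := le_integral_abse P measurableT (g := EFin \o S) (a := a).
  rewrite setTI => /(_ _ a0) h0.
  have {}h0 := h0 (iffRL (measurable_EFinP _ _) mS).
  have ES : (\int[P]_w `|(EFin \o S) w| <= (n%:R * X ^+ 2)%:E)%E.
    under eq_integral => w _ do rewrite /= ger0_norm// /S -sumEFin.
    rewrite ge0_integral_sum//; last 2 first.
    - move=> j; apply/measurable_EFinP; apply: (measurableT_comp mXi2); exact: measurable_funPT.
    - by move=> j w _; rewrite lee_fin sqr_ge0.
    rewrite (eq_bigr (fun=> \int[Q]_z (Xi z ^+ 2)%:E)%E); last first.
      move=> j _; apply: (ge0_integral_iid Ziid j (g := fun z => (Xi z ^+ 2)%:E)).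
        exact/measurable_EFinP.
      by move=> z; rewrite lee_fin sqr_ge0.
    have XiXfin : (\int[Q]_z (Xi z ^+ 2)%:E)%E \is a fin_num.
      exact: (integrable_fin_num _ (Lfun2_integrable_sqr Xi2)).
    move: XiX; rewrite -(fineK XiXfin) sumEFin big_const_seq count_predT size_tuple iter_addr addr0.
    by rewrite !lee_fin => hX; rewrite -[leLHS]mulr_natl ler_pM2l.
  have PUfin : P U2 \is a fin_num by exact: fin_num_measure.
  have : (a%:E * P U2 <= (n%:R * X ^+ 2)%:E)%E by exact: le_trans h0 ES.
  rewrite -(fineK PUfin) -EFinM !lee_fin.
  have -> : n%:R * X ^+ 2 = a * (1 / 4) by rewrite /a; field.
  by rewrite ler_pM2l.
have incl : ~` (sample Z s @^-1` ghost_good i) `<=` U1 `|` U2.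
  move=> w /= hw; apply: contrapT => /not_orP[h1 h2']; apply: hw; split=> /=.
    by rewrite sumE ltNge; apply/negP.
  rewrite (sumE (fun z => Xi z ^+ 2)) leNgt; apply/negP => hlt; apply: h2'.
  by rewrite /U2 /= lee_fin ger0_norm// ltW.
have Pfin : P (sample Z s @^-1` ghost_good i) \is a fin_num by exact: fin_num_measure.
have : (P (~` (sample Z s @^-1` ghost_good i)) <= (1 / 4)%:E + (1 / 4)%:E)%E.
  apply: le_trans (leeD PU1 PU2); apply: le_trans (measureU2 _ mU1 mU2).
  by apply: le_measure => //; rewrite inE; [exact: measurableC|exact: measurableU].
rewrite probability_setC// -(fineK Pfin) -EFinB -EFinD !lee_fin; lra.
Qed.

(** The event is split by the first index [i] at which the sample is bad. This index depends on the
    sample only, so the independent ghost is good for it with conditional probability at least 1/2,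
    and then the difference of the two sums exceeds [y]. *)
Lemma symmetrization :
  (P [set w | (\sum_(j < n) Xi (Z j w) ^+ 2 <= 2 * n%:R * X ^+ 2)%R /\
      exists i, (y + 2 * Num.sqrt n%:R * X
         < `|\sum_(j < n) h i (Z j w) - n%:R * \int[Q]_z h i z|)%R] <= (2 * p)%:E)%E.
Proof.
pose s0 : n.-tuple nat := [tuple of iota 0 n].
pose s1 : n.-tuple nat := [tuple of iota n n].
have us0 : uniq s0 := iota_uniq 0 n.
have us1 : uniq s1 := iota_uniq n n.
have us : uniq (s0 ++ s1) by rewrite -[tval s1](_ : iota (0 + n) n = _)// -iotaD iota_uniq.
have s0E w j : tnth (sample Z s0 w) j = Z j w.
  by rewrite tnth_mktuple (tnth_nth 0%N) nth_iota.
have s1E w j : tnth (sample Z s1 w) j = Z (n + j)%N w.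
  by rewrite tnth_mktuple (tnth_nth 0%N) nth_iota.
pose A i : set (n.-tuple T) :=
  [set x | \sum_(j < n) Xi (tnth x j) ^+ 2 <= 2 * n%:R * X ^+ 2] `&`
  [set x | y + 2 * Num.sqrt n%:R * X
           < `|\sum_(j < n) h i (tnth x j) - n%:R * \int[Q]_z h i z|].
have mA i : measurable (A i).
  apply: measurableI.
    by apply: measurable_set_le; exact: (measurable_fun_sum_tnth mXi2).
  exact: measurable_set_lt (measurable_deviation i).
have mF i : measurable (seqDU A i).
  by apply: measurableD => //; apply: bigsetU_measurable.
have mpre m' (s : m'.-tuple nat) C : measurable C -> measurable (sample Z s @^-1` C).
  by move=> mC; rewrite -[X in measurable X]setTI; exact: measurable_sample.
have -> : [set w | (\sum_(j < n) Xi (Z j w) ^+ 2 <= 2 * n%:R * X ^+ 2)%R /\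
      exists i, (y + 2 * Num.sqrt n%:R * X
         < `|\sum_(j < n) h i (Z j w) - n%:R * \int[Q]_z h i z|)%R]
    = \bigcup_i (sample Z s0 @^-1` seqDU A i).
  rewrite -preimage_bigcup -seqDU_bigcup_eq; apply/seteqP; split=> w /=.
    move=> [h1 [i hi]]; exists i => //; split=> /=; under eq_bigr do rewrite s0E; done.
  move=> [i _ [/= h1 hi]]; split; first by under eq_bigr do rewrite -s0E.
  by exists i; under eq_bigr do rewrite -s0E.
have tF : trivIset setT (fun i => sample Z s0 @^-1` seqDU A i).
  move=> i j _ _ [w [hi hj]]; apply: (trivIset_seqDU A) => //.
  by exists (sample Z s0 w).
rewrite measure_bigcup//; last by move=> i _; exact: mpre.
pose G i := sample Z s0 @^-1` seqDU A i `&` sample Z s1 @^-1` ghost_good i.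
have mG i : measurable (G i).
  by apply: measurableI; apply: mpre => //; exact: measurable_ghost_good.
have half i : (P (sample Z s0 @^-1` seqDU A i) <= 2%:E * P (G i))%E.
  rewrite (sample_independent Ziid)//; last exact: measurable_ghost_good.
  rewrite (sample_law Ziid)// -(sample_law Ziid us1 (measurable_ghost_good i)).
  rewrite muleCA -[leLHS]mule1; apply: lee_wpmul2l => //.
  have two0 : (0 <= 2%:E :> \bar R)%E by rewrite lee_fin.
  apply: le_trans (lee_wpmul2l two0 (ghost_ge_half i us1)).
  by rewrite -EFinM lee_fin; lra.
apply: (@le_trans _ _ (\big[+%E/0]_(0 <= i <oo | i \in setT) (2%:E * P (G i)))%E).
  by apply: lee_nneseries => // i _; exact: half.
rewrite nneseriesZl// EFinM; apply: lee_wpmul2l; first by rewrite lee_fin.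
have -> : (\big[+%E/0]_(0 <= i <oo | i \in setT) P (G i) = P (\bigcup_i G i))%E.
  rewrite measure_bigcup// => i j _ _ [w [[hi _] [hj _]]]; apply: tF => //.
  by exists w.
apply: le_trans pair_event_le; apply: le_measure; rewrite ?inE.
- exact: bigcup_measurable.
- by apply: mpre; exact: measurable_pair_event.
move=> w [i _ [hF [/= g1 g2]]].
have e0 j : ([ffun=> false] : {ffun 'I_n -> bool}) j = false by rewrite ffunE.
have [/= a1 a2] : A i (sample Z s0 w) by exact: subset_seqDU hF.
split=> /=.
  under eq_bigr do rewrite sample_swap_lshift e0.
  under [X in _ + X <= _]eq_bigr do rewrite sample_swap_rshift e0.
  move: a1 g2; under eq_bigr do rewrite s0E; move=> a1; under eq_bigr do rewrite s1E; lra.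
exists i => //=.
under eq_bigr do rewrite sample_swap_lshift sample_swap_rshift e0.
rewrite sumrB.
move: a2 g1; under eq_bigr do rewrite s0E; move=> a2; under eq_bigr do rewrite s1E.
set M := n%:R * _ => g1; rewrite ltNge; apply/negP => hle.
move: a2; rewrite ltNge => /negP; apply.
set u := \sum_(j < n) h i (Z j w); set v := \sum_(j < n) _ in g1 hle.
rewrite -/u in hle.
have -> : u - M = (u - v) + (v - M) by ring.
by apply: le_trans (ler_normD _ _) _; apply: lerD => //; exact: ltW.
Qed.

End Symmetrization.

(** * Nets from the entropy integral *)

Section EntropyNets.
Context {R : realType} d (T : measurableType d).
Implicit Types (F : set (T -> R)) (C : T -> R) (Q : probability T R).

(** No measurability is assumed, because the integrand of [entropy_integral] is a supremum over all
    finitely supported measures. Monotonicity is read off from the simple functions below the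
    integrand. *)
Lemma ge0_le_integral_nonmeasurable d' (U : measurableType d') (mu : measure U R) (D : set U)
    (f g : U -> \bar R) :
  (forall x, D x -> (0 <= f x)%E) -> (forall x, D x -> (f x <= g x)%E) ->
  (\int[mu]_(x in D) f x <= \int[mu]_(x in D) g x)%E.
Proof.
move=> f0 fg; rewrite !ge0_integralE//; last by move=> x Dx; exact: le_trans (f0 _ Dx) (fg _ Dx).
apply: ereal_sup_le => _ [h hf <-]; exists h => // x; apply: le_trans (hf x) _.
by rewrite /patch; case: ifPn => // /set_mem; exact: fg.
Qed.

Let shell l : set R := `]2 ^- l / 16, 2 ^- l / 8]%classic.

(** The disjoint shells ]2^-l / 16, 2^-l / 8] lie in [0, 1/8] and have length 2^-l / 16; on the one
    of index [l] the integrand is at least [b l]. *)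
Lemma integral_ge_dyadic_sum (phi : R -> \bar R) (b : nat -> R) L :
  (forall l, 0 <= b l) -> (forall x, (0 <= phi x)%E) ->
  (forall l x, 0 <= x -> x <= 2 ^- l / 8 -> ((b l)%:E <= phi x)%E) ->
  ((\sum_(l < L) 2 ^- l / 16 * b l)%:E <=
   \int[lebesgue_measure]_(e in `[0%R, (1 / 8)%R]) phi e)%E.
Proof.
move=> b0 phi0 hphi.
have p2 l : 0 < 2 ^- l :> R by rewrite invr_gt0 exprn_gt0.
have shellD l : shell l `<=` `[0, 1 / 8].
  move=> x; rewrite /shell /= !in_itv/= => /andP[h1 h2].
  have : 2 ^- l <= 1 :> R by rewrite invf_le1 ?exprn_gt0// exprn_ege1// ler1n.
  by have := p2 l; lra.
have shell_inj l l' x : shell l x -> shell l' x -> l = l'.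
  wlog ll' : l l' / (l <= l')%N => [hw|].
    by have [/hw//|/ltnW /hw h h1 h2] := leqP l l'; apply/esym; exact: h.
  rewrite /shell /= !in_itv/= => /andP[h1 h2] /andP[h3 h4].
  apply/eqP; rewrite eqn_leq ll' leqNgt; apply/negP => lt.
  have : 2 ^- l' <= 2 ^- l.+1 :> R.
    by rewrite lef_pV2 ?posrE ?exprn_gt0// ler_eXn2l// ltr1n.
  by rewrite exprS invfM; lra.
pose g x := (\sum_(l < L) (b l * \1_(shell l) x)%:E)%E.
have mshell l : measurable (shell l) by exact: measurable_itv.
have gphi x : (g x <= phi x)%E.
  have [[l hl]|h] := pselect (exists l : 'I_L, shell l x).
    rewrite /g (bigD1 l)//= big1 ?adde0 => [|l' ll'].
      rewrite indicE mem_set// mulr1; move: hl; rewrite /shell /= in_itv/= => /andP[h1 h2].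
      by apply: hphi => //; have := p2 l; lra.
    rewrite indicE memNset ?mulr0// => hl'; move/eqP: ll'; apply; apply/val_inj.
    exact: shell_inj hl' hl.
  rewrite /g big1// => l _; rewrite indicE memNset ?mulr0// => hl.
  by apply: h; exists l.
apply: le_trans (_ : _ <= \int[lebesgue_measure]_(x in `[0%R, (1 / 8)%R]) g x)%E _; last first.
  apply: ge0_le_integral_nonmeasurable => [x _|x _]; last exact: gphi.
  by apply: sume_ge0 => l _; rewrite lee_fin mulr_ge0.
rewrite /g ge0_integral_sum//; last 2 first.
- move=> l; apply/measurable_EFinP; apply: measurable_funM => //.
  by apply: measurable_indic; exact: (mshell l).
- by move=> l x _; rewrite lee_fin mulr_ge0.
rewrite -sumEFin; apply: lee_sum => l _.
under eq_integral do rewrite EFinM.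
rewrite ge0_integralZl//; last 2 first.
- by apply/measurable_EFinP; apply: measurable_indic; exact: (mshell l).
- by rewrite lee_fin.
rewrite integral_indic//; last exact: (mshell l).
rewrite setIidl; last exact: (shellD l).
have mu_shell : lebesgue_measure (shell l) = (2 ^- l / 16)%:E.
  rewrite /shell lebesgue_measure_itv/= lte_fin ifT; last by have := p2 l; lra.
  by rewrite -EFinD; congr EFin; field; rewrite expf_neq0.
rewrite [X in (_ <= _ * X)%E](_ : _ = (2 ^- l / 16)%:E); last exact: mu_shell.
by rewrite -EFinM lee_fin mulrC.
Qed.

Lemma covering_number_le Q F (eta eta' : \bar R) : (eta <= eta')%E ->
  (covering_number Q F eta' <= covering_number Q F eta)%E.
Proof.
move=> ee; apply: ereal_inf_le_tmp => _ [k [c [hc cover]] <-]; exists k => //.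
exists c; split => // f /cover[i hi]; exists i; exact: le_trans hi ee.
Qed.

Lemma covering_number_ge1 Q F (eta : \bar R) : F !=set0 ->
  (1 <= covering_number Q F eta)%E.
Proof.
move=> [f Ff]; apply/ereal_infP => _ [k [c [_ cover]] <-].
have [i _] := cover _ Ff; rewrite lee_fin ler1n; exact: leq_ltn_trans (leq0n _) (ltn_ord i).
Qed.

Lemma covering_number_attained Q F (eta : \bar R) : (covering_number Q F eta < +oo)%E ->
  exists k (c : 'I_k -> T -> R), [/\ covering_number Q F eta = k%:R%:E,
    forall i, F (c i) &
    forall f, F f -> exists i, ('N[Q]_2%:E[EFin \o (f \- c i)%R] <= eta)%E].
Proof.
set A := [set k : nat | exists c : 'I_k -> T -> R, (forall i, F (c i)) /\
    (forall f, F f -> exists i, ('N[Q]_2%:E[EFin \o (f \- c i)%R] <= eta)%E)].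
move=> fin; have exA : exists k, `[< A k >].
  apply: contrapT => noA; move: fin; rewrite /covering_number -/A.
  suff -> : [set k%:R%:E | k in A] = set0 :> set (\bar R) by rewrite ereal_inf0 ltxx.
  by apply/seteqP; split=> // y [k Ak yk]; apply: noA; exists k; exact/asboolP.
case: (ex_minnP exA) => k /asboolP Ak kmin; have [c [hc cover]] := Ak.
exists k, c; split => //; apply/eqP; rewrite eq_le; apply/andP; split.
  by apply: ereal_inf_lbound; exists k => //; exists c.
apply/ereal_infP => _ [j Aj <-]; rewrite lee_fin ler_nat; apply: kmin; exact/asboolP.
Qed.

(** The covering number at radius 2^-l / 8 bounds the integrand from below at all smaller radii, so
    the dyadic lower bound of the integral controls the sum over levels. The 16 comes from the
    length 2^-l / 16 of the shells. *)
Lemma entropy_nets Q F C (M : R) : F !=set0 ->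
  (entropy_integral F C (1 / 8)%R <= M%:E)%E -> finitely_supported Q ->
  exists (k : nat -> nat) (c : forall l, 'I_(k l) -> T -> R),
    [/\ forall l i, F (c l i),
        forall l f, F f -> exists i, ('N[Q]_2%:E[EFin \o (f \- c l i)%R]
                                     <= (2 ^- l / 8)%R%:E * 'N[Q]_2%:E[EFin \o C])%E &
        forall L, \sum_(l < L) 2 ^- l * Num.sqrt (ln (2 * (k l)%:R)) <= 16 * M].
Proof.
move=> F0 JM fQ.
pose N l := covering_number Q F ((2 ^- l / 8)%R%:E * 'N[Q]_2%:E[EFin \o C]).
pose a l := (lne (2%:E * N l) `^ 2^-1)%E.
pose phi (e : R) := ereal_sup
  [set (lne (2%:E * covering_number Q' F (e%:E * 'N[Q']_2%:E[EFin \o C])) `^ 2^-1)%E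
  | Q' in @finitely_supported R d T].
have {}JM : (\int[lebesgue_measure]_(e in `[0%R, (1 / 8)%R]) phi e <= M%:E)%E by exact: JM.
have phi_ge l x : 0 <= x -> x <= 2 ^- l / 8 -> (a l <= phi x)%E.
  move=> x0 xl.
  have N1 e := @covering_number_ge1 Q F e F0.
  have big e : (1 <= 2%:E * covering_number Q F e)%E.
    rewrite -[leLHS]mule1; apply: lee_pmul => //; rewrite ?lee_fin ?ler1n//.
  apply: le_trans (_ : _ <= lne (2%:E * covering_number Q F (x%:E * 'N[Q]_2%:E[EFin \o C])) `^ 2^-1)%E _.
    have pos e : (0 <= 2%:E * covering_number Q F e)%E by exact: le_trans (big e).
    apply: gt0_ler_poweR.
    - by rewrite invr_ge0.
    - by rewrite in_itv/= leey andbT lne_ge0 big.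
    - by rewrite in_itv/= leey andbT lne_ge0 big.
    rewrite lee_lne; last 2 first.
    - by rewrite in_itv/= leey andbT pos.
    - by rewrite in_itv/= leey andbT pos.
    apply: lee_wpmul2l; first by rewrite lee_fin.
    by apply: covering_number_le; apply: lee_wpmul2r; rewrite ?Lnorm_ge0// lee_fin.
  by apply: ereal_sup_ubound; exists Q.
have phi0 x : (0 <= phi x)%E.
  by apply: le_ereal_sup_tmp; exists (lne (2%:E * covering_number Q F (x%:E * 'N[Q]_2%:E[EFin \o C])) `^ 2^-1)%E; [exists Q|exact: poweR_ge0].
have afin l : (a l < +oo)%E.
  rewrite ltNge leye_eq; apply/negP => /eqP al.
  (* If [a l] were infinite, the weight at level [l] could be chosen freely; this choice makes the
     lower bound of the integral equal to |M| + 1. *)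
  pose K := (`|M| + 1) * (16 * 2 ^+ l).
  have p2 : 0 < 2 ^+ l :> R by rewrite exprn_gt0.
  have K0 : 0 <= K by rewrite !mulr_ge0// ?addr_ge0// ltW.
  have : ((\sum_(l' < l.+1) 2 ^- l' / 16 * (if l' == l :> nat then K else 0))%:E <= M%:E)%E.
    apply: le_trans JM; apply: (integral_ge_dyadic_sum (b := fun l' => if l' == l then K else 0)) => //.
      by move=> l'; case: ifP.
    move=> l' x x0 xl.
    case: eqP xl => [-> xl|_ _]; last exact: phi0.
    by have := phi_ge l x x0 xl; rewrite al leye_eq => /eqP ->; rewrite leey.
  rewrite lee_fin (bigD1 ord_max)//= eqxx big1 ?addr0 => [|i /negbTE il]; last first.
    by rewrite [_ == _]il mulr0.
  rewrite /K [leLHS](_ : _ = `|M| + 1); last by field; rewrite gt_eqF.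
  by have := ler_norm M; lra.
have Nfin l : (N l < +oo)%E.
  rewrite ltNge leye_eq; apply/negP => /eqP Nl.
  move: (afin l); rewrite /a Nl gt0_muley ?lte_fin//.
  by rewrite (_ : lne +oo = +oo%E)// poweRyr ?invr_eq0// ltxx.
have [k hk] : exists k : nat -> nat, forall l, exists (c : 'I_(k l) -> T -> R),
   [/\ N l = (k l)%:R%:E, forall i, F (c i) &
    forall f, F f -> exists i, ('N[Q]_2%:E[EFin \o (f \- c i)%R]
      <= (2 ^- l / 8)%R%:E * 'N[Q]_2%:E[EFin \o C])%E].
  exists (fun l => sval (cid (covering_number_attained (Nfin l)))) => l.
  exact: (svalP (cid (covering_number_attained (Nfin l)))).
exists k, (fun l => sval (cid (hk l))); split.
- by move=> l i; case: (svalP (cid (hk l))).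
- by move=> l; case: (svalP (cid (hk l))).
move=> L.
have aE l : a l = (Num.sqrt (ln (2 * (k l)%:R)))%:E.
  have [c [Nl _ _]] := hk l.
  have : (1 <= N l)%E by exact: covering_number_ge1.
  rewrite /a Nl lee_fin => k1; rewrite -EFinM lne_EFin; last lra.
  rewrite poweR_EFin; congr EFin; rewrite powR12_sqrt// ln_ge0//; lra.
have : ((\sum_(l < L) 2 ^- l / 16 * Num.sqrt (ln (2 * (k l)%:R)))%:E <= M%:E)%E.
  apply: le_trans JM; apply: (integral_ge_dyadic_sum (b := fun l => Num.sqrt (ln (2 * (k l)%:R)))) => //.
  by move=> l x x0 xl; rewrite -aE; exact: phi_ge.
rewrite lee_fin.
under eq_bigr do rewrite mulrAC.
rewrite -mulr_suml; lra.
Qed.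

End EntropyNets.

(** * Nets for weighted empirical norms *)

Section PointMeasures.
Context {R : realType} d (T : measurableType d).

(** The entropy integral only sees finitely supported probabilities. Masses proportional to [w z] at
    the points of [s], with repeated points adding up, turn the L2 norm into a weighted empirical
    norm. *)
Lemma weighted_point_measure (s : seq T) (w : T -> R) : s != [::] -> (forall z, 0 < w z) ->
  exists Q : probability T R, finitely_supported Q /\
    forall f : T -> R, measurable_fun setT f ->
      'N[Q]_2%:E[EFin \o f]%E =
      (Num.sqrt ((\sum_(z <- s) w z * f z ^+ 2) / \sum_(z <- s) w z))%:E.
Proof.
case: s => // z0 s'; set s := z0 :: s' => _ w0.
pose S := \sum_(z <- s) w z.
have S0 : 0 < S.
  rewrite /S big_cons ltr_pwDl//; apply: sumr_ge0 => z _; exact: ltW.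
have q0 k : 0 <= w (nth z0 s k) / S by rewrite divr_ge0 ?ltW.
pose m (k : nat) : measure T R := mscale (NngNum (q0 k)) (\d_(nth z0 s k)).
pose mu : measure T R := msum m (size s).
have sumS (g : T -> R) : \sum_(k < size s) g (nth z0 s k) = \sum_(z <- s) g z.
  by rewrite (big_nth z0) big_mkord.
have muE A : (forall z, z \in s -> A z) -> mu A = 1%E.
  move=> sA; rewrite /mu /= /msum /= /m /= /mscale /=.
  transitivity (\sum_(k < size s) (w (nth z0 s k) / S)%:E)%E.
    apply: eq_bigr => k _; rewrite diracE mem_set ?mule1//.
    by apply: sA; rewrite mem_nth.
  rewrite sumEFin (sumS (fun z => w z / S)) -mulr_suml -/S divff// gt_eqF//.
have muT : mu setT = 1%E by exact: muE.
pose Q : probability T R := HB.pack (mu : set T -> \bar R) (Measure.class mu)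
  (Measure_isProbability.Build _ _ _ mu muT).
exists Q; split.
  exists [set` s]; split; first exact: finite_seq.
  by apply: muE.
move=> f mf.
have mf2 : measurable_fun setT (fun z => (f z ^+ 2)%:E).
  by apply/measurable_EFinP; exact: measurable_funX.
have intE : (\int[Q]_z (f z ^+ 2)%:E = ((\sum_(z <- s) w z * f z ^+ 2) / S)%:E)%E.
  transitivity (\int[mu]_z (f z ^+ 2)%:E)%E; first by [].
  rewrite /mu ge0_integral_measure_sum//; last by move=> z _; rewrite lee_fin sqr_ge0.
  rewrite mulr_suml -(sumS (fun z => w z * f z ^+ 2 / S)) -sumEFin.
  apply: eq_bigr => k _.
  rewrite /m ge0_integral_mscale//; last by move=> z _; rewrite lee_fin sqr_ge0.
  rewrite integral_dirac// diracT mul1e -EFinM /=; congr EFin; ring.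
rewrite unlock /=.
rewrite (eq_integral (fun z => (f z ^+ 2)%:E)); last first.
  by move=> z _; rewrite powR_mulrn ?normr_ge0// real_normK ?num_real.
rewrite [X in (X `^ _)%E](_ : _ = \int[Q]_z (f z ^+ 2)%:E)%E//.
rewrite intE poweR_EFin powR12_sqrt//; apply: divr_ge0; last exact: ltW.
by apply: sumr_ge0 => z _; rewrite mulr_ge0 ?sqr_ge0// ltW.
Qed.

(** The radius of the nets is relative to the norm of the envelope, so the total mass cancels and
    unnormalized weighted sums remain on both sides. *)
Lemma point_nets (F : set (T -> R)) (C : T -> R) (M : R) (s : seq T) (w : T -> R) :
  s != [::] -> (forall z, 0 < w z) -> F !=set0 ->
  (forall f, F f -> measurable_fun setT f) -> measurable_fun setT C ->
  (entropy_integral F C (1 / 8)%R <= M%:E)%E ->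
  exists (k : nat -> nat) (c : forall l, 'I_(k l) -> T -> R),
    [/\ forall l i, F (c l i),
        forall l f, F f -> exists i, \sum_(z <- s) w z * (f z - c l i z) ^+ 2
          <= (2 ^- l / 8) ^+ 2 * \sum_(z <- s) w z * C z ^+ 2 &
        forall L, \sum_(l < L) 2 ^- l * Num.sqrt (ln (2 * (k l)%:R)) <= 16 * M].
Proof.
move=> s0 w0 F0 mF mC JM.
have [Q [fQ normE]] := weighted_point_measure s0 w0.
have [k [c [cF net kM]]] := entropy_nets F0 JM fQ.
exists k, c; split => // l f Ff; have [i hi] := net l f Ff; exists i.
move: hi; rewrite (normE C)// (normE (f \- c l i)); last first.
  by apply: measurable_funB; [exact: mF|apply: mF; exact: cF].
rewrite -EFinM lee_fin.
have S0 : 0 < \sum_(z <- s) w z.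
  case: (s) s0 => // z s' _; rewrite big_cons ltr_pwDl//; apply: sumr_ge0 => z' _; exact: ltW.
have p2 : 0 <= 2 ^- l / 8 :> R by rewrite divr_ge0// invr_ge0 exprn_ge0.
have N0 (g : T -> R) : 0 <= (\sum_(z <- s) w z * g z ^+ 2) / \sum_(z <- s) w z.
  apply: divr_ge0; last exact: ltW.
  by apply: sumr_ge0 => z _; rewrite mulr_ge0 ?sqr_ge0// ltW.
rewrite -ler_sqr ?nnegrE ?mulr_ge0 ?sqrtr_ge0// exprMn !sqr_sqrtr//.
by rewrite mulrA ler_pM2r ?invr_gt0.
Qed.

End PointMeasures.

(** * Grids for the two real parameters *)

Section Grid.
Context {R : realType}.

(** These are the midpoints of the [N] equal cells of [-1, 1]. *)
Definition grid_point N (i : 'I_N) : R := -1 + (2 * i%:R + 1) / N%:R.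

Lemma grid_point_itv N (i : 'I_N) : -1 <= grid_point i <= 1.
Proof.
have N0 : 0 < N%:R :> R by rewrite ltr0n; exact: leq_ltn_trans (ltn_ord i).
have iN : i%:R + 1 <= N%:R :> R by rewrite natr1 ler_nat.
have i0 : 0 <= i%:R :> R by [].
rewrite /grid_point; apply/andP; split.
  by rewrite lerDl divr_ge0// ?ltW//; lra.
have : (2 * i%:R + 1) / N%:R <= 2 :> R by rewrite ler_pdivrMr//; lra.
lra.
Qed.

Lemma grid_net N (y : R) : (0 < N)%N -> -1 <= y <= 1 ->
  exists i : 'I_N, `|y - grid_point i| <= N%:R^-1.
Proof.
move=> N0 /andP[y1 y2]; have NR : 0 < N%:R :> R by rewrite ltr0n.
have t0 : 0 <= (y + 1) / 2 * N%:R by rewrite mulr_ge0//; lra.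
have := truncn_itv t0; set k := Num.truncn _ => /andP[k1 k2].
have [kN|Nk] := ltnP k N.
  exists (Ordinal kN); rewrite /grid_point /=.
  have -> : y - (-1 + (2 * k%:R + 1) / N%:R) =
      (2 * ((y + 1) / 2 * N%:R - k%:R) - 1) / N%:R by field; rewrite gt_eqF.
  rewrite normrM normfV (gtr0_norm NR) ler_pdivrMr// mulVf ?gt_eqF//.
  by rewrite ler_norml; rewrite -[k.+1%:R]natr1 in k2; lra.
(* Only the right endpoint y = 1 has truncated index [N]; it is assigned to the last cell. *)
have lN : (N.-1 < N)%N by rewrite prednK.
exists (Ordinal lN); rewrite /grid_point /=.
have y_1 : y = 1.
  have : N%:R <= k%:R :> R by rewrite ler_nat.
  move=> Nk'; have h : (y + 1) / 2 * N%:R <= 1 * N%:R by rewrite ler_pM2r//; lra.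
  have : (y + 1) / 2 * N%:R = 1 * N%:R by lra.
  by move/mulIf => E; have := E (lt0r_neq0 NR); lra.
have E : N%:R = N.-1%:R + 1 :> R by rewrite natr1 prednK.
have -> : y - (-1 + (2 * N.-1%:R + 1) / N%:R) = N%:R^-1.
  by rewrite y_1 E; field; rewrite -E gt_eqF.
by rewrite ger0_norm// invr_ge0 ltW.
Qed.

(** Two grids with 2^(l+3) points each have 2^(2l+6) pairs. After ln 2 <= 1, a linear majorant of
    the square root reduces the sum to 2 * 21/10 + 4 * 2/5 = 5.8. *)
Lemma sum_half_pow_sqrt_le L :
  \sum_(l < L) 2 ^- l * Num.sqrt (ln (2 ^+ (2 * l + 6))) <= 7 :> R.
Proof.
have ln2 : ln 2 <= 1 :> R by rewrite -ler_expR lnK ?posrE//; have := expR_ge1Dx (1 : R); lra.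
have term l : Num.sqrt (ln (2 ^+ (2 * l + 6))) <= 21 / 10 + 2 / 5 * l.+1%:R :> R.
  have c0 : 0 <= 21 / 10 + 2 / 5 * l.+1%:R :> R by rewrite addr_ge0// mulr_ge0.
  rewrite -[leRHS]ger0_norm// -sqrtr_sqr ler_wsqrtr// lnXn ?ltr0n// -[leLHS]mulr_natl.
  apply: (@le_trans _ _ (2 * l + 6)%:R).
    by rewrite -[leRHS]mulr1 ler_wpM2l.
  rewrite natrD natrM -[l.+1%:R]natr1; have : 0 <= l%:R :> R by [].
  set x := l%:R => x0; have := sqr_ge0 x; nra.
apply: le_trans (_ : _ <= \sum_(l < L) (2 ^- l * (21 / 10) + 2 / 5 * (2 ^- l * l.+1%:R))) _.
  apply: ler_sum => l _; apply: le_trans (ler_wpM2l _ (term l)) _.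
    by rewrite invr_ge0 exprn_ge0.
  by rewrite le_eqVlt; apply/orP; left; apply/eqP; ring.
rewrite big_split/= -mulr_suml -mulr_sumr.
have := sum_half_pow_index (R := R) L.
have : \sum_(l < L) 2 ^- l <= 2 :> R by rewrite sum_half_pow gerBl divr_ge0// exprn_ge0.
lra.
Qed.

End Grid.

(** * Deviations of a Lipschitz-parametrized class *)

Lemma sqrB_le {R : realType} (a b : R) : (a - b) ^+ 2 <= 2 * (a ^+ 2 + b ^+ 2).
Proof. by have := sqr_ge0 (a + b); nra. Qed.

Section ClassDeviation.
Context {R : realType} d d' (Omega : measurableType d) (T : measurableType d').
Context (P : probability Omega R) (Z : nat -> {RV P >-> T}).
Context (Q : probability T R) (Ziid : iid_with_law Z Q).
Context (n : nat) (n_gt0 : (0 < n)%N).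

Lemma Lfun2_le (f g : T -> R) : measurable_fun setT f -> (forall z, `|f z| <= g z) ->
  g \in Lfun Q 2%:E -> f \in Lfun Q 2%:E.
Proof.
move=> mf fg /Lfun2P[mg gfin]; apply/Lfun2P; split=> //.
move: gfin; rewrite unlock /= => gfin; apply: poweR_lty.
have := lty_poweRy _ gfin; rewrite invr_eq0 pnatr_eq0 => /(_ isT); apply: le_lt_trans.
have mpow (k : T -> R) : measurable_fun setT k -> measurable_fun setT (fun z : T => ((`|k z| `^ 2)%:E : \bar R)).
  move=> mk; apply/measurable_EFinP.
  apply: (measurableT_comp (measurable_powR 2)).
  exact: (measurableT_comp (@normr_measurable R setT)).
apply: ge0_le_integral => //; try exact: mpow.
move=> z _; rewrite lee_fin ge0_ler_powR ?nnegrE//.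
by rewrite (le_trans (fg z))// ler_norm.
Qed.

Context (I : Type) (U : set I) (g : I -> T -> R) (w l xi Xi : T -> R) (M X : R).
Context (h : I -> R -> R -> T -> R).
Context (U0 : U !=set0) (w_gt0 : forall z, 0 < w z) (l_ge0 : forall z, 0 <= l z).
Context (mg : forall i, U i -> measurable_fun setT (g i)) (mxi : measurable_fun setT xi).
Context (JM : (entropy_integral [set g i | i in U] xi (1 / 8)%R <= M%:E)%E).
Context (XiE : forall z, Xi z ^+ 2 = w z * xi z ^+ 2 + l z).
Context (h_env : forall i y u z, U i -> -1 <= y <= 1 -> -1 <= u <= 1 ->
  h i y u z ^+ 2 <= Xi z ^+ 2).
Context (h_lip : forall i i' y y' u u' eta z, U i -> U i' ->
  -1 <= y <= 1 -> -1 <= y' <= 1 -> -1 <= u <= 1 -> -1 <= u' <= 1 ->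
  `|y - y'| <= eta -> `|u - u'| <= eta ->
  (h i y u z - h i' y' u' z) ^+ 2 <= 2 * (w z * (g i z - g i' z) ^+ 2) + 10 * eta ^+ 2 * l z).
Context (X_gt0 : 0 < X).

(** The squared differences sum to at most 2 * 6 n X^2, which gives the radius sqrt(12 n) X. At
    level [l] the function net and both grids have relative mesh 2^-l / 8; the squared distance to
    the nearest center is then at most (24 + 120) / 64 * 4^-l n X^2, below the 3 * 4^-l n X^2 that
    chaining allows. *)
Lemma class_chaining (v : R) (x x' : 'I_n -> T) : 1 <= v ->
  \sum_(j < n) Xi (x j) ^+ 2 + \sum_(j < n) Xi (x' j) ^+ 2 <= 6 * n%:R * X ^+ 2 ->
  #|[pred e | `[< exists i y u, [/\ U i, -1 <= y <= 1, -1 <= u <= 1 &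
       Num.sqrt (12 * n%:R) * X * (3 / 2 * (16 * M + 7) + 6 * v + 1)
       < `|signed_sum e (fun j => h i y u (x j) - h i y u (x' j))|] >]]|%:R
  <= 2 ^+ n * (2 * expR (- v ^+ 2)).
Proof.
move=> v1 small.
pose s := map x (index_enum 'I_n) ++ map x' (index_enum 'I_n).
have sumS (f : T -> R) : \sum_(z <- s) f z = \sum_(j < n) f (x j) + \sum_(j < n) f (x' j).
  by rewrite big_cat/= !big_map.
have s0 : s != [::].
  apply/eqP => s0; have := sumS (fun=> 1).
  by rewrite s0 big_nil !sumr_const card_ord -natrD => /eqP; rewrite eq_sym pnatr_eq0; lia.
have F0 : [set g i | i in U] !=set0 by case: U0 => i Ui; exists (g i); exists i.
have mF f : [set g i | i in U] f -> measurable_fun setT f.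
  by move=> [i Ui <-]; exact: mg.
have [k [c [cF net kM]]] := point_nets s0 w_gt0 F0 mF mxi JM.
have [t tP] : exists t : forall l', 'I_(k l') -> I, forall l' p, U (t l' p) /\ g (t l' p) = c l' p.
  exists (fun l' p => s2val (cid2 (cF l' p))) => l' p.
  by split; [exact: (s2valP (cid2 (cF l' p)))|exact: (s2valP' (cid2 (cF l' p)))].
pose ok (q : I * R * R) := [/\ U q.1.1, -1 <= q.1.2 <= 1 & -1 <= q.2 <= 1].
pose J := {q : I * R * R | ok q}.
pose V (q : J) (j : 'I_n) : R := let: (i, y, u) := sval q in h i y u (x j) - h i y u (x' j).
pose N l' := (2 ^ (l' + 3))%N.
have N0 l' : (0 < N l')%N by rewrite expn_gt0.
pose K l' : finType := ('I_(k l') * 'I_(N l') * 'I_(N l'))%type.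
have ctr_ok l' (p : K l') : ok (t l' p.1.1, grid_point p.1.2, grid_point p.2).
  by split=> /=; [exact: (tP l' p.1.1).1|exact: grid_point_itv|exact: grid_point_itv].
pose ctr l' (p : K l') : J := exist ok _ (ctr_ok l' p).
pose D := Num.sqrt (12 * n%:R) * X.
have D0 : 0 <= D by rewrite mulr_ge0 ?sqrtr_ge0// ltW.
have D2 : D ^+ 2 = 12 * n%:R * X ^+ 2 by rewrite exprMn sqr_sqrtr// mulr_ge0.
have W6 : \sum_(z <- s) Xi z ^+ 2 <= 6 * n%:R * X ^+ 2 by rewrite (sumS (fun z => Xi z ^+ 2)).
have VD q : \sum_(j < n) V q j ^+ 2 <= D ^+ 2.
  case: q => [[[i y] u] [/= Ui yy uu]]; rewrite /V /=.
  apply: le_trans (_ : _ <= \sum_(j < n) (2 * (Xi (x j) ^+ 2) + 2 * (Xi (x' j) ^+ 2))) _.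
    apply: ler_sum => j _; apply: le_trans (sqrB_le _ _) _.
    have := h_env (x j) Ui yy uu; have := h_env (x' j) Ui yy uu; lra.
  by rewrite big_split/= -!mulr_sumr D2; move: small; lra.
have Vnet l' q : exists p, \sum_(j < n) (V q j - V (ctr l' p) j) ^+ 2 <= (2 ^- l' * D / 2) ^+ 2.
  case: q => [[[i y] u] [/= Ui yy uu]].
  have [p hp] := net l' (g i) (ex_intro2 _ _ i Ui erefl).
  have [py hy] := grid_net (N0 l') yy; have [pu hu] := grid_net (N0 l') uu.
  exists (p, py, pu); rewrite /V /=.
  set eta := (N l')%:R^-1 in hy hu.
  have etaE : eta = 2 ^- l' / 8 by rewrite /eta /N natrX exprD invfM; congr (_ * _); lra.
  set a := 2 ^- l' in etaE hp *.
  have lip z := h_lip z Ui (tP l' p).1 yy (grid_point_itv py) uu (grid_point_itv pu) hy hu.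
  rewrite (tP l' p).2 in lip.
  apply: le_trans (_ : _ <= \sum_(j < n) (2 * (2 * (w (x j) * (g i (x j) - c l' p (x j)) ^+ 2)
      + 10 * eta ^+ 2 * l (x j)) + 2 * (2 * (w (x' j) * (g i (x' j) - c l' p (x' j)) ^+ 2)
      + 10 * eta ^+ 2 * l (x' j)))) _.
    apply: ler_sum => j _.
    set A := h i y u (x j); set B := h i y u (x' j); set A' := h _ _ _ (x j); set B' := h _ _ _ (x' j).
    have -> : A - B - (A' - B') = (A - A') - (B - B') by ring.
    apply: le_trans (sqrB_le _ _) _.
    have := lip (x j); have := lip (x' j); rewrite -/A -/B -/A' -/B'; lra.
  rewrite big_split/= -!mulr_sumr.
  rewrite -mulrDr -(sumS (fun z => 2 * (w z * (g i z - c l' p z) ^+ 2) + 10 * eta ^+ 2 * l z)).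
  rewrite big_split/= -!mulr_sumr.
  have hl : \sum_(z <- s) l z <= \sum_(z <- s) Xi z ^+ 2.
    by apply: ler_sum => z _; rewrite XiE lerDr mulr_ge0 ?sqr_ge0// ltW.
  have hw : \sum_(z <- s) w z * xi z ^+ 2 <= \sum_(z <- s) Xi z ^+ 2.
    by apply: ler_sum => z _; rewrite XiE lerDl.
  have -> : (a * D / 2) ^+ 2 = a ^+ 2 * (3 * n%:R * X ^+ 2).
    have -> : (a * D / 2) ^+ 2 = a ^+ 2 * D ^+ 2 / 4 by field.
    by rewrite D2; field.
  set S1 := \sum_(z <- s) _ in hp *; set S2 := \sum_(z <- s) l z in hl *.
  set S3 := \sum_(z <- s) _ in hl hw W6; set S4 := \sum_(z <- s) _ in hp hw.
  have a2 : 0 <= a ^+ 2 by exact: sqr_ge0.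
  have e1 : a ^+ 2 * S4 <= a ^+ 2 * (6 * n%:R * X ^+ 2) by rewrite ler_wpM2l//; lra.
  have e2 : a ^+ 2 * S2 <= a ^+ 2 * (6 * n%:R * X ^+ 2) by rewrite ler_wpM2l//; lra.
  have hp' : S1 <= a ^+ 2 * S4 / 64 by apply: le_trans hp _; rewrite le_eqVlt; apply/orP; left; apply/eqP; field.
  rewrite etaE.
  have -> : 10 * (a / 8) ^+ 2 * S2 = 10 / 64 * (a ^+ 2 * S2) by field.
  have e3 : 0 <= a ^+ 2 * (n%:R * X ^+ 2) by apply: mulr_ge0 => //; apply: mulr_ge0 => //; exact: sqr_ge0.
  lra.
have Ksum L : \sum_(l' < L) 2 ^- l' * Num.sqrt (ln (2 * #|K l'|%:R)) <= 16 * M + 7.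
  apply: le_trans (_ : _ <= \sum_(l' < L) (2 ^- l' * Num.sqrt (ln (2 * (k l')%:R))
     + 2 ^- l' * Num.sqrt (ln (2 ^+ (2 * l' + 6))))) _; last first.
    by rewrite big_split/=; apply: lerD; [exact: kM|exact: sum_half_pow_sqrt_le].
  apply: ler_sum => l' _; rewrite -mulrDr ler_wpM2l ?invr_ge0 ?exprn_ge0//.
  have k1 : 1 <= (k l')%:R :> R.
    have [i Ui] := U0; have [p _] := net l' (g i) (ex_intro2 _ _ i Ui erefl).
    by rewrite ler1n; exact: leq_ltn_trans (leq0n _) (ltn_ord p).
  have -> : 2 * #|K l'|%:R = (2 * (k l')%:R) * 2 ^+ (2 * l' + 6) :> R.
    rewrite !card_prod !card_ord !natrM /N !natrX.
    have -> : (2 * l' + 6 = (l' + 3) + (l' + 3))%N by lia.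
    by rewrite (exprD _ (l' + 3) (l' + 3)); ring.
  rewrite lnM ?posrE ?exprn_gt0//; last lra.
  have A0 : 0 <= ln (2 * (k l')%:R) :> R by rewrite ln_ge0//; lra.
  have B0 : 0 <= ln (2 ^+ (2 * l' + 6)) :> R by rewrite ln_ge0// exprn_ege1// ler1n.
  rewrite -[leRHS]ger0_norm ?addr_ge0 ?sqrtr_ge0// -sqrtr_sqr ler_wsqrtr//.
  by rewrite sqrrD !sqr_sqrtr// lerD2r lerDl mulrn_wge0// mulr_ge0 ?sqrtr_ge0.
apply: le_trans (card_signed_sum_chaining D0 v1 VD Vnet Ksum).
rewrite ler_nat; apply: subset_leq_card; apply/fintype.subsetP => e /asboolP[i [y [u [Ui yy uu hlt]]]].
apply/asboolP; exists (exist ok (i, y, u) (And3 Ui yy uu)); exact: hlt.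
Qed.

Context (Xi_ge0 : forall z, 0 <= Xi z) (Xi2 : Xi \in Lfun Q 2%:E).
Context (XiX : (\int[Q]_x (Xi x ^+ 2)%:E <= (X ^+ 2)%:E)%E).
Context (mh : forall i y u, U i -> measurable_fun setT (h i y u)).

(** For v = s / 32 and sqrt 12 <= 7/2, the chaining threshold is at most sqrt n X times 84 M + 40.25
    + 21 s / 32. The lower bound on [s] puts this factor below s - 2, and the missing 2 is what
    symmetrization loses. *)
Lemma class_deviation (q : nat -> I * R * R) (s : R) :
  (forall k, [/\ U (q k).1.1, -1 <= (q k).1.2 <= 1 & -1 <= (q k).2 <= 1]) ->
  0 <= M -> 256 * (M + 7 / 10) + 7 / 5 <= s ->
  (P [set w | (\sum_(j < n) Xi (Z j w) ^+ 2 <= 2 * n%:R * X ^+ 2)%R /\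
      exists k, (s * Num.sqrt n%:R * X < `|\sum_(j < n) h (q k).1.1 (q k).1.2 (q k).2 (Z j w)
        - n%:R * \int[Q]_z h (q k).1.1 (q k).1.2 (q k).2 z|)%R]
   <= (4 * expR (- (s / 32) ^+ 2))%:E)%E.
Proof.
move=> qok M0 sM.
pose hk k := h (q k).1.1 (q k).1.2 (q k).2.
have hk_le k z : `|hk k z| <= Xi z.
  have [Ui yy uu] := qok k; have := h_env z Ui yy uu.
  by move=> hz; rewrite -ler_sqr ?nnegrE// real_normK ?num_real.
have hk2 k : hk k \in Lfun Q 2%:E.
  apply: Lfun2_le Xi2 => //; have [Ui _ _] := qok k; exact: mh.
pose v := s / 32.
have v1 : 1 <= v by rewrite /v; lra.
have p0 : 0 <= 2 * expR (- v ^+ 2) by rewrite mulr_ge0// expR_ge0.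
have sn0 : 0 <= Num.sqrt n%:R * X by rewrite mulr_ge0 ?sqrtr_ge0// ltW.
have rad (x x' : 'I_n -> T) :
  \sum_(j < n) Xi (x j) ^+ 2 + \sum_(j < n) Xi (x' j) ^+ 2 <= 6 * n%:R * X ^+ 2 ->
  #|[pred e | `[< exists k, s * Num.sqrt n%:R * X - 2 * Num.sqrt n%:R * X
      < `|signed_sum e (fun j => hk k (x j) - hk k (x' j))| >]]|%:R
    <= 2 ^+ n * (2 * expR (- v ^+ 2)).
  move=> small; apply: le_trans (class_chaining v1 small).
  rewrite ler_nat; apply: subset_leq_card; apply/fintype.subsetP => e /asboolP[k hlt].
  have [Ui yy uu] := qok k.
  apply/asboolP; exists (q k).1.1, (q k).1.2, (q k).2; split=> //.
  apply: le_lt_trans hlt.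
  have -> : s * Num.sqrt n%:R * X - 2 * Num.sqrt n%:R * X = Num.sqrt n%:R * X * (s - 2) by ring.
  have s12 : Num.sqrt 12 <= 7 / 2 :> R.
    by rewrite -[leRHS]ger0_norm// -sqrtr_sqr ler_wsqrtr//; lra.
  have -> : Num.sqrt (12 * n%:R) * X * (3 / 2 * (16 * M + 7) + 6 * v + 1) =
      Num.sqrt n%:R * X * (Num.sqrt 12 * (3 / 2 * (16 * M + 7) + 6 * v + 1)).
    by rewrite sqrtrM//; ring.
  apply: ler_wpM2l => //.
  have : Num.sqrt 12 * (3 / 2 * (16 * M + 7) + 6 * v + 1) <=
      7 / 2 * (3 / 2 * (16 * M + 7) + 6 * v + 1) by apply: ler_wpM2r => //; lra.
  by rewrite /v; lra.
have := symmetrization Ziid n_gt0 hk2 Xi2 hk_le X_gt0 p0 XiX rad.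
rewrite mulrA (_ : 2 * 2 = 4 :> R); last by ring.
apply: le_trans; rewrite le_eqVlt; apply/orP; left; apply/eqP; congr (P _).
by apply/seteqP; split=> w' /=; rewrite subrK.
Qed.

End ClassDeviation.

(** * Summation over the shells *)

Section PeelingNumerics.
Context {R : realType}.
Implicit Types (k : int) (t : R).

Lemma gfrak_ge0 t : 0 < t -> 0 <= gfrak t.
Proof. by move=> t0; rewrite /gfrak divr_ge0 ?sqr_ge0// !mulr_ge0//; lra. Qed.

Lemma gfrak_le t : 0 < t -> gfrak t <= (t + 1) / 224.
Proof.
move=> t0; rewrite /gfrak ler_pdivrMr; last by rewrite !mulr_gt0//; lra.
have -> : (t + 1) / 224 * (8 * (t + 1) * (5 * t + 28)) =
  (t + 1) ^+ 2 + 5 * (t + 1) ^+ 2 * t / 28 by field.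
have : 0 <= 5 * (t + 1) ^+ 2 * t / 28 by rewrite !mulr_ge0 ?sqr_ge0//; lra.
rewrite sqrrD1; have := ltW t0; lra.
Qed.

Lemma ln2_gt0 : 0 < ln 2 :> R.
Proof. by rewrite ln_gt0// ltr1n. Qed.

Lemma powR2_gt0 (x : R) : 0 < 2 `^ x. Proof. by rewrite powR_gt0. Qed.

Lemma powR2D (x y : R) : 2 `^ (x + y) = 2 `^ x * 2 `^ y.
Proof. by rewrite powRD// pnatr_eq0 implybT. Qed.

Lemma K_eps_bounds (eps : R) : 0 < eps ->
  2 `^ (K_eps eps)%:~R <= eps /\ eps < 2 `^ ((K_eps eps)%:~R + 1).
Proof.
move=> e0; have l2 := ln2_gt0.
have /andP[h1 h2] := floor_itv (ln eps / ln 2); rewrite intrD in h2.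
have E : 2 `^ (ln eps / ln 2) = eps.
  by rewrite /powR pnatr_eq0/= divfK ?gt_eqF// lnK ?posrE.
split.
  by rewrite -[leRHS]E; apply: ler_powR => //; rewrite ler1n.
rewrite -[ltLHS]E /powR pnatr_eq0/= ltr_expR ltr_pM2r//.
Qed.

(** The growth of the quadratic gain relative to the noise contributes k (2 - beta). Replacing [b]
    by sqrt 2 ^ k times [b] costs half of the positive part of [k], since for k <= 0 this factor
    enlarges nothing. *)
Definition shell_exponent (beta : R) k : R := k%:~R * (2 - beta) - (Num.max k 0)%:~R / 2.

Lemma shell_exponentS (beta : R) k :
  shell_exponent beta k + (3 / 2 - beta) <= shell_exponent beta (k + 1).
Proof.
rewrite /shell_exponent; have [k0|k0] := leP 0 k.
  have -> : Num.max (k + 1) 0 = k + 1 by lia.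
  by rewrite intrD; lra.
have -> : Num.max (k + 1) 0 = 0 by lia.
by rewrite intrD; lra.
Qed.

Lemma sqrt2_bounds : 7 / 5 <= Num.sqrt 2 :> R /\ Num.sqrt 2 <= 3 / 2 :> R.
Proof.
split.
  rewrite -[leLHS]ger0_norm; last lra.
  by rewrite -sqrtr_sqr ler_wsqrtr//; lra.
rewrite -[leRHS]ger0_norm; last lra.
by rewrite -sqrtr_sqr ler_wsqrtr//; lra.
Qed.

(** In [peeling_sum], 96 = 4 * 24 collects the factor 4 of the tail bound and the 24 of the
    geometric series, and 21/4 = 126/24 comes from the lower bound 126 for the level at [K]. *)
Lemma expR_gt96 (x : R) : 21 / 4 <= x -> 96 <= expR x.
Proof.
move=> x0.
have e8 : 9 / 8 <= expR (1 / 8) :> R by have := expR_ge1Dx (1 / 8 : R); lra.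
have e42 : expR (1 / 8) ^+ 42 <= expR x.
  by rewrite -expRM_natl ler_expR; lra.
have p1 : 63 / 50 <= expR (1 / 8) ^+ 2 :> R.
  by apply: (@le_trans _ _ ((9 / 8) ^+ 2)); [lra|rewrite lerXn2r ?nnegrE ?expR_ge0//; lra].
have p2 : 249 / 100 <= (expR (1 / 8) ^+ 2) ^+ 4 :> R.
  by apply: (@le_trans _ _ ((63 / 50) ^+ 4)); [lra|rewrite lerXn2r ?nnegrE ?exprn_ge0 ?expR_ge0//; lra].
apply: le_trans e42.
have -> : expR (1 / 8) ^+ 42 = ((expR (1 / 8) ^+ 2) ^+ 4) ^+ 5 * expR (1 / 8) ^+ 2 :> R.
  by rewrite -!exprM -exprD.
apply: (@le_trans _ _ ((249 / 100) ^+ 5 * (63 / 50))); first lra.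
apply: ler_pM; [lra|lra| |exact: p1].
by rewrite lerXn2r ?nnegrE ?exprn_ge0 ?expR_ge0//; lra.
Qed.

(** With q = exp(- x) one has q (1 + x) <= 1, hence q / (1 - q) <= 1 / x. The induction keeps the
    sharper bound (1 - q^N) / x. *)
Lemma sum_expR_geometric (x : R) N : 0 < x -> \sum_(j < N) expR (- x) ^+ j.+1 <= x^-1.
Proof.
move=> x0; have q0 := expR_gt0 (- x).
have q1 : expR (- x) < 1 by rewrite -expR0 ltr_expR; lra.
have qx : expR (- x) * (1 + x) <= 1.
  apply: le_trans (ler_wpM2l (ltW q0) (expR_ge1Dx x)) _.
  by rewrite mulrC expRxMexpNx_1.
set q := expR (- x) in q0 q1 qx *.
have qN M : 0 <= q ^+ M by rewrite exprn_ge0// ltW.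
suff H : \sum_(j < N) q ^+ j.+1 <= (1 - q ^+ N) / x.
  by apply: le_trans H _; rewrite ler_pdivrMr// mulVf ?gt_eqF// gerBl.
elim: N => [|N IH]; first by rewrite big_ord0 expr0 subrr mul0r.
rewrite big_ord_recr/=.
have h : q ^+ N.+1 <= (q ^+ N - q ^+ N.+1) / x.
  rewrite ler_pdivlMr// exprS.
  by have := ler_wpM2l (qN N) qx; lra.
apply: le_trans (lerD IH h) _; rewrite le_eqVlt; apply/orP; left; apply/eqP; ring.
Qed.

Section PeelingSum.
Context (beta M1 Mb M r t : R) (K : int).
Context (beta_gt0 : 0 < beta) (beta_le1 : beta <= 1) (M1_gt0 : 0 < M1) (Mb_gt0 : 0 < Mb).
Context (M_ge0 : 0 <= M) (r_ge0 : 0 <= r) (t_gt0 : 0 < t).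

(** This is the quadratic growth on shell [k] in units of the noise. The growth is taken at the
    inner radius, half of the outer one, whence the 4. *)
Definition shell_level k : R := M1 * 2 `^ shell_exponent beta k / (4 * Mb).

Context (levelK : 1 + 2 * (t + 1) * eta_hat M < shell_level K - r).

Let gam : R := 3 / 2 - beta.
Let s j := shell_level (K + 1 + j%:Z).

Lemma shell_level_gt0 k : 0 < shell_level k.
Proof. by rewrite /shell_level divr_gt0// mulr_gt0// powR2_gt0. Qed.

Lemma shell_levelS k : 2 `^ gam * shell_level k <= shell_level (k + 1).
Proof.
rewrite /shell_level.
have -> : 2 `^ gam * (M1 * 2 `^ shell_exponent beta k / (4 * Mb)) =
    M1 * (2 `^ gam * 2 `^ shell_exponent beta k) / (4 * Mb) by ring.
rewrite -powR2D ler_pM2r ?invr_gt0 ?mulr_gt0// ler_pM2l//.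
by apply: ler_powR; rewrite ?ler1n// addrC; exact: shell_exponentS.
Qed.

Let gam_ge : 1 / 2 <= gam. Proof. by rewrite /gam; move: beta_le1; lra. Qed.

Let two_gam : Num.sqrt 2 <= 2 `^ gam.
Proof. by rewrite -powR12_sqrt//; apply: ler_powR; rewrite ?ler1n//; move: gam_ge; lra. Qed.

Lemma shell_level_growth j : 2 `^ (gam * j.+1%:R) * shell_level K <= s j.
Proof.
rewrite /s; elim: j => [|j IH]; first by rewrite mulr1 addr0; exact: shell_levelS.
apply: le_trans (_ : _ <= 2 `^ gam * shell_level (K + 1 + j%:Z)) _; last first.
  apply: le_trans (shell_levelS _) _; rewrite (_ : K + 1 + j.+1%:Z = K + 1 + j%:Z + 1)//; lia.
apply: le_trans (ler_wpM2l (powR_ge0 _ _) IH).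
have -> : gam * j.+2%:R = gam + gam * j.+1%:R by rewrite -[j.+2%:R]natr1; ring.
by rewrite powR2D -mulrA lexx.
Qed.

Let levelK_ge : 1 + 128 * Num.sqrt 2 * (t + 1) * (M + 7 / 10) < shell_level K - r.
Proof. by apply: le_lt_trans levelK; rewrite /eta_hat; lra. Qed.

Let s_ge_sqrt2 j : Num.sqrt 2 * shell_level K <= s j.
Proof.
apply: le_trans (shell_level_growth j); rewrite ler_wpM2r ?(ltW (shell_level_gt0 _))//.
apply: le_trans two_gam _; apply: ler_powR; rewrite ?ler1n//.
by rewrite ler_peMr ?ler1n//; move: gam_ge; lra.
Qed.

(** Passing from [K] to [K + 1] multiplies the level by at least sqrt 2, which turns the 128 sqrt 2
    of the assumption into 256 and its summand 1 into at least 7/5. *)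
Let u_ge j : 256 * (t + 1) * (M + 7 / 10) + 7 / 5 <= s j - r.
Proof.
have [q1 q2] := sqrt2_bounds; have := s_ge_sqrt2 j; have := levelK_ge.
move: M_ge0 r_ge0 t_gt0; set q := Num.sqrt 2 in q1 q2 *; set S := shell_level K; set x := s j.
move=> m0 r0 t0 h1 h2.
have qq : q * q = 2 by rewrite -expr2 /q sqr_sqrtr.
have h3 : q * (1 + 128 * q * (t + 1) * (M + 7 / 10)) <= q * (S - r).
  by rewrite ler_pM2l//; lra.
have e : q * (1 + 128 * q * (t + 1) * (M + 7 / 10)) = q + 128 * (q * q) * ((t + 1) * (M + 7 / 10)).
  by ring.
rewrite e qq in h3.
have : q * r >= 1 * r by rewrite ler_wpM2r//; lra.
lra.
Qed.

Lemma shell_level_large j : 256 * (M + 7 / 10) + 7 / 5 <= s j - r.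
Proof.
apply: le_trans (u_ge j); rewrite lerD2r.
by rewrite ler_wpM2r//; move: M_ge0 t_gt0; lra.
Qed.

(** One factor of the square is at least 32^-1 times 179 (t + 1), the other at least 32^-1 times 2/7
    of [s j]. Since [gfrak t] is at most (t + 1) / 224, the product covers the rate of [P_1] and
    leaves [s j / 24] for the summation. *)
Let u_sq j : gfrak t * shell_level K + s j / 24 <= ((s j - r) / 32) ^+ 2.
Proof.
have [q1 q2] := sqrt2_bounds; have h1 := s_ge_sqrt2 j; have h2 := levelK_ge; have h3 := u_ge j.
have g1 := gfrak_le t_gt0; have g0 := gfrak_ge0 t_gt0.
move: M_ge0 r_ge0 t_gt0 h1 h2 h3 => m0 r0 t0 h1 h2 h3.
have S0 := shell_level_gt0 K.
set q := Num.sqrt 2 in q1 q2 h1 h2; set S := shell_level K in h1 h2 S0 *; set x := s j in h1 h3 *.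
have tm : 0 <= (t + 1) * M by rewrite mulr_ge0//; lra.
have rS : r <= S.
  have : 0 <= 128 * q * (t + 1) * (M + 7 / 10) by rewrite !mulr_ge0//; lra.
  lra.
have Sx : S <= 5 / 7 * x.
  have : 7 / 5 * S <= q * S by rewrite ler_pM2r.
  lra.
have u1 : 179 * (t + 1) <= x - r by lra.
have u2 : 2 / 7 * x <= x - r by lra.
have x0 : 0 < x by lra.
have p : (179 * (t + 1)) * (2 / 7 * x) <= (x - r) * (x - r) by apply: ler_pM => //; lra.
have -> : ((x - r) / 32) ^+ 2 = (x - r) * (x - r) / 1024 by field.
have gS : gfrak t * S <= (t + 1) / 224 * (5 / 7 * x) by apply: ler_pM => //; lra.
have tx : 0 <= t * x by rewrite mulr_ge0//; lra.
lra.
Qed.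

(** Let S be the level at [K]. The bound 2^(gam (j+1)) >= 1 + gam (j+1) ln 2 turns the reserve
    [s j / 24] into S / 24 plus a term linear in [j]. The linear term gives a geometric series with
    sum at most 24 / (gam ln 2 S), and exp(- S / 24) absorbs the factor 4 * 24. *)
Lemma peeling_sum N :
  \sum_(j < N) 4 * expR (- ((s j - r) / 32) ^+ 2) <=
  (gam * ln 2 * shell_level K)^-1 * expR (- (gfrak t * shell_level K)).
Proof.
have S0 := shell_level_gt0 K; have l2 := ln2_gt0.
have g0 : 0 < gam by move: gam_ge; lra.
set S := shell_level K in S0 *.
pose x := S * gam * ln 2 / 24.
have x0 : 0 < x by apply: divr_gt0 => //; apply: mulr_gt0 => //; exact: mulr_gt0.
have S126 : 126 <= S.
  have [q1 q2] := sqrt2_bounds; have := levelK_ge; rewrite -/S.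
  set q := Num.sqrt 2 in q1 q2 *; move: M_ge0 r_ge0 t_gt0 => m0 r0 t0.
  have : 7 / 5 * (7 / 10) <= q * ((t + 1) * (M + 7 / 10)).
    apply: ler_pM => //; try lra.
    have : 0 <= t * M by rewrite mulr_ge0// ltW.
    lra.
  lra.
apply: le_trans (_ : _ <= \sum_(j < N) (4 * expR (- (gfrak t * S)) * expR (- (S / 24)))
    * expR (- x) ^+ j.+1) _.
  apply: ler_sum => j _.
  have -> : 4 * expR (- (gfrak t * S)) * expR (- (S / 24)) * expR (- x) ^+ j.+1 =
      4 * expR (- (gfrak t * S) - S / 24 + j.+1%:R * (- x)).
    by rewrite !expRD expRM_natl; ring.
  rewrite ler_pM2l// ler_expR.
  have h1 := u_sq j; have := shell_level_growth j; rewrite -/S in h1 *.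
  have e1 : 1 + gam * j.+1%:R * ln 2 <= 2 `^ (gam * j.+1%:R).
    by rewrite /powR pnatr_eq0/=; exact: expR_ge1Dx.
  have h2 := ler_wpM2r (ltW S0) e1 => h3.
  have h4 := le_trans h2 h3.
  rewrite /x; lra.
rewrite -mulr_sumr.
apply: le_trans (ler_wpM2l _ (sum_expR_geometric N x0)) _; first by rewrite !mulr_ge0 ?expR_ge0.
have -> : x^-1 = 24 * (gam * ln 2 * S)^-1.
  by rewrite /x; field; rewrite !gt_eqF.
have big : 96 * expR (- (S / 24)) <= 1.
  rewrite expRN -ler_pdivlMr ?invr_gt0 ?expR_gt0// invrK mul1r; apply: expR_gt96; lra.
set D := (gam * ln 2 * S)^-1.
have D0 : 0 < D by rewrite invr_gt0; apply: mulr_gt0 => //; exact: mulr_gt0.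
have : (D * expR (- (gfrak t * S))) * (96 * expR (- (S / 24))) <= (D * expR (- (gfrak t * S))) * 1.
  by rewrite ler_wpM2l// mulr_ge0 ?expR_ge0// ltW.
lra.
Qed.

End PeelingSum.

(** The first exponential of [P_1] is at least 1. The other two factors depend on a single quantity
    [X] and decrease in it, and [X] is at most the level at [K_eps eps]: of the factor 2^(4 - beta),
    2^(2 - beta) pays for rounding [eps] to a power of 2, and 4 is the one of [shell_level]. *)
Lemma P_1_ge (beta M1 l2 Mab Mb nL2 b t eps : R) : 0 < beta -> beta <= 1 -> 0 < M1 -> 0 < Mb ->
  0 <= l2 -> 0 <= Mab -> 0 <= nL2 -> 0 < b -> 0 < t -> 0 < eps ->
  ((3 / 2 - beta) * ln 2 * shell_level beta M1 Mb (K_eps eps))^-1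
    * expR (- (gfrak t * shell_level beta M1 Mb (K_eps eps)))
  <= P_1 M1 beta l2 Mab Mb nL2 b t eps.
Proof.
move=> b0 b1 M10 Mb0 l20 Mab0 nL0 bb0 t0 e0.
set K := K_eps eps; set S := shell_level _ _ _ _.
have S0 : 0 < S by exact: shell_level_gt0.
have g0 := gfrak_ge0 t0; have ln20 := ln2_gt0.
pose X := eps `^ (3 / 2 - beta) * Num.sqrt (Num.min eps 2) * M1 / (2 `^ (4 - beta) * Mb).
have min0 : 0 < Num.min eps 2 by rewrite lt_min e0/=.
have p4 : 0 < 2 `^ (4 - beta) :> R by exact: powR2_gt0.
have X0 : 0 < X by rewrite /X divr_gt0 ?mulr_gt0 ?powR_gt0 ?sqrtr_gt0.
have XS : X <= S.
  have [_ eK] := K_eps_bounds e0; rewrite -/K in eK.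
  have h1 : eps `^ (3 / 2 - beta) <= 2 `^ ((K%:~R + 1) * (3 / 2 - beta)).
    by rewrite powRrM ge0_ler_powR ?nnegrE ?powR_ge0 ?(ltW e0) ?(ltW eK)//; lra.
  have h2 : Num.sqrt (Num.min eps 2) <= 2 `^ ((K%:~R + 1 - (Num.max K 0)%:~R) / 2).
    rewrite powRrM powR12_sqrt ?powR_ge0// ler_wsqrtr//.
    have [k0|k0] := leP 0 K.
      by rewrite addrAC subrr add0r powRr1// ge_min lexx orbT.
    by rewrite subr0 ge_min ltW.
  have h3 := ler_pM (powR_ge0 _ _) (sqrtr_ge0 _) h1 h2.
  rewrite -powR2D in h3.
  rewrite /X /S /shell_level ler_pdivrMr ?mulr_gt0//.
  have -> : M1 * 2 `^ shell_exponent beta K / (4 * Mb) * (2 `^ (4 - beta) * Mb)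
      = (2 `^ shell_exponent beta K * (2 `^ (4 - beta) / 4)) * M1 by field; rewrite gt_eqF.
  have -> : 2 `^ (4 - beta) / 4 = 2 `^ (2 - beta) :> R.
    have -> : 4 - beta = 2 + (2 - beta) by ring.
    rewrite powR2D.
    by rewrite powR_mulrn//; field.
  rewrite -powR2D.
  rewrite ler_pM2r//; apply: le_trans h3 _; apply: ler_powR; rewrite ?ler1n// /shell_exponent.
  lra.
have first_ge1 : 1 <= expR (l2 * Mab * gfrak t / (Num.min (Num.sqrt eps) 1 * b * nL2)).
  rewrite -expR0 ler_expR; apply: divr_ge0.
    by apply: mulr_ge0 => //; exact: mulr_ge0.
  apply: mulr_ge0 => //; apply: mulr_ge0; last exact: ltW.
  by rewrite le_min sqrtr_ge0/=.
rewrite /P_1.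
have -> : 2 `^ (4 - beta) * Mb / ((3 / 2 - beta) * ln 2 * M1 * eps `^ (3 / 2 - beta)
      * Num.sqrt (Num.min eps 2)) = ((3 / 2 - beta) * ln 2 * X)^-1.
  rewrite /X; field; rewrite !gt_eqF ?powR_gt0 ?sqrtr_gt0//; lra.
have -> : eps `^ (3 / 2 - beta) * Num.sqrt (Num.min eps 2) * M1 * gfrak t /
           (2 `^ (4 - beta) * Mb) = gfrak t * X by rewrite /X; ring.
have gl0 : 0 < (3 / 2 - beta) * ln 2 by apply: mulr_gt0 => //; lra.
have glX : 0 < (3 / 2 - beta) * ln 2 * X by exact: mulr_gt0.
have glS : 0 < (3 / 2 - beta) * ln 2 * S by exact: mulr_gt0.
have second : ((3 / 2 - beta) * ln 2 * S)^-1 <= ((3 / 2 - beta) * ln 2 * X)^-1.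
  by rewrite lef_pV2 ?posrE// ler_pM2l.
have third : expR (- (gfrak t * S)) <= expR (- (gfrak t * X)).
  by rewrite ler_expR lerN2 ler_wpM2l.
apply: ler_pM => //; rewrite ?expR_ge0 ?invr_ge0 ?(ltW glS)//.
rewrite -[leLHS]mul1r; apply: ler_pM => //.
by rewrite invr_ge0 ltW.
Qed.

End PeelingNumerics.

(** * Integral estimates *)

Section LebesgueShift.
Context {R : realType}.
Notation mu := (@lebesgue_measure R).
Notation shift c := ((fun x : R => x + c) : measurableTypeR R -> measurableTypeR R).

Lemma measurable_shift (c : R) : measurable_fun setT (shift c).
Proof. exact: measurable_funD. Qed.

Lemma shift_preimage_itv (c x y : R) b b' :
  shift c @^-1` [set` Interval (BSide b x) (BSide b' y)] =
  [set` Interval (BSide b (x - c)) (BSide b' (y - c))].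
Proof.
apply/seteqP; split=> z /=; rewrite !in_itv/= => /andP[];
case: b; case: b' => /=; rewrite ?lerBlDr ?ltrBlDr ?lerBrDr ?ltrBrDr => -> ->//.
Qed.

Lemma lebesgue_measure_shift c (A : set (measurableTypeR R)) : measurable A ->
  pushforward mu (shift c) A = mu A.
Proof.
move=> mA; apply/esym/lebesgue_measure_unique => //=.
  exact: measurable_shift.
move=> ? _ [[a b]] _ <-.
rewrite /pushforward shift_preimage_itv !lebesgue_measure_itv/=.
rewrite !lte_fin ltrD2r; case: ifP => // _.
by rewrite -!EFinB; congr EFin; ring.
Qed.

Lemma integral_shift (f : measurableTypeR R -> \bar R) (D : set (measurableTypeR R)) (c : R) : measurable D ->
  mu.-integrable D f ->
  mu.-integrable (shift c @^-1` D) (f \o shift c) /\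
  (\int[mu]_(x in D) f x = \int[mu]_(x in shift c @^-1` D) f (x + c)%R)%E.
Proof.
move=> mD fi; pose F := f \_ D.
have ms := measurable_shift c.
have Fi : mu.-integrable setT F by exact: (iffLR (integrable_mkcond f mD) fi).
have mF : measurable_fun setT F by exact: measurable_int Fi.
have mpre : measurable (shift c @^-1` D) by have := ms measurableT _ mD; rewrite setTI.
have patchE : (f \o shift c) \_ (shift c @^-1` D) = F \o shift c.
  by apply/funext => x; rewrite /F /patch /=; congr (if _ then _ else _); apply/idP/idP => /set_mem h; exact/mem_set.
have inv A : measurable A -> A `<=` setT -> pushforward mu (shift c) A = mu A.
  by move=> mA _; exact: lebesgue_measure_shift.
have i' : mu.-integrable setT (F \o shift c).
  apply/integrableP; split; first exact: (measurableT_comp mF ms).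
  have -> : (\int[mu]_x `|(F \o shift c) x| = \int[mu]_x `|F x|)%E.
    transitivity (\int[pushforward mu (shift c)]_x `|F x|)%E.
      rewrite (ge0_integral_pushforward ms)//.
      exact: (measurableT_comp (abse_measurable (D := setT)) mF).
    exact: eq_measure_integral.
  by have /integrableP[] := Fi.
split; first by apply: (iffRL (integrable_mkcond (f \o shift c) mpre)); rewrite patchE.
rewrite integral_mkcond [RHS]integral_mkcond patchE.
transitivity (\int[pushforward mu (shift c)]_x F x)%E; last by rewrite (integral_pushforward ms).
by apply/esym; exact: eq_measure_integral.
Qed.

(** The integrands are compared at equal offsets from two base points, so both windows are first
    translated to the same interval. *)
Lemma shift_difference (f g : R -> R) (p q l h C : R) : l <= h ->
  mu.-integrable `[p + l, p + h] (EFin \o f) ->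
  mu.-integrable `[q + l, q + h] (EFin \o g) ->
  (forall x, l <= x <= h -> `|f (p + x) - g (q + x)| <= C) ->
  `|\int[mu]_(x in `[p + l, p + h]) f x - \int[mu]_(x in `[q + l, q + h]) g x|
    <= (h - l) * C.
Proof.
move=> lh fi gi fg.
have mitv (x y : R) : measurable (`[x, y]%classic : set (measurableTypeR R)) by exact: measurable_itv.
have pre (x : R) : shift x @^-1` `[x + l, x + h] = `[l, h]%classic.
  by rewrite shift_preimage_itv (addrC x l) (addrC x h) !addrK.
have [fi' fE] := integral_shift p (mitv _ _) fi.
have [gi' gE] := integral_shift q (mitv _ _) gi.
rewrite pre in fi' fE; rewrite pre in gi' gE.
rewrite /Rintegral fE gE -!/(Rintegral _ _ _).
rewrite -RintegralB//.
have muI : mu (`[l, h]%classic : set (measurableTypeR R)) = (h - l)%:E.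
  rewrite lebesgue_measure_itv/= lte_fin; case: ifPn => [_|]; first by rewrite EFinB.
  by rewrite -leNgt => hl; congr EFin; lra.
have ci : mu.-integrable `[l, h] (EFin \o cst C).
  apply/integrableP; split; first exact: (measurable_cst C%:E).
  rewrite /= integral_cst//.
  by rewrite [X in (_ * X)%E](_ : _ = (h - l)%:E) ?muI// -EFinM ltry.
have di : mu.-integrable `[l, h] (EFin \o (fun x => f (x + p) - g (x + q))).
  exact: integrableB fi' gi'.
apply: le_trans (le_normr_Rintegral (mitv _ _) di) _.
apply: le_trans (_ : _ <= \int[mu]_(x in `[l, h]) C) _.
  apply: le_Rintegral => //; first exact: (integrable_abse di).
  move=> x /=; rewrite in_itv/= => /fg; by rewrite ![x + _]addrC.
rewrite Rintegral_cst//.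
by rewrite [X in _ * fine X](_ : _ = (h - l)%:E) ?muI//= mulrC.
Qed.

End LebesgueShift.

Section UniformIntegrability.
Context {R : realType} d (T : measurableType d) (Q : probability T R).

(** Separability only gives closeness of [G] in mean, while the Lipschitz factor is unbounded. Where
    the factor exceeds [N], dominated convergence makes the envelope term small uniformly in [g];
    elsewhere it costs at most [N]. *)
Lemma integral_mul_small (L xi : T -> R) (e : R) : measurable_fun setT L -> measurable_fun setT xi ->
  (forall z, 0 <= L z) -> (forall z, 0 <= xi z) ->
  Q.-integrable setT (fun z => (L z * xi z)%:E) -> 0 < e ->
  exists2 eta : R, 0 < eta & forall g : T -> R, measurable_fun setT g ->
    (forall z, `|g z| <= xi z) -> (\int[Q]_z `|g z|%:E <= eta%:E)%E ->
    (\int[Q]_z (L z * `|g z|)%:E <= e%:E)%E.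
Proof.
move=> mL mxi L0 xi0 iL e0.
pose f_ (N : nat) z : \bar R := (L z * xi z * \1_[set z | N%:R < L z] z)%:E.
have mset N : measurable [set z | (N%:R : R) < L z] by exact: measurable_set_lt.
have mf N : measurable_fun setT (f_ N).
  apply/measurable_EFinP; apply: measurable_funM; first exact: measurable_funM.
  exact: measurable_indic.
have fcvg : \forall x \ae Q, setT x -> f_ ^~ x @ \oo --> (cst 0%E : T -> \bar R) x.
  apply: aeW => z _; apply: cvg_near_cst.
  near=> N; rewrite /f_ indicE memNset ?mulr0//= => /lt_geF.
  by move/negP; apply; near: N; exact: nbhs_infty_ger.
have fle : \forall x \ae Q, forall N, setT x -> (`|f_ N x| <= (L x * xi x)%:E)%E.
  apply: aeW => z N _; rewrite /f_ lee_fin ger0_norm; last by rewrite !mulr_ge0.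
  by rewrite ler_piMr ?mulr_ge0// indicE lern1 leq_b1.
have [_ _] := dominated_convergence measurableT mf (measurable_cst _) fcvg iL fle.
rewrite integral0 => /fine_cvgP[hfin hcvg].
have e2 : 0 < e / 2 by lra.
have [N [Nfin Nlt]] : exists N, (\int[Q]_z f_ N z)%E \is a fin_num /\
    fine (\int[Q]_z f_ N z)%E < e / 2.
  have hlt : \forall N \near \oo, fine (\int[Q]_z f_ N z)%E < e / 2 by exact: cvgr_lt hcvg _ e2.
  have [N _ hN] := filterI hfin hlt.
  by exists N; exact: (hN N (leqnn N)).
have N1 : 0 < 2 * (N%:R + 1) :> R by rewrite mulr_gt0// ltr_wpDl.
exists (e / (2 * (N%:R + 1))); first by rewrite divr_gt0.
move=> g mg gxi geta.
have mabs : measurable_fun setT (fun z => `|g z|) by exact: (measurableT_comp (@normr_measurable R setT)).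
apply: le_trans (_ : _ <= \int[Q]_z (f_ N z + (N%:R * `|g z|)%:E))%E _.
  apply: ge0_le_integral => //.
  - by move=> z _; rewrite lee_fin mulr_ge0.
  - by apply/measurable_EFinP; exact: measurable_funM.
  - apply: emeasurable_funD => //; apply/measurable_EFinP; exact: measurable_funM.
  move=> z _; rewrite /f_ -EFinD lee_fin indicE.
  have [LN|NL] := ltP N%:R (L z).
    rewrite mem_set// mulr1; apply: le_trans (_ : _ <= L z * xi z) _; first by rewrite ler_wpM2l.
    by rewrite lerDl mulr_ge0.
  by rewrite memNset ?mulr0 ?add0r ?ler_wpM2r//=; apply/negP; rewrite -leNgt.
have f0 z : (0 <= f_ N z)%E by rewrite lee_fin !mulr_ge0.
rewrite ge0_integralD//; last by apply/measurable_EFinP; exact: measurable_funM.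
have -> : e%:E = ((e / 2)%:E + (e / 2)%:E)%E by rewrite -EFinD; congr EFin; lra.
apply: leeD; first by rewrite -(fineK Nfin) lee_fin ltW.
under eq_integral do rewrite EFinM.
rewrite ge0_integralZl_EFin//; last exact/measurable_EFinP.
apply: le_trans (lee_wpmul2l _ geta) _; first by rewrite lee_fin.
rewrite -EFinM lee_fin.
have -> : N%:R * (e / (2 * (N%:R + 1))) = (e / 2) * (N%:R / (N%:R + 1)).
  by field; rewrite gt_eqF// ltr_wpDl.
rewrite ler_piMr ?(ltW e2)// ler_pdivrMr ?mul1r ?lerDl// ltr_wpDl//.
Unshelve. all: by end_near.
Qed.

End UniformIntegrability.

(** * Norms, empirical deviations and measurability of suprema *)

Section SquareNorm.
Context {R : realType} d (T : measurableType d) (Q : probability T R).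

Lemma integral_sq_ge0 (f : T -> R) : 0 <= \int[Q]_z f z ^+ 2.
Proof. by apply: Rintegral_ge0 => z _; exact: sqr_ge0. Qed.

Lemma EFin_integral_sq (f : T -> R) : f \in Lfun Q 2%:E ->
  (\int[Q]_z (f z ^+ 2)%:E = (\int[Q]_z f z ^+ 2)%:E)%E.
Proof.
move=> f2; rewrite /Rintegral fineK//.
exact: (integrable_fin_num _ (Lfun2_integrable_sqr f2)).
Qed.

Lemma Lnorm2_sqrt (f : T -> R) : f \in Lfun Q 2%:E ->
  ('N[Q]_2%:E[EFin \o f] = (Num.sqrt (\int[Q]_z f z ^+ 2))%:E)%E.
Proof.
move=> f2; rewrite unlock /=.
rewrite (eq_integral (fun z => (f z ^+ 2)%:E)); last first.
  by move=> z _; rewrite powR_mulrn ?normr_ge0// real_normK ?num_real.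
by rewrite EFin_integral_sq// poweR_EFin powR12_sqrt// integral_sq_ge0.
Qed.

Lemma sq_integral_le (f : T -> R) : f \in Lfun Q 2%:E ->
  (\int[Q]_z f z) ^+ 2 <= \int[Q]_z f z ^+ 2.
Proof.
move=> f2; have := variance_ge0 Q f; rewrite varianceE// unlock.
have E1 : (\int[Q]_z (f z)%:E = (\int[Q]_z f z)%:E)%E.
  by rewrite /Rintegral fineK// integrable_fin_num//; exact: Lfun2_integrable.
have -> : (\int[Q]_z ((f ^+ 2)%R z)%:E)%E = (\int[Q]_z f z ^+ 2)%:E.
  exact: EFin_integral_sq.
by rewrite E1 -EFin_expe -EFinB lee_fin subr_ge0.
Qed.

End SquareNorm.

Section EuclideanNorm.
Context {R : realType} (m : nat).
Implicit Types (x y : 'rV[R]_m) (Theta : set 'rV[R]_m).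

Lemma enorm_ge0 x : 0 <= enorm x.
Proof. exact: sqrtr_ge0. Qed.

Lemma enorm_sqr x : enorm x ^+ 2 = \sum_(i < m) x 0 i ^+ 2.
Proof. by rewrite sqr_sqrtr// sumr_ge0// => i _; exact: sqr_ge0. Qed.

Lemma enorm_le_diam Theta x y : compact Theta -> Theta x -> Theta y ->
  enorm (x - y) <= ediam Theta.
Proof.
move=> cT Tx Ty; apply: ub_le_sup; last by exists x => //; exists y.
have [B [_ hB]] := compact_bounded cT.
have {}hB : forall x, Theta x -> `|x| <= B + 1 by apply: hB; rewrite ltrDl.
exists (Num.sqrt (\sum_(i < m) (2 * (B + 1)) ^+ 2)) => _ [x' Tx' [y' Ty' <-]].
rewrite /enorm ler_wsqrtr//; apply: ler_sum => i _.
have B0 : 0 <= B + 1 by exact: le_trans (hB _ Tx).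
rewrite -real_normK ?num_real// ler_sqr ?nnegrE ?mulr_ge0//.
have co (v : 'rV[R]_m) : `|v 0 i| <= `|v|
  by rewrite [leRHS]mx_normrE; exact: (le_bigmax 0 (fun ij => `|v ij.1 ij.2|) (0, i)).
rewrite !mxE; apply: le_trans (ler_normB _ _) _.
have := le_trans (co _) (hB _ Tx'); have := le_trans (co _) (hB _ Ty'); lra.
Qed.

(** It makes [event_Theta] an event about a supremum over a ball around [theta_star]. *)
Lemma eball_in_diam Theta x : compact Theta -> Theta x ->
  eball_in Theta x (ediam Theta) = Theta.
Proof.
move=> cT Tx; apply/seteqP; split=> y; first by case.
by move=> Ty; split => //; exact: enorm_le_diam.
Qed.

Lemma measurable_enorm_gt (x : 'rV[R]_m) (c : R) :
  measurable ([set y : borel_rV R m | c < enorm (y - x)] : set (borel_rV R m)).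
Proof.
have [c0|c0] := ltP c 0.
  rewrite (_ : [set y | _] = setT)//; apply/seteqP; split=> y // _ /=.
  exact: lt_le_trans c0 (enorm_ge0 _).
have -> : [set y : borel_rV R m | c < enorm (y - x)] =
    (fun y : 'rV[R]_m => \sum_(i < m) (y 0 i - x 0 i) ^+ 2) @^-1` [set r | c ^+ 2 < r].
  apply/funext => y /=; apply/propext.
  have -> : \sum_(i < m) (y 0 i - x 0 i) ^+ 2 = enorm (y - x) ^+ 2.
    by rewrite enorm_sqr; apply: eq_bigr => i _; rewrite !mxE.
  by rewrite ltr_sqr ?nnegrE ?enorm_ge0.
apply: sub_sigma_algebra; apply: open_comp; last exact: open_gt.
have cont (r : seq 'I_m) :
    continuous (fun y : 'rV[R]_m => \sum_(i <- r) (y 0 i - x 0 i) ^+ 2).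
  elim: r => [|i r IH].
    have -> : (fun y : 'rV[R]_m => \sum_(i <- [::]) (y 0 i - x 0 i) ^+ 2) = cst 0.
      by apply/funext => z; rewrite big_nil.
    exact: cst_continuous.
  move=> y; rewrite (_ : (fun y : 'rV[R]_m => _) = (fun y => (y 0 i - x 0 i) ^+ 2
      + \sum_(i <- r) (y 0 i - x 0 i) ^+ 2)).
    have ci := @coord_continuous R 1 m 0 i y.
    have cx := @cst_continuous 'rV[R]_m R (- x 0 i) y.
    exact: cvgD (cvgM (cvgD ci cx) (cvgD ci cx)) (IH y).
  by apply/funext => z; rewrite big_cons.
move=> y _; exact: cont.
Qed.

End EuclideanNorm.

(** * Separability along the observed sample and measurable suprema *)

Section Sampling.
Context {R : realType} disp (Omega : measurableType disp) (P : probability Omega R).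
Context (P_complete : measure_is_complete P) (m d : nat).
Context (Z : nat -> {RV P >-> borel_rV R d}) (Q : probability (borel_rV R d) R).
Context (Ziid : iid_with_law Z Q).
Context (Theta : set 'rV[R]_m) (G : 'rV[R]_m -> borel_rV R d -> R) (theta_star : 'rV[R]_m).

Lemma expectE (f : borel_rV R d -> R) : Q.-integrable setT (EFin \o f) ->
  expect Z f = \int[Q]_z f z.
Proof. exact: Rintegral_iid. Qed.

Lemma empirical_deviationE n (f : borel_rV R d -> R) w : (0 < n)%N ->
  Q.-integrable setT (EFin \o f) ->
  empirical_deviation Z n f w =
  n%:R^-1 * (\sum_(j < n) f (Z j w) - n%:R * \int[Q]_z f z).
Proof.
move=> n0 fi; rewrite /empirical_deviation sumrB.
under [X in _ - X]eq_bigr do rewrite (Rintegral_iid Ziid)//.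
by rewrite sumr_const card_ord -[X in _ - X]mulr_natl.
Qed.

Context (G_separable : forall delta : R, 0 < delta ->
     exists (C : set 'rV[R]_m) (N : forall n, set (n.-tuple (borel_rV R d))),
       [/\ countable C,
           C `<=` eball_in Theta theta_star delta,
           (forall n, (0 < n)%N ->
              (power_probability Q n).-negligible (N n)) &
           forall theta n (z : n.-tuple (borel_rV R d)),
             eball_in Theta theta_star delta theta -> (0 < n)%N -> ~ N n z ->
             ereal_inf
               [set (expect Z (fun x => `|G theta x - G vartheta x|)
                     + \big[Num.max/0]_(j < n)
                         `|G theta (tnth z j) - G vartheta (tnth z j)|)%:E
               | vartheta in C] = 0%E]).

Lemma eball_center (delta : R) : Theta theta_star -> 0 < delta ->
  eball_in Theta theta_star delta theta_star.
Proof.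
move=> Ts d0; split => //; rewrite subrr /enorm big1 ?sqrtr0 ?ltW// => i _.
by rewrite mxE expr0n.
Qed.

(** The null set is pulled back along the sample and serves all theta at once, while the index [k]
    may depend on [w], [theta] and [e]. Both parts of the vanishing infimum are nonnegative, so one
    point of the countable set makes both small. *)
Lemma sample_separable (delta : R) n : Theta theta_star -> 0 < delta -> (0 < n)%N ->
  exists (f : nat -> 'rV[R]_m) (N : set Omega),
    [/\ forall k, eball_in Theta theta_star delta (f k), measurable N, P N = 0%E &
      forall w theta (e : R), ~ N w -> eball_in Theta theta_star delta theta -> 0 < e ->
        exists k, expect Z (fun x => `|G theta x - G (f k) x|) < e /\
          forall j : 'I_n, `|G theta (Z j w) - G (f k) (Z j w)| < e].
Proof.
move=> Ts d0 n0; have [C [N [cC CU Nnull inf0]]] := G_separable d0.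
have [f [fU fC]] : exists f : nat -> 'rV[R]_m,
    (forall k, eball_in Theta theta_star delta (f k)) /\ forall x, C x -> exists k, f k = x.
  have /pfcard_geP[C0|[f]] := cC.
    by exists (fun=> theta_star); split => [k|x]; [exact: eball_center|rewrite C0].
  exists f; split=> [k|x Cx]; first by apply: CU; exact: funS.
  by have [k _ <-] := 'surj_f Cx; exists k.
have [A [mA A0 NA]] := Nnull n n0.
pose s : n.-tuple nat := [tuple of iota 0 n].
exists f, (sample Z s @^-1` A); split=> //.
- by rewrite -[X in measurable X]setTI; exact: measurable_sample.
- by rewrite (sample_law Ziid)//; exact: (iota_uniq 0 n).
move=> w theta e Nw Uth e0.
have Nw' : ~ N n (sample Z s w) by move=> h; apply: Nw; exact: NA.
have := inf0 theta n _ Uth n0 Nw' => inf_eq.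
have /ereal_inf_lt[_ [v Cv <-]] : (ereal_inf [set (expect Z (fun x => `|G theta x - G vartheta x|)
                     + \big[Num.max/0]_(j < n)
                         `|G theta (tnth (sample Z s w) j) - G vartheta (tnth (sample Z s w) j)|)%:E
               | vartheta in C] < e%:E)%E by rewrite inf_eq lte_fin.
rewrite lte_fin => lte.
have ex0 : 0 <= expect Z (fun x => `|G theta x - G v x|) by apply: Rintegral_ge0.
have mx (j : 'I_n) : `|G theta (Z j w) - G v (Z j w)| <= \big[Num.max/0]_(j < n)
    `|G theta (tnth (sample Z s w) j) - G v (tnth (sample Z s w) j)|.
  have sE : Z j w = tnth (sample Z s w) j by rewrite tnth_mktuple (tnth_nth 0%N) nth_iota.
  rewrite sE; exact: (le_bigmax 0 (fun j => `|G theta (tnth (sample Z s w) j)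
    - G v (tnth (sample Z s w) j)|)).
have [k fk] := fC _ Cv; exists k; rewrite fk; split.
  by apply: le_lt_trans lte; rewrite lerDl bigmax_ge_id.
by move=> j; apply: le_lt_trans lte; apply: le_trans (mx j) _; rewrite lerDr.
Qed.

(* By completeness, an event that differs from a measurable one by a subset of a null set is measurable. *)
Lemma measurable_event_sup (f : 'rV[R]_m -> borel_rV R d -> R) (delta c : R) n :
  Theta theta_star -> 0 < delta -> (0 < n)%N ->
  (forall theta, eball_in Theta theta_star delta theta -> Q.-integrable setT (EFin \o f theta)) ->
  (forall theta vartheta z, f theta z - f vartheta z = G theta z - G vartheta z) ->
  measurable [set w | (ereal_sup [set `|empirical_deviation Z n (f theta) w|%:E
     | theta in eball_in Theta theta_star delta] <= c%:E)%E].
Proof.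
move=> Ts d0 n0 fi fG.
have [v [N [vU mN N0 sep]]] := sample_separable Ts d0 n0.
set U := eball_in _ _ _ in fi vU sep *.
have n0R : 0 < n%:R :> R by rewrite ltr0n.
pose D theta w := `|empirical_deviation Z n (f theta) w|.
set A := [set w | _].
have AE w : A w <-> forall theta, U theta -> D theta w <= c.
  rewrite /A /=; split=> [/ereal_supP h theta Uth|h].
    by have := h _ (imageP _ Uth); rewrite lee_fin.
  by apply/ereal_supP => _ [theta Uth <-]; rewrite lee_fin; exact: h.
pose B := \bigcap_k [set w | D (v k) w <= c].
have mB : measurable B.
  apply: bigcap_measurable => // k _; apply: measurable_set_le.
  apply: (measurableT_comp (@normr_measurable R setT)).
  apply: measurable_funM => //; apply: measurable_sum => j; apply: measurable_funB => //.
  have mf := iffLR (measurable_EFinP _ _) (measurable_int _ (fi _ (vU k))).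
  exact: (measurableT_comp mf (measurable_funPT (Z j))).
have AB : A `<=` B by move=> w /AE h k _; exact: h.
have BA : B `\` A `<=` N.
  move=> w [Bw nA]; apply: contrapT => Nw; apply: nA; apply/AE => theta Uth.
  apply/ler_addgt0Pr => e e0.
  have e2 : 0 < e / 2 by lra.
  have [k [h1 h2]] := sep w theta _ Nw Uth e2.
  have := Bw k I; rewrite /= => Dv.
  have diffi : Q.-integrable setT (EFin \o (fun z => G theta z - G (v k) z)).
    apply: (eq_integrable measurableT ((EFin \o f theta) \- (EFin \o f (v k)))%E); last first.
      exact: (integrableB measurableT (fi _ Uth) (fi _ (vU k))).
    by move=> z _; rewrite /= -EFinB; congr EFin; exact: fG.
  have intB : `|\int[Q]_z f theta z - \int[Q]_z f (v k) z| <= e / 2.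
    rewrite -RintegralB//; [|exact: fi|exact: (fi _ (vU k))].
    under eq_Rintegral do rewrite fG.
    apply: le_trans (le_normr_Rintegral measurableT diffi) _.
    by move: h1; rewrite expectE; [exact: ltW|exact: integrable_abse diffi].
  have sumB : `|\sum_(j < n) f theta (Z j w) - \sum_(j < n) f (v k) (Z j w)| <= n%:R * (e / 2).
    rewrite -sumrB; apply: le_trans (ler_norm_sum _ _ _) _.
    apply: (@le_trans _ _ (\sum_(j < n) (e / 2))).
      by apply: ler_sum => j _; rewrite fG ltW// h2.
    by rewrite sumr_const card_ord -[leLHS]mulr_natl.
  suff h : D theta w <= D (v k) w + e by apply: le_trans h _; rewrite lerD2r.
  rewrite /D !empirical_deviationE//; [|exact: (fi _ (vU k))|exact: fi].
  set S1 := \sum_(j < n) _ in sumB *; set S2 := \sum_(j < n) _ in sumB *.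
  set I1 := \int[Q]_z _ in intB *; set I2 := \int[Q]_z _ in intB *.
  have -> : n%:R^-1 * (S1 - n%:R * I1) = n%:R^-1 * (S2 - n%:R * I2)
      + (n%:R^-1 * (S1 - S2) - (I1 - I2)) by field; rewrite gt_eqF.
  apply: le_trans (ler_normD _ _) _; rewrite lerD2l.
  apply: le_trans (ler_normB _ _) _.
  have -> : e = n%:R^-1 * (n%:R * (e / 2)) + e / 2 by field; rewrite gt_eqF.
  apply: lerD => //; rewrite normrM gtr0_norm ?invr_gt0// ler_pM2l ?invr_gt0//.
have mBA : measurable (B `\` A) by apply: P_complete; exists N.
rewrite (_ : A = B `\` (B `\` A)); first exact: measurableD.
by rewrite setDD; apply/seteqP; split=> w; [move=> h; split=> //; exact: AB|case].
Qed.

End Sampling.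

(** * Concentration on one shell *)

Section CenteredSum.
Context {R : realType} d (T : measurableType d) (Q : probability T R) (n : nat) (x : 'I_n -> T).

Definition centered_sum (f : T -> R) : R := \sum_(j < n) f (x j) - n%:R * \int[Q]_z f z.

Lemma centered_sum_dist (f g : T -> R) (k : T -> R) (S I : R) :
  Q.-integrable setT (EFin \o f) -> Q.-integrable setT (EFin \o g) ->
  Q.-integrable setT (EFin \o k) -> (forall z, `|f z - g z| <= k z) ->
  \sum_(j < n) k (x j) <= S -> \int[Q]_z k z <= I ->
  `|centered_sum f - centered_sum g| <= S + n%:R * I.
Proof.
move=> fi gi ki fgk kS kI; rewrite /centered_sum.
have di : Q.-integrable setT (EFin \o (fun z => f z - g z)) by exact: integrableB fi gi.
have -> : \sum_(j < n) f (x j) - n%:R * \int[Q]_z f z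
    - (\sum_(j < n) g (x j) - n%:R * \int[Q]_z g z)
  = \sum_(j < n) (f (x j) - g (x j)) - n%:R * (\int[Q]_z (f z - g z)).
  by rewrite RintegralB// sumrB; ring.
apply: le_trans (ler_normB _ _) _; apply: lerD.
  apply: le_trans (ler_norm_sum _ _ _) _; apply: le_trans kS.
  by apply: ler_sum => j _; exact: fgk.
rewrite normrM ger0_norm// ler_wpM2l//; apply: le_trans kI.
apply: le_trans (le_normr_Rintegral measurableT di) _.
by apply: le_Rintegral => //; exact: integrable_abse di.
Qed.

End CenteredSum.

Section Shell.
Context {R : realType} disp (Omega : measurableType disp) (P : probability Omega R) (m d : nat).
Local Notation T := (borel_rV R d).
Context (Z : nat -> {RV P >-> T}) (Q : probability T R) (Ziid : iid_with_law Z Q).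
Context (Theta : set 'rV[R]_m) (G : 'rV[R]_m -> T -> R) (H : 'rV[R]_m -> R -> T -> R).
Context (theta_star : 'rV[R]_m) (Ts : Theta theta_star).
Context (G_integrable : forall theta, Theta theta -> Q.-integrable setT (EFin \o G theta)).
Context (xiG : T -> R) (xiG_L2 : xiG \in Lfun Q 2%:E)
  (xiG_bound : forall theta z, Theta theta -> `|G theta z| <= xiG z).
Context (H_measurable : forall theta t, Theta theta -> measurable_fun setT (H theta t)).
Context (H_integrable : forall theta, Theta theta ->
     Q.-integrable setT (EFin \o H theta (psi_bar Z G theta))).
Context (L1 L2 : T -> R) (L1_ge0 : forall z, 0 <= L1 z) (L2_ge0 : forall z, 0 <= L2 z).
Context (L1_L2 : L1 \in Lfun Q 2%:E) (L2_L2 : L2 \in Lfun Q 2%:E).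
Context (H_lipschitz : forall theta vartheta t s z, Theta theta -> Theta vartheta ->
     `|H theta t z - H vartheta s z| ^+ 2
     <= L1 z ^+ 2 * `|G theta z - G vartheta z| ^+ 2 + L2 z ^+ 2 * `|t - s| ^+ 2).

Lemma H_lipschitz_theta theta vartheta t z : Theta theta -> Theta vartheta ->
  `|H theta t z - H vartheta t z| <= L1 z * `|G theta z - G vartheta z|.
Proof.
move=> Tt Tv; have := H_lipschitz t t z Tt Tv.
rewrite subrr normr0 expr0n/= mulr0 addr0 -exprMn ler_sqr ?nnegrE//.
by rewrite mulr_ge0.
Qed.

Lemma H_lipschitz_t theta t s z : Theta theta ->
  `|H theta t z - H theta s z| <= L2 z * `|t - s|.
Proof.
move=> Tt; have := H_lipschitz t s z Tt Tt.
rewrite subrr normr0 expr0n/= mulr0 add0r -exprMn ler_sqr ?nnegrE//.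
by rewrite mulr_ge0.
Qed.

(** Integrability is given at the inner mean only; the Lipschitz bound in the second argument moves
    it to every [t]. *)
Lemma H_integrable_t theta t : Theta theta -> Q.-integrable setT (EFin \o H theta t).
Proof.
move=> Tt; have i0 := H_integrable Tt.
set p := psi_bar Z G theta in i0.
have ki : Q.-integrable setT (EFin \o (fun z => L2 z * `|t - p| + `|H theta p z|)).
  apply: (eq_integrable measurableT ((fun z => (`|t - p|)%:E * (L2 z)%:E) \+ (abse \o (EFin \o H theta p)))%E).
    by move=> z _ /=; rewrite EFinD EFinM muleC.
  apply: integrableD => //; last exact: integrable_abse.
  by apply: integrableZl => //; exact: Lfun2_integrable.
apply: le_integrable ki => //; first by apply/measurable_EFinP; exact: H_measurable.
move=> z _ /=; rewrite lee_fin; apply: le_trans (ler_norm _).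
have h1 := H_lipschitz_t t p z Tt.
by apply: le_trans (lerD h1 (lexx _)); apply: le_trans (ler_normD _ _); rewrite subrK.
Qed.

Lemma dH_integrable theta t vartheta s : Theta theta -> Theta vartheta ->
  Q.-integrable setT (EFin \o (fun z => H theta t z - H vartheta s z)).
Proof. by move=> Tt Tv; exact: integrableB (H_integrable_t t Tt) (H_integrable_t s Tv). Qed.

Context (n : nat) (n_gt0 : (0 < n)%N).
Context (delta beta b alpha Mlo Mup : R) (xi : T -> R).
Context (delta_gt0 : 0 < delta) (b_gt0 : 0 < b) (alpha_ge0 : 0 <= alpha).
Context (Mlo_gt0 : 0 < Mlo) (Mup_gt0 : 0 < Mup).
Context (xi_L2 : xi \in Lfun Q 2%:E).
Context (xi_env : positive_envelope (F_Theta_delta Theta G theta_star delta) xi).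
Context (xi_norm : ('N[Q]_2%:E[EFin \o (fun z => (Num.max (L1 z) 1 * xi z)%R)]
      <= (Mlo * delta `^ beta)%:E)%E).
Context (entropy_bound : (entropy_integral (F_Theta_delta Theta G theta_star delta)
           xi (1 / 8)%R <= Mup%:E)%E).

Local Notation A := (delta `^ beta).
Local Notation nL2 := (fine ('N[Q]_2%:E[EFin \o L2])%E).
Local Notation rho := ((b + Mlo) * A).
Local Notation U := (eball_in Theta theta_star delta).
Local Notation Xi := (xi_bdelta L1 L2 xi Mlo beta b delta).
Local Notation X := (Mbar_b Mlo nL2 b * A).
Local Notation ps := (psi_bar Z G theta_star).

Context (alpha_rho : alpha <= rho).

Let A_gt0 : 0 < A. Proof. by rewrite powR_gt0. Qed.
Let rho_gt0 : 0 < rho. Proof. by rewrite mulr_gt0// addr_gt0. Qed.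
Let xi_ge0 z : 0 <= xi z. Proof. by case: xi_env => _ h _; exact: ltW. Qed.
Let mL1 : measurable_fun setT L1 := ((Lfun2P _ _).1 L1_L2).1.
Let mL2 : measurable_fun setT L2 := ((Lfun2P _ _).1 L2_L2).1.
Let mxi : measurable_fun setT xi := ((Lfun2P _ _).1 xi_L2).1.
Let max_ge1 z : 1 <= Num.max (L1 z) 1. Proof. by rewrite le_max lexx orbT. Qed.

Let mmax : measurable_fun setT (fun z => Num.max (L1 z) 1).
Proof. exact: measurable_maxr. Qed.

Let Lxi2 : (fun z => Num.max (L1 z) 1 * xi z) \in Lfun Q 2%:E.
Proof.
apply/Lfun2P; split; first exact: measurable_funM.
by apply: le_lt_trans xi_norm _; rewrite ltry.
Qed.

Let int_Lxi : \int[Q]_z (Num.max (L1 z) 1 * xi z) ^+ 2 <= (Mlo * A) ^+ 2.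
Proof.
move: xi_norm; rewrite Lnorm2_sqrt// lee_fin => h.
rewrite -[leLHS]sqr_sqrtr ?integral_sq_ge0// ler_sqr ?nnegrE ?sqrtr_ge0//.
by rewrite mulr_ge0 ?ltW.
Qed.

Let nL2E : nL2 = Num.sqrt (\int[Q]_z L2 z ^+ 2).
Proof. by rewrite Lnorm2_sqrt. Qed.

Let nL2_ge0 : 0 <= nL2. Proof. by rewrite nL2E sqrtr_ge0. Qed.

Let Mb_gt0 : 0 < Mbar_b Mlo nL2 b.
Proof.
rewrite /Mbar_b; apply: ltr_pwDl; last by apply: mulr_ge0 => //; exact: ltW.
by apply: mulr_gt0 => //; apply: ltr_pwDl.
Qed.

Let X_gt0 : 0 < X. Proof. exact: mulr_gt0. Qed.

Lemma Xi_sqr z : Xi z ^+ 2 = (Num.max (L1 z) 1) ^+ 2 * xi z ^+ 2 + L2 z ^+ 2 * rho ^+ 2.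
Proof.
rewrite /xi_bdelta sqr_sqrtr.
  have -> : delta `^ (2 * beta) = A ^+ 2 by rewrite (mulrC 2) powRrM powR_mulrn ?powR_ge0.
  by ring.
apply: addr_ge0; first by apply: mulr_ge0; exact: sqr_ge0.
by apply: mulr_ge0; [apply: mulr_ge0; exact: sqr_ge0|exact: powR_ge0].
Qed.

Lemma Xi_ge0 z : 0 <= Xi z. Proof. exact: sqrtr_ge0. Qed.

Lemma Xi_Lfun2 : Xi \in Lfun Q 2%:E.
Proof.
have S2 : (fun z => Num.max (L1 z) 1 * xi z + L2 z * rho) \in Lfun Q 2%:E.
  have L2r : (rho \o* L2) \in Lfun Q 2%:E by apply: Lfun_scale => //; rewrite ler1n.
  rewrite (_ : (fun z => _) = (fun z => Num.max (L1 z) 1 * xi z) \+ (rho \o* L2)).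
    by rewrite rpredD ?lee1n.
  by apply/funext => z /=; rewrite mulrC.
apply: Lfun2_le S2.
  rewrite (_ : Xi = (fun r => r `^ 2^-1) \o (fun z => Num.max (L1 z) 1 ^+ 2 * xi z ^+ 2
      + L2 z ^+ 2 * (b + Mlo) ^+ 2 * delta `^ (2 * beta))).
    apply: (measurableT_comp (measurable_powR 2^-1)); apply: measurable_funD.
      by apply: measurable_funM; exact: measurable_funX.
    apply: measurable_funM => //; apply: measurable_funM => //; exact: measurable_funX.
  apply/funext => z; rewrite /= powR12_sqrt//; apply: addr_ge0; first by apply: mulr_ge0; exact: sqr_ge0.
  by apply: mulr_ge0; [apply: mulr_ge0; exact: sqr_ge0|exact: powR_ge0].
move=> z; have mx0 : 0 <= Num.max (L1 z) 1 by exact: le_trans (max_ge1 _).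
have p1 : 0 <= Num.max (L1 z) 1 * xi z by exact: mulr_ge0.
have p2 : 0 <= L2 z * rho by apply: mulr_ge0 => //; exact: ltW.
rewrite ger0_norm ?Xi_ge0// -ler_sqr ?nnegrE ?Xi_ge0//; last exact: addr_ge0.
rewrite Xi_sqr -!exprMn sqrrD lerD2r lerDl mulrn_wge0//; exact: mulr_ge0.
Qed.

(** [X] equals Mlo A + rho |L2|, a sum of bounds for the L2 norms of the two parts of the envelope;
    their squares add up to at most the square of the sum. *)
Lemma int_Xi_le : \int[Q]_z Xi z ^+ 2 <= X ^+ 2.
Proof.
have i1 := Lfun2_integrable_sqr Lxi2; have i2 := Lfun2_integrable_sqr L2_L2.
have -> : \int[Q]_z Xi z ^+ 2 =
    \int[Q]_z (Num.max (L1 z) 1 * xi z) ^+ 2 + rho ^+ 2 * \int[Q]_z L2 z ^+ 2.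
  rewrite -RintegralZl// -RintegralD//; last exact: (integrableZl measurableT (rho ^+ 2) i2).
  by apply: eq_Rintegral => z _; rewrite Xi_sqr; ring.
have -> : \int[Q]_z L2 z ^+ 2 = nL2 ^+ 2 by rewrite nL2E sqr_sqrtr// integral_sq_ge0.
have -> : X = Mlo * A + rho * nL2 by rewrite /Mbar_b; ring.
apply: le_trans (lerD int_Lxi (lexx _)) _.
rewrite -exprMn sqrrD lerD2r lerDl mulrn_wge0//; apply: mulr_ge0; apply: mulr_ge0 => //; exact: ltW.
Qed.

(** The weight max(L1, 1) is at least 1, so the weighted envelope dominates the increment of [G],
    and its mean is at most its L2 norm. *)
Lemma psi_bar_dist theta : U theta -> `|psi_bar Z G theta - ps| <= Mlo * A.
Proof.
move=> Uth; have Tt := Uth.1.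
have i1 := G_integrable Tt; have i2 := G_integrable Ts.
rewrite /psi_bar !(expectE Ziid)// -RintegralB//.
have di : Q.-integrable setT (EFin \o (fun z => G theta z - G theta_star z)) by exact: integrableB i1 i2.
apply: le_trans (le_normr_Rintegral measurableT di) _.
apply: le_trans (_ : _ <= \int[Q]_z (Num.max (L1 z) 1 * xi z)) _.
  apply: le_Rintegral => //; [exact: integrable_abse di|exact: Lfun2_integrable|].
  move=> z _; case: xi_env => _ _ h; apply: le_trans (h (G theta \- G theta_star) z _) _.
    by exists theta.
  by rewrite ler_peMl.
rewrite -ler_sqr ?nnegrE; last 2 first.
- by apply: Rintegral_ge0 => z _; apply: mulr_ge0 => //; exact: le_trans (max_ge1 _).
- by apply: mulr_ge0; exact: ltW.
exact: le_trans (sq_integral_le Lxi2) int_Lxi.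
Qed.

(** [y] places the empirical inner mean at [theta_star], [u] its increment from [theta_star] to
    [theta]. Both terms share the [y] shift, so only the increment, of size at most [rho], enters
    the envelope. *)
Definition dH theta y u z : R :=
  H theta (ps + y * alpha + u * rho) z - H theta_star (ps + y * alpha) z.

Let L1_sq_le z : L1 z ^+ 2 <= Num.max (L1 z) 1 ^+ 2.
Proof. by rewrite ler_sqr ?nnegrE ?(le_trans ler01 (max_ge1 z))// le_max lexx. Qed.

Let dH_env theta y u z : U theta -> -1 <= y <= 1 -> -1 <= u <= 1 ->
  dH theta y u z ^+ 2 <= Xi z ^+ 2.
Proof.
move=> Uth _ uu; have Tt := Uth.1.
have := H_lipschitz (ps + y * alpha + u * rho) (ps + y * alpha) z Tt Ts.
rewrite real_normK ?num_real// => h; apply: le_trans h _; rewrite Xi_sqr.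
apply: lerD.
  apply: ler_pM; rewrite ?sqr_ge0//.
  rewrite ler_sqr ?nnegrE//; case: xi_env => _ _ h; apply: (h (G theta \- G theta_star)).
  by exists theta.
rewrite ler_wpM2l ?sqr_ge0// ler_sqr ?nnegrE ?(ltW rho_gt0)// addrAC subrr add0r.
rewrite normrM (gtr0_norm rho_gt0) ler_piMl ?(ltW rho_gt0)//.
by rewrite ler_norml.
Qed.

(** As [alpha] is at most [rho], a change of [y] costs no more than one of [u]. The second arguments
    then move by at most 2 rho eta at [theta] and rho eta at [theta_star], and 10 = 2 * (2^2 +
    1^2). *)
Let dH_lip theta theta' y y' u u' eta z : U theta -> U theta' ->
  -1 <= y <= 1 -> -1 <= y' <= 1 -> -1 <= u <= 1 -> -1 <= u' <= 1 ->
  `|y - y'| <= eta -> `|u - u'| <= eta ->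
  (dH theta y u z - dH theta' y' u' z) ^+ 2 <=
  2 * (Num.max (L1 z) 1 ^+ 2 * ((G theta \- G theta_star) z - (G theta' \- G theta_star) z) ^+ 2)
  + 10 * eta ^+ 2 * (L2 z ^+ 2 * rho ^+ 2).
Proof.
move=> Uth Uth' _ _ _ _ yy uu.
have eta0 : 0 <= eta by apply: le_trans yy.
set t := ps + y * alpha + u * rho; set t' := ps + y' * alpha + u' * rho.
set s := ps + y * alpha; set s' := ps + y' * alpha.
have r0 := ltW rho_gt0.
have ss : `|s - s'| <= rho * eta.
  have -> : s - s' = alpha * (y - y') by rewrite /s /s'; ring.
  by rewrite normrM ger0_norm//; apply: ler_pM.
have tt : `|t - t'| <= 2 * (rho * eta).
  have -> : t - t' = (s - s') + rho * (u - u') by rewrite /t /t' /s /s'; ring.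
  apply: le_trans (ler_normD _ _) _; rewrite normrM (ger0_norm r0).
  have : rho * `|u - u'| <= rho * eta by rewrite ler_wpM2l.
  lra.
have -> : dH theta y u z - dH theta' y' u' z =
    (H theta t z - H theta' t' z) - (H theta_star s z - H theta_star s' z).
  by rewrite /dH; ring.
apply: le_trans (sqrB_le _ _) _.
have h1 := H_lipschitz t t' z Uth.1 Uth'.1.
have h2 := H_lipschitz s s' z Ts Ts.
rewrite real_normK ?num_real// in h1; rewrite real_normK ?num_real// subrr normr0 expr0n/= mulr0 add0r in h2.
rewrite real_normK ?num_real// in h1.
have re0 : 0 <= rho * eta by exact: mulr_ge0.
have e1 : L2 z ^+ 2 * `|t - t'| ^+ 2 <= L2 z ^+ 2 * (2 * (rho * eta)) ^+ 2.
  by rewrite ler_wpM2l ?sqr_ge0// ler_sqr ?nnegrE// mulr_ge0.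
have e2 : L2 z ^+ 2 * `|s - s'| ^+ 2 <= L2 z ^+ 2 * (rho * eta) ^+ 2.
  by rewrite ler_wpM2l ?sqr_ge0// ler_sqr ?nnegrE.
have e3 : L1 z ^+ 2 * (G theta z - G theta' z) ^+ 2 <=
    Num.max (L1 z) 1 ^+ 2 * ((G theta \- G theta_star) z - (G theta' \- G theta_star) z) ^+ 2.
  have -> : (G theta \- G theta_star) z - (G theta' \- G theta_star) z = G theta z - G theta' z.
    by rewrite /=; ring.
  rewrite ler_wpM2r ?sqr_ge0//; exact: L1_sq_le.
have -> : 10 * eta ^+ 2 * (L2 z ^+ 2 * rho ^+ 2) =
  2 * (L2 z ^+ 2 * (2 * (rho * eta)) ^+ 2 + L2 z ^+ 2 * (rho * eta) ^+ 2) by ring.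
lra.
Qed.

Context (G_separable : forall delta : R, 0 < delta ->
     exists (C : set 'rV[R]_m) (N : forall n, set (n.-tuple (borel_rV R d))),
       [/\ countable C,
           C `<=` eball_in Theta theta_star delta,
           (forall n, (0 < n)%N ->
              (power_probability Q n).-negligible (N n)) &
           forall theta n (z : n.-tuple (borel_rV R d)),
             eball_in Theta theta_star delta theta -> (0 < n)%N -> ~ N n z ->
             ereal_inf
               [set (expect Z (fun x => `|G theta x - G vartheta x|)
                     + \big[Num.max/0]_(j < n)
                         `|G theta (tnth z j) - G vartheta (tnth z j)|)%:E
               | vartheta in C] = 0%E]).

(** Clipping makes every rational an admissible parameter, so the enumeration needs no side
    condition. *)
Definition clip (y : R) : R := Num.max (-1) (Num.min 1 y).

Lemma clip_itv y : -1 <= clip y <= 1.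
Proof. by rewrite /clip le_max lexx/= ge_max ge_min lexx/= andbT; lra. Qed.

Lemma clip_near y y' : -1 <= y <= 1 -> `|y - clip y'| <= `|y - y'|.
Proof.
move=> /andP[y1 y2]; have n1 := ler_norm (y - y'); have n2 := ler_norm (y' - y).
rewrite distrC in n2; rewrite /clip.
have [h1|h1] := leP 1 y'.
  by rewrite max_r; [rewrite ler_norml; lra|lra].
have [h2|h2] := leP (-1) y'; first by [].
by rewrite ler_norml; lra.
Qed.

Lemma rat_near (y eta : R) : 0 < eta -> -1 <= y <= 1 ->
  exists q : rat, `|y - clip (ratr q)| < eta.
Proof.
move=> e0 yy; have : y - eta < y + eta by lra.
move=> /rat_in_itvoo[q]; rewrite in_itv/= => hq; exists q.
by apply: le_lt_trans (clip_near _ yy) _; rewrite ltr_norml; lra.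
Qed.

(** Numbers that code no triple are sent to an admissible one, because the deviation bound requires
    admissibility at every index. *)
Definition grid_index (f : nat -> 'rV[R]_m) (k : nat) : 'rV[R]_m * R * R :=
  if (unpickle k : option (nat * rat * rat)) is Some (j, q1, q2)
  then (f j, clip (ratr q1), clip (ratr q2)) else (f 0%N, 0, 0).

(* The supremum over theta, y and u is attained along a countable subfamily, up to an arbitrarily small error. *)
Lemma dH_approximation (f : nat -> 'rV[R]_m) w c :
  (forall k, U (f k)) ->
  (forall theta (e : R), U theta -> 0 < e ->
     exists k, expect Z (fun x => `|G theta x - G (f k) x|) < e /\
          forall j : 'I_n, `|G theta (Z j w) - G (f k) (Z j w)| < e) ->
  forall theta y u, U theta -> -1 <= y <= 1 -> -1 <= u <= 1 ->
    c < `|centered_sum Q (fun j : 'I_n => Z j w) (dH theta y u)| ->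
  exists k, let: (theta', y', u') := grid_index f k in
    c < `|centered_sum Q (fun j : 'I_n => Z j w) (dH theta' y' u')|.
Proof.
move=> fU sep theta y u Uth yy uu hc.
set F := centered_sum _ _ in hc *.
pose e := `|F (dH theta y u)| - c.
have e0 : 0 < e by rewrite /e subr_gt0.
have Tt := Uth.1.
pose S2 := \sum_(j < n) L2 (Z j w); pose I2 := \int[Q]_z L2 z.
have S20 : 0 <= S2 by apply: sumr_ge0.
have I20 : 0 <= I2 by apply: Rintegral_ge0.
have n0 : 0 < n%:R :> R by rewrite ltr0n.
(* For the fixed sample, K - 1 is a Lipschitz constant of the centered sum in [(y, u)]; the added 1
   makes [K] positive and the estimate strict. *)
pose K := (S2 + n%:R * I2) * (3 * rho) + 1.
have K0 : 0 < K.
  rewrite /K ltr_wpDl//; apply: mulr_ge0; last by rewrite mulr_ge0// ltW.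
  by rewrite addr_ge0// mulr_ge0.
have eta0 : 0 < e / (2 * K) by rewrite divr_gt0// mulr_gt0.
have [q1 h1] := rat_near eta0 yy; have [q2 h2] := rat_near eta0 uu.
set y' := clip (ratr q1) in h1; set u' := clip (ratr q2) in h2.
set eta := e / (2 * K) in eta0 h1 h2.
have il2 := Lfun2_integrable L2_L2; have il1 := Lfun2_integrable L1_L2.
have step1 : `|F (dH theta y u) - F (dH theta y' u')| < e / 2.
  have ki : Q.-integrable setT (EFin \o (fun z => (3 * rho * eta) * L2 z)).
    exact: (integrableZl measurableT (3 * rho * eta) il2).
  have hk z : `|dH theta y u z - dH theta y' u' z| <= (3 * rho * eta) * L2 z.
    have -> : dH theta y u z - dH theta y' u' z =
        (H theta (ps + y * alpha + u * rho) z - H theta (ps + y' * alpha + u' * rho) z)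
        - (H theta_star (ps + y * alpha) z - H theta_star (ps + y' * alpha) z).
      by rewrite /dH; ring.
    apply: le_trans (ler_normB _ _) _.
    have g1 := H_lipschitz_t (ps + y * alpha + u * rho) (ps + y' * alpha + u' * rho) z Tt.
    have g2 := H_lipschitz_t (ps + y * alpha) (ps + y' * alpha) z Ts.
    have r0 := ltW rho_gt0.
    have ss : `|ps + y * alpha - (ps + y' * alpha)| <= rho * eta.
      have -> : ps + y * alpha - (ps + y' * alpha) = alpha * (y - y') by ring.
      by rewrite normrM ger0_norm//; apply: ler_pM => //; exact: ltW.
    have tt : `|ps + y * alpha + u * rho - (ps + y' * alpha + u' * rho)| <= 2 * (rho * eta).
      have -> : ps + y * alpha + u * rho - (ps + y' * alpha + u' * rho) =
        (ps + y * alpha - (ps + y' * alpha)) + rho * (u - u') by ring.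
      apply: le_trans (ler_normD _ _) _; rewrite [X in _ + X]normrM (ger0_norm r0).
      have : rho * `|u - u'| <= rho * eta by rewrite ler_wpM2l// ltW.
      lra.
    have g3 := ler_wpM2l (L2_ge0 z) ss; have g4 := ler_wpM2l (L2_ge0 z) tt.
    lra.
  have hS : \sum_(j < n) (3 * rho * eta) * L2 (Z j w) <= 3 * rho * eta * S2 by rewrite -mulr_sumr.
  have hI : \int[Q]_z ((3 * rho * eta) * L2 z) <= 3 * rho * eta * I2 by rewrite RintegralZl.
  apply: le_lt_trans (centered_sum_dist (dH_integrable _ _ Tt Ts) (dH_integrable _ _ Tt Ts) ki hk hS hI) _.
  have -> : 3 * rho * eta * S2 + n%:R * (3 * rho * eta * I2) = eta * (K - 1) by rewrite /K; ring.
  have -> : e / 2 = eta * K by rewrite /eta; field; rewrite gt_eqF.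
  by rewrite ltr_pM2l//; lra.
pose S1 := \sum_(j < n) L1 (Z j w).
have S10 : 0 <= S1 by apply: sumr_ge0.
have mxiG : measurable_fun setT xiG := ((Lfun2P _ _).1 xiG_L2).1.
have xiG0 z : 0 <= 2 * xiG z by rewrite mulr_ge0// (le_trans _ (xiG_bound z Ts)).
have iLxi : Q.-integrable setT (fun z => (L1 z * (2 * xiG z))%:E).
  have : Q.-integrable setT (EFin \o (L1 \* xiG)) by apply/Lfun1_integrable; exact: Lfun2_mul_Lfun1.
  move=> /(integrableZl measurableT 2); apply: eq_integrable => // z _.
  by rewrite /= -EFinM; congr EFin; ring.
have e4 : 0 < e / (8 * n%:R) by rewrite divr_gt0// mulr_gt0.
(* [eta'] controls the integral part of the change in theta; the minimum taken below also controls
   the sample part, through the finite sum [S1]. *)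
have [eta' eta'0 small] := integral_mul_small mL1
  (measurable_funM (measurable_cst (2 : R)) mxiG) L1_ge0 xiG0 iLxi e4.
have e5 : 0 < Num.min eta' (e / (8 * (S1 + 1))).
  by rewrite lt_min eta'0 divr_gt0//; lra.
have [k [hk1 hk2]] := sep theta _ Uth e5.
have Tk := (fU k).1.
have dGi : Q.-integrable setT (EFin \o (fun z => G theta z - G (f k) z)).
  exact: integrableB (G_integrable Tt) (G_integrable Tk).
have step2 : `|F (dH theta y' u') - F (dH (f k) y' u')| < e / 2.
  have mdG : measurable_fun setT (fun z => G theta z - G (f k) z).
    by apply/measurable_EFinP; exact: measurable_int dGi.
  have gxi z : `|G theta z - G (f k) z| <= 2 * xiG z.
    apply: le_trans (ler_normB _ _) _.
    by have := xiG_bound z Tt; have := xiG_bound z Tk; lra.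
  have intG : (\int[Q]_z `|G theta z - G (f k) z|%:E <= eta'%:E)%E.
    have adGi : Q.-integrable setT (EFin \o (fun z => `|G theta z - G (f k) z|)) by exact: integrable_abse dGi.
    rewrite -(fineK (integrable_fin_num measurableT adGi)) lee_fin.
    by move: hk1; rewrite (expectE Ziid)// lt_min => /andP[+ _]; exact: ltW.
  have intL := small _ mdG gxi intG.
  have kL : Q.-integrable setT (EFin \o (fun z => L1 z * `|G theta z - G (f k) z|)).
    apply: le_integrable iLxi => //.
      apply/measurable_EFinP; apply: measurable_funM => //.
      exact: (measurableT_comp (@normr_measurable R setT)).
    move=> z _ /=; rewrite lee_fin normrM normr_id (ger0_norm (L1_ge0 z)).
    by apply: le_trans (ler_norm _); apply: ler_wpM2l.
  have hk z : `|dH theta y' u' z - dH (f k) y' u' z| <= L1 z * `|G theta z - G (f k) z|.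
    rewrite /dH opprB addrA subrK; exact: H_lipschitz_theta.
  have hS : \sum_(j < n) L1 (Z j w) * `|G theta (Z j w) - G (f k) (Z j w)| <= e / 8.
    apply: (@le_trans _ _ (\sum_(j < n) L1 (Z j w) * (e / (8 * (S1 + 1))))).
      apply: ler_sum => j _; rewrite ler_wpM2l//.
      by have := hk2 j; rewrite lt_min => /andP[_ /ltW].
    rewrite -mulr_suml -/S1.
    have -> : S1 * (e / (8 * (S1 + 1))) = e / 8 * (S1 / (S1 + 1)) by field; rewrite gt_eqF//; lra.
    by rewrite ler_piMr ?divr_ge0 ?(ltW e0)// ler_pdivrMr; lra.
  have hI : \int[Q]_z (L1 z * `|G theta z - G (f k) z|) <= e / (8 * n%:R).
    by rewrite -lee_fin /Rintegral fineK// (integrable_fin_num measurableT kL).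
  apply: le_lt_trans (centered_sum_dist (dH_integrable _ _ Tt Ts) (dH_integrable _ _ Tk Ts) kL hk hS hI) _.
  have -> : n%:R * (e / (8 * n%:R)) = e / 8 by field; rewrite gt_eqF.
  lra.
exists (pickle (k, q1, q2)); rewrite /grid_index pickleK -/y' -/u'.
have := lerB_dist (F (dH theta y u)) (F (dH theta y' u')).
have := lerB_dist (F (dH theta y' u')) (F (dH (f k) y' u')).
by move: step1 step2; rewrite /e; lra.
Qed.

(** The deviation event over all [(theta, y, u)] is not claimed to be measurable. [D] is a
    measurable set that contains its part inside [event_B]: the deviation event of the countable
    subfamily together with the null set of the approximation. *)
Lemma shell_bound (s : R) : 256 * (Mup + 7 / 10) + 7 / 5 <= s ->
  exists D : set Omega, [/\ measurable D,
    (P D <= (4 * expR (- (s / 32) ^+ 2))%:E)%E &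
    forall w theta y u, event_B Z n Xi w -> U theta -> -1 <= y <= 1 -> -1 <= u <= 1 ->
      s * Num.sqrt n%:R * X < `|centered_sum Q (fun j : 'I_n => Z j w) (dH theta y u)| -> D w].
Proof.
move=> sM.
have [f [N [fU mN N0 sep]]] := sample_separable Ziid G_separable Ts delta_gt0 n_gt0.
pose q := grid_index f.
have qok k : [/\ U (q k).1.1, -1 <= (q k).1.2 <= 1 & -1 <= (q k).2 <= 1].
  rewrite /q /grid_index; case: unpickle => [[[j q1] q2]|] /=.
    by split; [exact: fU|exact: clip_itv|exact: clip_itv].
  by split; [exact: fU|lra|lra].
pose D1 := [set w | (\sum_(j < n) Xi (Z j w) ^+ 2 <= 2 * n%:R * X ^+ 2)%R /\
      exists k, (s * Num.sqrt n%:R * X < `|\sum_(j < n) dH (q k).1.1 (q k).1.2 (q k).2 (Z j w)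
        - n%:R * \int[Q]_z dH (q k).1.1 (q k).1.2 (q k).2 z|)%R].
have n0 : 0 < n%:R :> R by rewrite ltr0n.
have mdH theta y u : U theta -> measurable_fun setT (dH theta y u).
  by move=> Uth; apply: measurable_funB; apply: H_measurable => //; exact: Uth.1.
have mXi : measurable_fun setT Xi := ((Lfun2P _ _).1 Xi_Lfun2).1.
have mcomp (g : T -> R) : measurable_fun setT g ->
    measurable_fun setT (fun w => \sum_(j < n) g (Z j w)).
  by move=> mg; apply: measurable_sum => j; exact: (measurableT_comp mg (measurable_funPT (Z j))).
have mD1 : measurable D1.
  rewrite (_ : D1 = [set w | \sum_(j < n) Xi (Z j w) ^+ 2 <= 2 * n%:R * X ^+ 2] `&`
     \bigcup_k [set w | s * Num.sqrt n%:R * X < `|\sum_(j < n) dH (q k).1.1 (q k).1.2 (q k).2 (Z j w)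
        - n%:R * \int[Q]_z dH (q k).1.1 (q k).1.2 (q k).2 z|]).
    apply: measurableI.
      by apply: measurable_set_le; apply: (mcomp (fun z => Xi z ^+ 2)); exact: measurable_funX.
    apply: bigcup_measurable => k _; apply: measurable_set_lt.
    apply: (measurableT_comp (@normr_measurable R setT)); apply: measurable_funB => //.
    by apply: mcomp; apply: mdH; have [] := qok k.
  by apply/seteqP; split=> w /= [h]; [move=> [k hk]; split=> //; exists k|move=> [k _ hk]; split=> //; exists k].
have U0 : U !=set0 by exists theta_star; exact: eball_center.
have EXi : (\int[Q]_x (Xi x ^+ 2)%:E <= (X ^+ 2)%:E)%E.
  by rewrite EFin_integral_sq ?Xi_Lfun2// lee_fin int_Xi_le.
have w_gt0 z : 0 < Num.max (L1 z) 1 ^+ 2 by rewrite exprn_gt0// (lt_le_trans ltr01).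
have l_ge0 z : 0 <= L2 z ^+ 2 * rho ^+ 2 by apply: mulr_ge0; exact: sqr_ge0.
have mg theta : U theta -> measurable_fun setT (G theta \- G theta_star).
  move=> Uth; apply: measurable_funB; apply/measurable_EFinP.
    exact: measurable_int (G_integrable Uth.1).
  exact: measurable_int (G_integrable Ts).
have PD1 : (P D1 <= (4 * expR (- (s / 32) ^+ 2))%:E)%E.
  apply: (class_deviation Ziid n_gt0 U0 w_gt0 l_ge0 mg mxi entropy_bound Xi_sqr dH_env dH_lip
    X_gt0 Xi_ge0 Xi_Lfun2 EXi mdH qok (ltW Mup_gt0) sM).
exists (D1 `|` N); split; first exact: measurableU.
  apply: le_trans (measureU2 _ mD1 mN) _.
  have PN : (P N <= 0)%E by rewrite N0.
  by apply: le_trans (leeD PD1 PN) _; rewrite adde0.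
move=> w theta y u Bw Uth yy uu hlt.
have [Nw|Nw] := pselect (N w); [by right|left].
split.
  (* [event_B] is stated with the second moment of the envelope, which [X ^+ 2] dominates. *)
  have := Bw; rewrite /event_B /= (expectE Ziid); last exact: Lfun2_integrable_sqr Xi_Lfun2.
  have := int_Xi_le; set E := \int[Q]_z _; set S := \sum_(j < n) _ => EX h.
  have : n%:R * (n%:R^-1 * S) <= n%:R * (2 * E) by rewrite ler_pM2l.
  rewrite mulrA divff ?gt_eqF// mul1r => h'; apply: le_trans h' _.
  have -> : 2 * n%:R * X ^+ 2 = n%:R * (2 * X ^+ 2) by ring.
  by rewrite ler_pM2l// ler_pM2l.
have [k hk] := dH_approximation fU (fun theta e => sep w theta e Nw) Uth yy uu hlt.
by exists k; move: hk; rewrite -/(q k); case: (q k) => [[a1 a2] a3].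
Qed.

End Shell.

(** * Localization of the minimizer *)

Section Deterministic.
Context {R : realType} disp (Omega : measurableType disp) (P : probability Omega R) (m d : nat).
Local Notation T := (borel_rV R d).
Context (Z : nat -> {RV P >-> T}) (Q : probability T R) (Ziid : iid_with_law Z Q).
Context (Theta : set 'rV[R]_m) (G : 'rV[R]_m -> T -> R) (H : 'rV[R]_m -> R -> T -> R).
Context (theta_star : 'rV[R]_m) (Ts : Theta theta_star).
Context (G_integrable : forall theta, Theta theta -> Q.-integrable setT (EFin \o G theta)).
Context (H_measurable : forall theta t, Theta theta -> measurable_fun setT (H theta t)).
Context (H_integrable : forall theta, Theta theta ->
     Q.-integrable setT (EFin \o H theta (psi_bar Z G theta))).
Context (L1 L2 : T -> R) (L2_ge0 : forall z, 0 <= L2 z) (L2_L2 : L2 \in Lfun Q 2%:E).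
Context (H_lipschitz : forall theta vartheta t s z, Theta theta -> Theta vartheta ->
     `|H theta t z - H vartheta s z| ^+ 2
     <= L1 z ^+ 2 * `|G theta z - G vartheta z| ^+ 2 + L2 z ^+ 2 * `|t - s| ^+ 2).
Context (M1 : R) (psi_H_growth : forall theta, Theta theta ->
     M1 * enorm (theta - theta_star) ^+ 2
     <= psi_H Z G H theta - psi_H Z G H theta_star).
Context (delta1 K_delta1 : R) (mTR : 'rV[R]_m -> R -> R).
Context (K_delta1_ge0 : 0 <= K_delta1).
Context (mTR_lipschitz : forall theta (x : R), Theta theta -> - delta1 <= x <= delta1 ->
     `|mTR theta (psi_bar Z G theta + x)
       - mTR theta_star (psi_bar Z G theta_star + x)|
     <= K_delta1 * enorm (row_mx (theta - theta_star)
          (const_mx (psi_bar Z G theta - psi_bar Z G theta_star) : 'rV[R]_1))).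
Context (mTR_integrable : forall theta s t, Theta theta -> s < t ->
     lebesgue_measure.-integrable `[s, t] (EFin \o mTR theta)).
Context (mTR_density : forall theta s t, Theta theta -> s < t ->
     expect Z (H theta t) - expect Z (H theta s)
     = \int[lebesgue_measure]_(u in `[s, t]) mTR theta u).

Local Notation ps := (psi_bar Z G).
Local Notation EH := (fun theta t => expect Z (H theta t)).
Local Notation EL2 := (expect Z L2).

Lemma enorm_row_mx_le (v : 'rV[R]_m) (c : R) :
  enorm (row_mx v (const_mx c : 'rV[R]_1)) <= enorm v + `|c|.
Proof.
rewrite -ler_sqr ?nnegrE ?enorm_ge0 ?addr_ge0 ?enorm_ge0//.
rewrite enorm_sqr big_split_ord/= big_ord1.
rewrite (eq_bigr (fun i => v 0 i ^+ 2)) => [|i _]; last by rewrite row_mxEl.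
rewrite row_mxEr mxE -enorm_sqr sqrrD real_normK ?num_real// lerD2r lerDl mulrn_wge0//.
by rewrite mulr_ge0 ?enorm_ge0.
Qed.

Lemma EH_lipschitz theta t s : Theta theta -> `|EH theta t - EH theta s| <= EL2 * `|t - s|.
Proof.
move=> Tt.
have it x : Q.-integrable setT (EFin \o H theta x).
  exact: (H_integrable_t H_measurable H_integrable L2_ge0 L2_L2 H_lipschitz).
rewrite !(expectE Ziid)//; last exact: Lfun2_integrable.
rewrite -RintegralB//.
have di : Q.-integrable setT (EFin \o (fun z => H theta t z - H theta s z)) by exact: integrableB (it t) (it s).
apply: le_trans (le_normr_Rintegral measurableT di) _.
have L2i := Lfun2_integrable L2_L2.
rewrite -RintegralZr//; apply: le_Rintegral => //; first exact: integrable_abse di.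
  apply: (eq_integrable measurableT (fun z => (L2 z)%:E * (`|t - s|)%:E)%E) => //.
  exact: integrableZr.
by move=> z _; exact: (H_lipschitz_t L2_ge0 H_lipschitz).
Qed.

(** Both increments are integrals of [mTR] over windows of length |x| that start or end at the inner
    means, so the bound on the density at equal offsets is integrated over |x|. *)
Lemma EH_shift theta x : Theta theta -> - delta1 <= x <= delta1 ->
  `|(EH theta (ps theta + x) - EH theta (ps theta))
    - (EH theta_star (ps theta_star + x) - EH theta_star (ps theta_star))|
  <= `|x| * (K_delta1 * (enorm (theta - theta_star) + `|ps theta - ps theta_star|)).
Proof.
move=> Tt xd; set C := K_delta1 * _.
have hC x' : - delta1 <= x' <= delta1 ->
    `|mTR theta (ps theta + x') - mTR theta_star (ps theta_star + x')| <= C.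
  move=> hx'; apply: le_trans (mTR_lipschitz Tt hx') _.
  by rewrite ler_wpM2l//; exact: enorm_row_mx_le.
have [x0|x0|->] := ltgtP x 0; last by rewrite !addr0 !subrr normr0 mul0r.
- have lt th : ps th + x < ps th by rewrite gtrDl.
  have lt1 := lt theta; have lt2 := lt theta_star.
  rewrite -(opprB (EH theta (ps theta))) -(opprB (EH theta_star (ps theta_star))).
  rewrite !mTR_density// -opprD normrN (ltr0_norm x0).
  have := @shift_difference R (mTR theta) (mTR theta_star) (ps theta) (ps theta_star) x 0 C.
  rewrite !addr0 sub0r; move=> h; apply: h => //; [exact: ltW|exact: mTR_integrable|exact: mTR_integrable|].
  by move=> x' hx'; apply: hC; lra.
have lt th : ps th < ps th + x by rewrite ltrDl.
rewrite !mTR_density// (gtr0_norm x0).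
have := @shift_difference R (mTR theta) (mTR theta_star) (ps theta) (ps theta_star) 0 x C.
rewrite !addr0 subr0; move=> h; apply: h => //; [exact: ltW|exact: mTR_integrable|exact: mTR_integrable|].
by move=> x' hx'; apply: hC; lra.
Qed.

(** The two offsets differ. The increments are compared at the common offset [x1] through the
    density, and [x1] is then replaced by [x2] at [theta_star], at the cost of the mean of [L2]. If
    that mean is 0, the expectations do not depend on their second argument and the bias
    vanishes. *)
Lemma bias_le theta x1 x2 (alpha c delta B : R) : Theta theta ->
  enorm (theta - theta_star) <= delta -> `|ps theta - ps theta_star| <= B ->
  `|x1| <= alpha -> `|x1 - x2| <= c -> (0 < EL2 -> alpha <= delta1) ->
  `|(EH theta (ps theta + x1) - EH theta (ps theta))
    - (EH theta_star (ps theta_star + x2) - EH theta_star (ps theta_star))|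
  <= (0 < EL2)%R%:R * (alpha * (K_delta1 * (delta + B)) + EL2 * c).
Proof.
move=> Tt hd hB hx1 hx12 ad.
have [EL0|EL0] := ltP 0 EL2.
  have a1 := ad EL0; have xd : - delta1 <= x1 <= delta1 by move: hx1; rewrite ler_norml; lra.
  rewrite mul1r.
  have h1 := EH_shift Tt xd.
  have h2 := EH_lipschitz (ps theta_star + x1) (ps theta_star + x2) Ts.
  have e : ps theta_star + x1 - (ps theta_star + x2) = x1 - x2 by ring.
  rewrite e in h2.
  have h3 : EL2 * `|x1 - x2| <= EL2 * c by rewrite ler_wpM2l// ltW.
  have h4 : `|x1| * (K_delta1 * (enorm (theta - theta_star) + `|ps theta - ps theta_star|))
     <= alpha * (K_delta1 * (delta + B)).
    apply: ler_pM => //; first by rewrite mulr_ge0// addr_ge0// enorm_ge0.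
    by rewrite ler_wpM2l//; exact: lerD.
  have -> : (EH theta (ps theta + x1) - EH theta (ps theta))
    - (EH theta_star (ps theta_star + x2) - EH theta_star (ps theta_star)) =
    ((EH theta (ps theta + x1) - EH theta (ps theta))
    - (EH theta_star (ps theta_star + x1) - EH theta_star (ps theta_star)))
    + (EH theta_star (ps theta_star + x1) - EH theta_star (ps theta_star + x2)) by ring.
  apply: le_trans (ler_normD _ _) _; lra.
have EL : EL2 = 0.
  by apply/eqP; rewrite eq_le EL0/=; apply: Rintegral_ge0.
have z th t s : Theta th -> EH th t = EH th s.
  move=> Tth; have := EH_lipschitz t s Tth; rewrite EL mul0r normr_le0 subr_eq0.
  by move/eqP.
by rewrite (z theta _ (ps theta))// (z theta_star _ (ps theta_star))// !subrr normr0 mul0r.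
Qed.

Context (n : nat) (n_gt0 : (0 < n)%N).
Context (alpha rho : R) (alpha_gt0 : 0 < alpha) (rho_gt0 : 0 < rho).

(** [y] and [u] are read off from the empirical inner means, and c + B <= rho keeps [u] in [-1, 1].
    The empirical sum is nonpositive because [theta] does at least as well as [theta_star], while
    its mean is at least the growth minus the bias; centering leaves a large negative value. *)
Lemma shell_deviation w theta (c delta B : R) : Theta theta ->
  enorm (theta - theta_star) <= delta -> `|ps theta - ps theta_star| <= B -> c + B <= rho ->
  `|empirical_deviation Z n (G theta) w| <= alpha ->
  `|empirical_deviation Z n (G theta_star) w| <= alpha ->
  `|empirical_deviation Z n (G theta \- G theta_star) w| <= c ->
  (0 < EL2 -> alpha <= delta1) ->
  empirical_objective Z G H n w theta <= empirical_objective Z G H n w theta_star ->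
  exists y u, [/\ -1 <= y <= 1, -1 <= u <= 1 &
    n%:R * (M1 * enorm (theta - theta_star) ^+ 2
      - (0 < EL2)%R%:R * (alpha * (K_delta1 * (delta + B)) + EL2 * c))
    <= `|centered_sum Q (fun j : 'I_n => Z j w)
         (fun z => H theta (ps theta_star + y * alpha + u * rho) z
                   - H theta_star (ps theta_star + y * alpha) z)|].
Proof.
move=> Tt hd hB cB da da' dc ad obj.
have n0 : 0 < n%:R :> R by rewrite ltr0n.
pose psn th := n%:R^-1 * \sum_(i < n) G th (Z i w).
have devE th : Theta th -> empirical_deviation Z n (G th) w = psn th - ps th.
  move=> Tth; rewrite (empirical_deviationE Ziid)//; last exact: G_integrable.
  by rewrite /psn /psi_bar (expectE Ziid) ?G_integrable// mulrBr mulrA mulVf ?gt_eqF// mul1r.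
have devBE : empirical_deviation Z n (G theta \- G theta_star) w =
    (psn theta - ps theta) - (psn theta_star - ps theta_star).
  rewrite (empirical_deviationE Ziid)//; last first.
    exact: (integrableB measurableT (G_integrable Tt) (G_integrable Ts)).
  rewrite RintegralB ?G_integrable// /psn /psi_bar !(expectE Ziid) ?G_integrable//= sumrB.
  by field; rewrite gt_eqF.
rewrite devE// in da; rewrite devE// in da'; rewrite devBE in dc.
pose y := (psn theta_star - ps theta_star) / alpha.
pose u := (psn theta - psn theta_star) / rho.
have yE : ps theta_star + y * alpha = psn theta_star by rewrite /y divfK ?gt_eqF//; ring.
have uE : psn theta_star + u * rho = psn theta by rewrite /u divfK ?gt_eqF//; ring.
exists y, u; split.
- rewrite -ler_norml /y normrM normfV (gtr0_norm alpha_gt0) ler_pdivrMr// mul1r//.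
- rewrite -ler_norml /u normrM normfV (gtr0_norm rho_gt0) ler_pdivrMr// mul1r.
  apply: le_trans cB; apply: le_trans (lerD dc hB); apply: le_trans (ler_normD _ _).
  by rewrite le_eqVlt; apply/orP; left; apply/eqP; congr (`| _ |); ring.
rewrite yE uE.
have iH th t : Theta th -> Q.-integrable setT (EFin \o H th t).
  exact: (H_integrable_t H_measurable H_integrable L2_ge0 L2_L2 H_lipschitz).
have sum_le0 : \sum_(j < n) (H theta (psn theta) (Z j w) - H theta_star (psn theta_star) (Z j w)) <= 0.
  by rewrite sumrB subr_le0; move: obj; rewrite /empirical_objective ler_pM2l ?invr_gt0.
have intE : \int[Q]_z (H theta (psn theta) z - H theta_star (psn theta_star) z) =
    EH theta (psn theta) - EH theta_star (psn theta_star).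
  by rewrite RintegralB ?iH// !(expectE Ziid) ?iH.
have growth := psi_H_growth Tt.
have bias := @bias_le theta (psn theta - ps theta) (psn theta_star - ps theta_star)
  alpha c delta B Tt hd hB da dc ad.
rewrite !(addrC (ps _)) !subrK in bias.
rewrite -normrN; apply: le_trans (ler_norm _); rewrite /centered_sum intE opprB.
move: bias; rewrite ler_norml => /andP[bias _].
rewrite /psi_H in growth.
set I := EH theta (psn theta) - _; set S := \sum_(j < n) _ in sum_le0 *.
apply: le_trans (_ : n%:R * I <= _); last by lra.
rewrite ler_pM2l// /I; lra.
Qed.

End Deterministic.

(** * Exponents of the rate and comparison of scales on a shell *)

Section ShellNumerics.
Context {R : realType} (beta : R) (beta_gt0 : 0 < beta) (beta_le1 : beta <= 1).
Context (n : nat) (n_gt0 : (0 < n)%N).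

Local Notation p := ((4 - 2 * beta)^-1).
Local Notation N := (n%:R : R).

Lemma rate_exponent : p * (2 - beta) = 2^-1.
Proof. by field; move: beta_le1; lra. Qed.

Lemma rate_powR_gt0 (x : R) : 0 < N `^ x.
Proof. by rewrite powR_gt0// ltr0n. Qed.

Lemma rate_powRD (x y : R) : N `^ (x + y) = N `^ x * N `^ y.
Proof. by rewrite powRD// pnatr_eq0 -lt0n n_gt0 implybT. Qed.

Lemma sqrt_rate : (Num.sqrt N)^-1 = N `^ (- 2^-1).
Proof. by rewrite powRN powR12_sqrt. Qed.

Lemma delta_nkE (k : int) : delta_nk beta n k = 2 `^ k%:~R * N `^ (- p).
Proof. by rewrite /delta_nk powR_intmul. Qed.

Lemma delta_nk_gt0 (k : int) : 0 < delta_nk beta n k.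
Proof. by rewrite delta_nkE mulr_gt0 ?powR2_gt0 ?rate_powR_gt0. Qed.

Lemma delta_nkS (k : int) : delta_nk beta n k = 2 * delta_nk beta n (k - 1).
Proof.
rewrite !delta_nkE mulrA; congr (_ * _).
have -> : k%:~R = 1 + (k - 1)%:~R :> R by rewrite intrB; ring.
by rewrite powR2D powRr1.
Qed.

Lemma sqrt2_exprz (k : int) : Num.sqrt 2 ^ k = 2 `^ (k%:~R / 2) :> R.
Proof. by rewrite -powR_intmul ?sqrtr_ge0// -powR12_sqrt// -powRrM mulrC. Qed.

(** The rate is chosen to balance delta^2 against delta^beta / sqrt n. For delta equal to
    [delta_nk beta n k] both sides coincide, since (2 - beta) / (4 - 2 beta) = 1/2. *)
Lemma powR_delta_nk_le (k : int) (delta : R) : 0 < delta -> delta <= delta_nk beta n k ->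
  2 `^ (k%:~R * (2 - beta)) * (delta `^ beta / Num.sqrt N) <= 4 * delta_nk beta n (k - 1) ^+ 2.
Proof.
move=> d0 dk; have -> : 4 * delta_nk beta n (k - 1) ^+ 2 = delta_nk beta n k ^+ 2.
  by rewrite (delta_nkS k); ring.
have h : delta `^ beta <= (2 `^ k%:~R) `^ beta * (N `^ (- p)) `^ beta.
  rewrite -powRM ?powR_ge0// -delta_nkE; apply: ge0_ler_powR; rewrite ?nnegrE ?(ltW d0)//.
    by apply: ltW; exact: beta_gt0.
  by apply: ltW; exact: delta_nk_gt0.
rewrite sqrt_rate; apply: le_trans (_ : 2 `^ (k%:~R * (2 - beta)) *
   (((2 `^ k%:~R) `^ beta * (N `^ (- p)) `^ beta) * N `^ (- 2^-1)) <= _).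
  by rewrite ler_pM2l ?powR2_gt0// ler_pM2r ?rate_powR_gt0.
rewrite -!powRrM le_eqVlt; apply/orP; left; apply/eqP.
have -> : 2 `^ (k%:~R * (2 - beta)) * (2 `^ (k%:~R * beta) * N `^ (- p * beta) * N `^ (- 2^-1))
  = (2 `^ (k%:~R * (2 - beta)) * 2 `^ (k%:~R * beta)) * (N `^ (- p * beta) * N `^ (- 2^-1)) by ring.
rewrite -powR2D -rate_powRD delta_nkE exprMn -!powR_mulrn ?powR_ge0// -!powRrM.
congr (_ `^ _ * _ `^ _); first by ring.
by have := rate_exponent; rewrite !mulNr => h2; rewrite -h2; ring.
Qed.

(* The condition linking a, b and eps makes the range of psi_n(theta) - psi_n(theta_star) on every
   shell dominate that of psi_n(theta_star) - psi(theta_star). *)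
Lemma alpha_le_shell (a b eps delta : R) (k : int) : 0 < b -> 0 < eps ->
  a * 2 `^ (beta + 1 / 2) <= b * eps `^ (beta + 1 / 2) -> K_eps eps + 1 <= k ->
  delta_nk beta n (k - 1) <= delta ->
  a / Num.sqrt N <= Num.sqrt 2 ^ k * b * delta `^ beta.
Proof.
move=> b0 e0 ab Kk dd.
have [_ eK] := K_eps_bounds e0.
have ek : eps <= 2 `^ k%:~R.
  apply: le_trans (ltW eK) _; apply: ler_powR; rewrite ?ler1n//.
  by rewrite -(intrD _ _ 1) ler_int.
have s0 : 0 < beta + 1 / 2 by move: beta_gt0; lra.
have h1 : a <= b * 2 `^ ((k%:~R - 1) * (beta + 1 / 2)).
  rewrite -(ler_pM2r (powR2_gt0 (beta + 1 / 2))); apply: le_trans ab _.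
  rewrite -mulrA ler_pM2l// -powR2D.
  have -> : (k%:~R - 1) * (beta + 1 / 2) + (beta + 1 / 2) = k%:~R * (beta + 1 / 2) by ring.
  by rewrite powRrM; apply: ge0_ler_powR; rewrite ?nnegrE ?powR_ge0 ?(ltW e0) ?(ltW s0).
have h2 : delta_nk beta n (k - 1) `^ beta <= delta `^ beta.
  apply: ge0_ler_powR; rewrite ?nnegrE//.
  - by apply: ltW; exact: beta_gt0.
  - by apply: ltW; exact: delta_nk_gt0.
  - by apply: le_trans dd; apply: ltW; exact: delta_nk_gt0.
have h3 : N `^ (- 2^-1) <= N `^ (- p * beta).
  apply: ler_powR; first by rewrite ler1n.
  rewrite mulNr lerN2; have := rate_exponent => hr.
  have p0 : 0 < p by rewrite invr_gt0; move: beta_le1; lra.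
  by rewrite -hr ler_wpM2l ?(ltW p0)//; move: beta_le1; lra.
rewrite sqrt_rate.
apply: le_trans (_ : b * 2 `^ ((k%:~R - 1) * (beta + 1 / 2)) * N `^ (- p * beta) <= _).
  apply: le_trans (ler_wpM2r (powR_ge0 _ _) h1) _.
  by rewrite ler_pM2l// mulr_gt0// powR2_gt0.
have b2 : 0 < Num.sqrt 2 ^ k * b by rewrite sqrt2_exprz mulr_gt0// powR2_gt0.
apply: le_trans (ler_wpM2l (ltW b2) h2).
rewrite delta_nkE powRM ?powR_ge0// -!powRrM sqrt2_exprz.
have -> : 2 `^ (k%:~R / 2) * b * (2 `^ ((k - 1)%:~R * beta) * N `^ (- p * beta))
  = b * (2 `^ (k%:~R / 2) * 2 `^ ((k - 1)%:~R * beta)) * N `^ (- p * beta) by ring.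
rewrite ler_pM2r ?rate_powR_gt0// ler_pM2l// -powR2D; apply: ler_powR; rewrite ?ler1n//.
by rewrite intrB; lra.
Qed.

(** [J] does not depend on [r], so that finitely many shells serve all outcomes. *)
Lemma exists_shell (eps Delta : R) : 0 < eps ->
  exists J : nat, forall r : R, eps < N `^ p * r -> r <= Delta ->
    exists2 j : nat, (j < J)%N & delta_nk beta n (K_eps eps + j%:Z) < r
      /\ r <= delta_nk beta n (K_eps eps + 1 + j%:Z).
Proof.
move=> e0; set K := K_eps eps.
have [Ke _] := K_eps_bounds e0; rewrite -/K in Ke.
pose D0 := delta_nk beta n K.
have DK (j : nat) : delta_nk beta n (K + j%:Z) = 2 ^+ j * D0.
  elim: j => [|j IH]; first by rewrite addr0 mul1r.
  by rewrite delta_nkS (_ : K + j.+1%:Z - 1 = K + j%:Z) ?IH ?exprS ?mulrA//; lia.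
have D00 : 0 < D0 by exact: delta_nk_gt0.
(* The ratio Delta / D0 is less than [J], hence less than 2^J, so the last radius covers [Delta]. *)
pose J := (Num.trunc (Delta / D0)).+1.
have hJ : Delta <= delta_nk beta n (K + J%:Z).
  rewrite DK -ler_pdivrMr//; apply: ltW; apply: lt_le_trans (truncnS_gt _) _.
  by rewrite -natrX ler_nat ltnW// ltn_expl.
exists J => r er rD.
have h0 : D0 < r.
  rewrite /D0 delta_nkE powRN ltr_pdivrMr ?rate_powR_gt0// mulrC.
  exact: le_lt_trans Ke er.
have ex : exists j, r <= delta_nk beta n (K + j%:Z) by exists J; exact: le_trans hJ.
case: (ex_minnP ex) => -[|j] rj minj.
  by move: rj; rewrite addr0 leNgt h0.
exists j; first by have := minj J (le_trans rD hJ).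
split; last by rewrite (_ : K + 1 + j%:Z = K + j.+1%:Z)//; lia.
by rewrite ltNge; apply/negP => /minj; rewrite ltnn.
Qed.

(* On the k-th shell the quadratic growth of psi_H beats both the bias and the level
   (shell_level k - r) sqrt n X at which the concentration bound is applied. *)
Lemma shell_growth_lt (a b M1 Mlo nL2 EL2 l2 Kd Delta delta x : R) (k : int) :
  0 < a -> 0 < b -> 0 < M1 -> 0 < Mlo -> 0 <= nL2 -> 0 <= EL2 -> 0 <= l2 -> 0 <= Kd ->
  let Mab := M_ab Kd Delta Mlo beta EL2 a b in
  let Mb := Mbar_b Mlo nL2 b in
  let bk := Num.sqrt 2 ^ k * b in
  0 < delta -> delta <= delta_nk beta n k -> delta <= Delta ->
  delta_nk beta n (k - 1) < x ->
  0 <= shell_level beta M1 Mb k - l2 * Mab / Mb ->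
  (shell_level beta M1 Mb k - l2 * Mab / Mb) * Num.sqrt N * (Mbar_b Mlo nL2 bk * delta `^ beta)
  < N * (M1 * x ^+ 2 - l2 * (a / Num.sqrt N * (Kd * (delta + Mlo * delta `^ beta))
      + EL2 * (bk * delta `^ beta / Num.sqrt N))).
Proof.
move=> a0 b0 M10 Ml0 nL0 EL0 l20 Kd0 Mab Mb bk d0 dk dD dx.
set s := shell_level _ _ _ _ - _ => s0.
have N0 : 0 < N by rewrite ltr0n.
have sq0 : 0 < Num.sqrt N by rewrite sqrtr_gt0.
pose q := delta `^ beta / Num.sqrt N.
have q0 : 0 < q by rewrite divr_gt0// powR_gt0.
(* [w] is the larger of 1 and sqrt 2 ^ k. This one factor bounds the growth of both [Mbar_b] and the
   bias when [b] is replaced by [bk]. *)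
pose w := 2 `^ ((Num.max k 0)%:~R / 2) : R.
have w1 : 1 <= w.
  rewrite /w -[leLHS](powRr0 2); apply: ler_powR; rewrite ?ler1n//.
  by rewrite divr_ge0// ler0z le_max lexx orbT.
have bkw : bk <= w * b.
  rewrite /bk sqrt2_exprz ler_pM2r//; apply: ler_powR; rewrite ?ler1n//.
  by rewrite ler_pM2r// ler_int le_max lexx.
have Mb0 : 0 < Mb.
  by rewrite /Mb /Mbar_b ltr_pwDl//; [apply: mulr_gt0 => //; lra|apply: mulr_ge0 => //; exact: ltW].
have Mbw : Mbar_b Mlo nL2 bk <= w * Mb.
  rewrite /Mb /Mbar_b (mulrDr w); apply: lerD.
    by rewrite ler_peMl//; apply: mulr_ge0; [exact: ltW|lra].
  by rewrite mulrA ler_wpM2r.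
have Q1 : delta = delta `^ (1 - beta) * delta `^ beta.
  by rewrite -[LHS](powRr1 (ltW d0)) -{1}(subrK beta 1) powRD//; apply/implyP => _; rewrite gt_eqF.
have Q2 : delta `^ (1 - beta) <= Delta `^ (1 - beta).
  apply: ge0_ler_powR; rewrite ?nnegrE ?(ltW d0)//; first by move: beta_le1; lra.
  by apply: le_trans dD; exact: ltW.
pose Y := a * Kd * q * (delta `^ (1 - beta) + Mlo) + EL2 * bk * q.
have YE : a / Num.sqrt N * (Kd * (delta + Mlo * delta `^ beta))
      + EL2 * (bk * delta `^ beta / Num.sqrt N) = Y.
  by rewrite {1}Q1 /Y /q; field; rewrite gt_eqF.
have Mabw : Y <= q * (w * Mab).
  have e1 : a * Kd * q * (delta `^ (1 - beta) + Mlo) <= q * (w * (Kd * a * (Delta `^ (1 - beta) + Mlo))).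
    rewrite -(mulrC q) mulrA -(mulrA q) -(mulrA q) ler_pM2l//.
    rewrite (mulrC a); apply: le_trans (_ : Kd * a * (Delta `^ (1 - beta) + Mlo) <= _).
      by rewrite ler_wpM2l ?lerD2r//; apply: mulr_ge0 => //; exact: ltW.
    rewrite ler_peMl//; apply: mulr_ge0; first by apply: mulr_ge0 => //; exact: ltW.
    by rewrite addr_ge0 ?powR_ge0// ltW.
  have e2 : EL2 * bk * q <= q * (w * (b * EL2)).
    by rewrite -(mulrC q) ler_pM2l// (mulrC EL2) mulrA ler_wpM2r.
  by rewrite /Y /Mab /M_ab (mulrDr w) (mulrDr q); exact: lerD.
(* The subtracted term in [s] is the bias in units of the noise, so noise level and bias add up
   exactly to a quarter of the growth term. *)
have main : s * q * (w * Mb) + l2 * (q * (w * Mab)) = M1 / 4 * (2 `^ (k%:~R * (2 - beta)) * q).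
  have -> : k%:~R * (2 - beta) = shell_exponent beta k + (Num.max k 0)%:~R / 2.
    by rewrite /shell_exponent subrK.
  rewrite powR2D -/w /s /shell_level; field.
  by rewrite gt_eqF.
have pw := powR_delta_nk_le d0 dk; rewrite -/q in pw.
have dn0 := delta_nk_gt0 (k - 1).
have xx : delta_nk beta n (k - 1) ^+ 2 < x ^+ 2 by rewrite ltr_sqr ?nnegrE ?(ltW dn0)// ltW// (lt_trans dn0).
rewrite YE.
have -> : s * Num.sqrt N * (Mbar_b Mlo nL2 bk * delta `^ beta) = N * (s * q * Mbar_b Mlo nL2 bk).
  have NE : N = Num.sqrt N * Num.sqrt N by rewrite -expr2 sqr_sqrtr// ltW.
  by rewrite {2}NE /q; field; rewrite gt_eqF.
rewrite ltr_pM2l//.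
have i1 : s * q * Mbar_b Mlo nL2 bk <= s * q * (w * Mb).
  by rewrite ler_wpM2l//; apply: mulr_ge0 => //; exact: ltW.
have i2 : l2 * Y <= l2 * (q * (w * Mab)) by rewrite ler_wpM2l.
have i3 : M1 / 4 * (2 `^ (k%:~R * (2 - beta)) * q) <= M1 * delta_nk beta n (k - 1) ^+ 2.
  have m4 : 0 <= M1 / 4 by lra.
  have := ler_wpM2l m4 pw; lra.
have i4 : M1 * delta_nk beta n (k - 1) ^+ 2 < M1 * x ^+ 2 by rewrite ltr_pM2l.
lra.
Qed.

End ShellNumerics.

(** * Assembly of the tail bound *)

Lemma sum_le_esum {R : realType} (T : choiceType) (S : set T) (f : nat -> T) (C : pred nat)
  (a : T -> \bar R) J : injective f -> (forall j, C j -> S (f j)) ->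
  (\sum_(j < J | C j) a (f j) <= \esum_(k in S) a k)%E.
Proof.
move=> finj fS; pose s := [seq f j | j <- iota 0 J & C j].
apply: esum_ge; exists [set` s].
  split; first exact: finite_seq.
  by move=> x /mapP[j]; rewrite mem_filter => /andP[Cj _] ->; exact: fS.
rewrite -fsbig_seq; last by rewrite map_inj_uniq// filter_uniq// iota_uniq.
by rewrite big_map big_filter -(big_mkord C (fun j => a (f j))) /index_iota subn0.
Qed.

Theorem theorem3p4
  (R : realType) (disp : measure_display) (Omega : measurableType disp)
  (P : probability Omega R)
  (P_complete : measure_is_complete P)
  (P_atomless : atomless P)
  (m d : nat) (m_gt0 : (0 < m)%N) (d_gt0 : (0 < d)%N)
  (Z : nat -> {RV P >-> borel_rV R d})
  (PZ : probability (borel_rV R d) R)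
  (Z_iid : iid_with_law Z PZ)
  (Theta : set 'rV[R]_m)
  (Theta_compact : compact Theta)
  (Theta_diam : 0 < ediam Theta)
  (G : 'rV[R]_m -> borel_rV R d -> R)
  (H : 'rV[R]_m -> R -> borel_rV R d -> R)
  (theta_hat : nat -> {RV P >-> borel_rV R m})
  (theta_hat_in : forall n w, (0 < n)%N -> Theta (theta_hat n w))
  (theta_hat_min : forall n w theta, (0 < n)%N -> Theta theta ->
     empirical_objective Z G H n w (theta_hat n w)
     <= empirical_objective Z G H n w theta)
  (G_integrable : forall theta, Theta theta ->
     PZ.-integrable setT (EFin \o G theta))
  (G_cvg : forall (theta_ : nat -> 'rV[R]_m) (theta : 'rV[R]_m),
     (forall k, Theta (theta_ k)) -> Theta theta ->
     theta_ @ \oo --> theta ->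
     cvg_in_probability PZ (fun k => G (theta_ k)) (G theta))
  (xiG : borel_rV R d -> R)
  (xiG_gt0 : forall z, 0 < xiG z)
  (xiG_L2 : xiG \in Lfun PZ 2%:E)
  (xiG_bound : forall theta z, Theta theta -> `|G theta z| <= xiG z)
  (H_measurable : forall theta t, Theta theta -> measurable_fun setT (H theta t))
  (H_integrable : forall theta, Theta theta ->
     PZ.-integrable setT (EFin \o H theta (psi_bar Z G theta)))
  (L1 L2 : borel_rV R d -> R)
  (L1_ge0 : forall z, 0 <= L1 z) (L2_ge0 : forall z, 0 <= L2 z)
  (L1_L2 : L1 \in Lfun PZ 2%:E) (L2_L2 : L2 \in Lfun PZ 2%:E)
  (H_lipschitz : forall theta vartheta t s z, Theta theta -> Theta vartheta ->
     `|H theta t z - H vartheta s z| ^+ 2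
     <= L1 z ^+ 2 * `|G theta z - G vartheta z| ^+ 2
        + L2 z ^+ 2 * `|t - s| ^+ 2)
  (theta_star : 'rV[R]_m)
  (theta_star_in : Theta theta_star)
  (theta_star_min : forall theta, Theta theta ->
     psi_H Z G H theta_star <= psi_H Z G H theta)
  (theta_star_unique : forall theta, Theta theta ->
     (forall vartheta, Theta vartheta ->
        psi_H Z G H theta <= psi_H Z G H vartheta) ->
     theta = theta_star)
  (M1 : R) (M1_gt0 : 0 < M1)
  (psi_H_growth : forall theta, Theta theta ->
     M1 * enorm (theta - theta_star) ^+ 2
     <= psi_H Z G H theta - psi_H Z G H theta_star)
  (G_separable : forall delta : R, 0 < delta ->
     exists (C : set 'rV[R]_m) (N : forall n, set (n.-tuple (borel_rV R d))),
       [/\ countable C,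
           C `<=` eball_in Theta theta_star delta,
           (forall n, (0 < n)%N ->
              (power_probability PZ n).-negligible (N n)) &
           forall theta n (z : n.-tuple (borel_rV R d)),
             eball_in Theta theta_star delta theta -> (0 < n)%N -> ~ N n z ->
             ereal_inf
               [set (expect Z (fun x => `|G theta x - G vartheta x|)
                     + \big[Num.max/0]_(j < n)
                         `|G theta (tnth z j) - G vartheta (tnth z j)|)%:E
               | vartheta in C] = 0%E])
  (beta Mbar_lo Mbar_up : R) (xi_ : R -> borel_rV R d -> R)
  (beta_gt0 : 0 < beta) (beta_le1 : beta <= 1)
  (Mbar_lo_gt0 : 0 < Mbar_lo) (Mbar_up_gt0 : 0 < Mbar_up)
  (xi_L2 : forall delta : R, 0 < delta <= ediam Theta ->
     xi_ delta \in Lfun PZ 2%:E)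
  (xi_envelope : forall delta : R, 0 < delta <= ediam Theta ->
     positive_envelope (F_Theta_delta Theta G theta_star delta) (xi_ delta))
  (xi_norm : forall delta : R, 0 < delta <= ediam Theta ->
     ('N[PZ]_2%:E[EFin \o (fun z => (Num.max (L1 z) 1 * xi_ delta z)%R)]
      <= (Mbar_lo * delta `^ beta)%:E)%E)
  (entropy_bound : forall delta : R, 0 < delta <= ediam Theta ->
     (Order.max
        (entropy_integral (F_Theta_delta Theta G theta_star delta)
           (xi_ delta) (1 / 8)%R)
        (entropy_integral (F_Theta Theta G) xiG (1 / 8)%R)
      <= Mbar_up%:E)%E)
  (delta1 K_delta1 : R) (mTR : 'rV[R]_m -> R -> R)
  (delta1_gt0 : 0 < delta1) (K_delta1_ge0 : 0 <= K_delta1)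
  (mTR_measurable : measurable_fun (Theta `*` [set: R] : set (borel_rV R m * R))
     (fun x : borel_rV R m * R => mTR x.1 x.2))
  (mTR_lipschitz : forall theta (x : R), Theta theta -> - delta1 <= x <= delta1 ->
     `|mTR theta (psi_bar Z G theta + x)
       - mTR theta_star (psi_bar Z G theta_star + x)|
     <= K_delta1 * enorm (row_mx (theta - theta_star)
          (const_mx (psi_bar Z G theta - psi_bar Z G theta_star) : 'rV[R]_1)))
  (mTR_integrable : forall theta s t, Theta theta -> s < t ->
     lebesgue_measure.-integrable `[s, t] (EFin \o mTR theta))
  (mTR_density : forall theta s t, Theta theta -> s < t ->
     expect Z (H theta t) - expect Z (H theta s)
     = \int[lebesgue_measure]_(u in `[s, t]) mTR theta u)
  (a b eps : R) (a_gt0 : 0 < a) (b_gt0 : 0 < b) (eps_gt0 : 0 < eps)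
  (ab_eps : a * 2 `^ (beta + 1 / 2) <= b * eps `^ (beta + 1 / 2))
  (n : nat) (n_gt0 : (0 < n)%N) (t : R) (t_gt0 : 0 < t) :
  let Delta := ediam Theta in
  let EL2 := expect Z L2 in
  let nL2 : R := fine ('N[PZ]_2%:E[EFin \o L2])%E in
  let l2 : R := (0 < EL2)%R%:R in
  let Mab := M_ab K_delta1 Delta Mbar_lo beta EL2 a b in
  let Mb := Mbar_b Mbar_lo nL2 b in
  let K := K_eps eps in
  let delta_ (k : int) : R := Num.min (delta_nk beta n k) Delta in
  n_ab Mb Delta delta1 l2 beta a <= n%:R ->
  4 * (Mab * l2 + Mb * (1 + 2 * (t + 1) * eta_hat Mbar_up)) / M1
    < 2 `^ (K%:~R * (2 - beta) - (Num.max K 0)%:~R / 2) ->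
  (P [set w | (eps < n%:R `^ (4 - 2 * beta)^-1
                     * enorm (theta_hat n w - theta_star))%R]
   <= (P_1 M1 beta l2 Mab Mb nL2 b t eps)%:E
      + \esum_(k in peeling_indices Delta beta n eps)
          P (~` event_delta Z Theta G theta_star beta n (delta_ k)
                  (Num.sqrt 2 ^ k * b)%R)
      + \esum_(k in peeling_indices Delta beta n eps)
          P (~` event_B Z n
                  (xi_bdelta L1 L2 (xi_ (delta_ k)) Mbar_lo beta
                     (Num.sqrt 2 ^ k * b)%R (delta_ k)))
      + P (~` event_Theta Z Theta G n a))%E.
Proof.
move=> Delta EL2 nL2 l2 Mab Mb K delta_ n_large t_large.
have EL20 : 0 <= EL2 by apply: Rintegral_ge0.
have nL20 : 0 <= nL2 by rewrite /nL2 fine_ge0// Lnorm_ge0.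
have l20 : 0 <= l2 by rewrite /l2 ler0n.
have Mab0 : 0 <= Mab.
  rewrite /Mab /M_ab; apply: addr_ge0; last by rewrite mulr_ge0// ltW.
  apply: mulr_ge0; first by rewrite mulr_ge0// ltW.
  by rewrite addr_ge0 ?powR_ge0// ltW.
have Mb0 : 0 < Mb.
  rewrite /Mb /Mbar_b ltr_pwDl//; first by rewrite mulr_gt0// ltr_pwDl.
  by rewrite mulr_ge0// ltW.
(* The bias in units of the noise; subtracting it from each shell level leaves the level available
   for the deviation. *)
pose r := l2 * Mab / Mb.
have r0 : 0 <= r by rewrite /r divr_ge0 ?mulr_ge0// ltW.
have levelK : 1 + 2 * (t + 1) * eta_hat Mbar_up < shell_level beta M1 Mb K - r.
  move: t_large; rewrite ltr_pdivrMr// -/(shell_exponent beta K) => t_large.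
  rewrite ltrBrDr /shell_level ltr_pdivlMr ?mulr_gt0// /r.
  rewrite (_ : (_ + _) * (4 * Mb) = 4 * (Mab * l2 + Mb * (1 + 2 * (t + 1) * eta_hat Mbar_up))).
    by rewrite (mulrC M1).
  by field; rewrite gt_eqF.
have n0 : 0 < n%:R :> R by rewrite ltr0n.
have sqn0 : 0 < Num.sqrt n%:R :> R by rewrite sqrtr_gt0.
have sqn1 : 1 <= Num.sqrt n%:R :> R by rewrite -[leLHS]sqrtr1 ler_wsqrtr// ler1n.
(* The second term of [n_ab] ensures this, so the empirical inner mean stays where [mTR] is
   controlled. *)
have alpha_delta1 : 0 < EL2 -> a / Num.sqrt n%:R <= delta1.
  move=> EL2_gt0; rewrite ler_pdivrMr//.
  rewrite -ler_sqr ?nnegrE ?mulr_ge0 ?(ltW a_gt0) ?(ltW delta1_gt0) ?(ltW sqn0)//.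
  rewrite exprMn sqr_sqrtr ?(ltW n0)// -ler_pdivrMl ?exprn_gt0//.
  apply: le_trans n_large; rewrite /n_ab /l2 EL2_gt0 mul1r.
  by rewrite le_max le_max [_^-1 * _]mulrC lexx orbT.
pose k_ (j : nat) : int := K + 1 + j%:Z.
pose b_ (j : nat) : R := Num.sqrt 2 ^ k_ j * b.
pose cond (j : nat) := delta_nk beta n (k_ j - 1) <= Delta.
have delta_gt0 j : 0 < delta_ (k_ j) by rewrite /delta_ lt_min delta_nk_gt0.
have delta_Delta j : 0 < delta_ (k_ j) <= ediam Theta.
  by rewrite delta_gt0/= /delta_ ge_min lexx orbT.
have b_gt0' j : 0 < b_ j by rewrite /b_ mulr_gt0// exprz_gt0// sqrtr_gt0.
pose dist w := enorm (theta_hat n w - theta_star).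
pose eT := event_Theta Z Theta G n a.
pose ed j := event_delta Z Theta G theta_star beta n (delta_ (k_ j)) (b_ j).
pose eB j := event_B Z n (xi_bdelta L1 L2 (xi_ (delta_ (k_ j))) Mbar_lo beta (b_ j) (delta_ (k_ j))).
(* The exceptional set is chosen for every [j], and is empty when shell [j] lies outside the
   diameter, so that the choice is a plain sequence. *)
have shell j : exists D : set Omega, [/\ measurable D,
    (P D <= (4 * expR (- ((shell_level beta M1 Mb (k_ j) - r) / 32) ^+ 2))%:E)%E &
    cond j -> forall w, eT w -> ed j w -> eB j w ->
      delta_nk beta n (k_ j - 1) < dist w -> dist w <= delta_nk beta n (k_ j) -> D w].
  have [cj|_] := boolP (cond j); last first.
    by exists set0; split => //; rewrite measure0 lee_fin mulr_ge0// expR_ge0.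
  have dj := delta_Delta j; have d0 := delta_gt0 j.
  have := entropy_bound _ dj; rewrite ge_max => /andP[ent _].
  have level := shell_level_large beta_gt0 beta_le1 M1_gt0 Mb0 (ltW Mbar_up_gt0) r0 t_gt0 levelK j.
  (* Truncating the outer radius at the diameter keeps it above the inner radius of the shell, as
     [alpha_le_shell] requires. *)
  have dd : delta_nk beta n (k_ j - 1) <= delta_ (k_ j).
    rewrite le_min; apply/andP; split; last exact: cj.
    by rewrite [leRHS]delta_nkS ler_peMl ?ler1n// ltW// delta_nk_gt0.
  have K1 : K_eps eps + 1 <= k_ j by rewrite /k_ lerDl.
  have alpha_b := alpha_le_shell beta_gt0 beta_le1 n_gt0 b_gt0 eps_gt0 ab_eps K1 dd.
  have alpha_rho : a / Num.sqrt n%:R <= (b_ j + Mbar_lo) * delta_ (k_ j) `^ beta.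
    by apply: le_trans alpha_b _; rewrite ler_wpM2r ?powR_ge0// lerDl ltW.
  have alpha0 : 0 < a / Num.sqrt n%:R by exact: divr_gt0.
  have rho0 := lt_le_trans alpha0 alpha_rho.
  have [D [mD PD hD]] := shell_bound Z_iid theta_star_in G_integrable xiG_L2 xiG_bound
    H_measurable H_integrable L1_ge0 L2_ge0 L1_L2 L2_L2 H_lipschitz n_gt0 d0 (b_gt0' j)
    (ltW alpha0) Mbar_lo_gt0 Mbar_up_gt0 (xi_L2 _ dj) (xi_envelope _ dj) (xi_norm _ dj) ent
    alpha_rho G_separable level.
  exists D; split=> // _ w eTw edw eBw dlo dhi.
  pose theta := theta_hat n w; have Tt : Theta theta by exact: theta_hat_in.
  have dw : dist w <= delta_ (k_ j) by rewrite le_min dhi enorm_le_diam.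
  have Ut : eball_in Theta theta_star (delta_ (k_ j)) theta by [].
  have psi_dist := psi_bar_dist Z_iid theta_star_in G_integrable L1_L2 d0 Mbar_lo_gt0
    (xi_L2 _ dj) (xi_envelope _ dj) (xi_norm _ dj) Ut.
  have devT th : Theta th -> `|empirical_deviation Z n (G th) w| <= a / Num.sqrt n%:R.
    by move: eTw => /ereal_supP h Tth; have := h _ (imageP _ Tth); rewrite lee_fin.
  have devd : `|empirical_deviation Z n (G theta \- G theta_star) w|
      <= b_ j * delta_ (k_ j) `^ beta / Num.sqrt n%:R.
    by move: edw => /ereal_supP h; have := h _ (imageP _ Ut); rewrite lee_fin.
  have cB : b_ j * delta_ (k_ j) `^ beta / Num.sqrt n%:R + Mbar_lo * delta_ (k_ j) `^ beta
      <= (b_ j + Mbar_lo) * delta_ (k_ j) `^ beta.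
    rewrite mulrDl lerD2r ler_pdivrMr// ler_peMr// mulr_ge0 ?powR_ge0// ltW//; exact: b_gt0'.
  have [y [u [hy hu dev]]] := shell_deviation Z_iid theta_star_in G_integrable H_measurable
    H_integrable L2_ge0 L2_L2 H_lipschitz psi_H_growth K_delta1_ge0 mTR_lipschitz
    mTR_integrable mTR_density n_gt0 alpha0 rho0 Tt dw psi_dist cB (devT _ Tt)
    (devT _ theta_star_in) devd alpha_delta1 (theta_hat_min _ w _ n_gt0 theta_star_in).
  apply: (hD w theta y u) => //; apply: lt_le_trans dev.
  have level0 : 0 <= shell_level beta M1 Mb (k_ j) - r by move: level Mbar_up_gt0; lra.
  have dD : delta_ (k_ j) <= Delta by case/andP: dj.
  by apply: shell_growth_lt => //; rewrite /delta_ ge_min lexx.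
have [D hD] := choice shell.
have meT : measurable eT.
  rewrite /eT /event_Theta -{1}(eball_in_diam Theta_compact theta_star_in).
  by apply: (measurable_event_sup P_complete Z_iid G_separable) => // theta -[Tt _]; exact: G_integrable.
have med j : measurable (ed j).
  apply: (measurable_event_sup P_complete Z_iid G_separable) => //.
    by move=> theta [Tt _]; exact: integrableB (G_integrable _ Tt) (G_integrable _ theta_star_in).
  by move=> theta vartheta z /=; ring.
have meB j : measurable (eB j).
  apply: measurable_set_le => //.
  apply: measurable_funM => //; apply: measurable_sum => i; apply: measurable_funX.
  have dj := delta_Delta j.
  have /Lfun2P[mXi _] := Xi_Lfun2 L2_ge0 L1_L2 L2_L2 (delta_gt0 j) (b_gt0' j) Mbar_lo_gt0
    (xi_L2 _ dj) (xi_envelope _ dj) (xi_norm _ dj).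
  exact: (measurableT_comp mXi (measurable_funPT (Z i))).
have mD j : measurable (D j) by have [] := hD j.
have [J hJ] := exists_shell beta_gt0 beta_le1 n_gt0 Delta eps_gt0.
(* Shells outside [peeling_indices] get the empty set, so only the terms present in the two sums of
   the statement are charged. *)
pose E j := if cond j then ~` ed j `|` ~` eB j `|` D j else set0.
have mE j : measurable (E j).
  rewrite /E; case: ifP => // _; apply: measurableU => //; apply: measurableU; exact: measurableC.
have cover : [set w | (eps < n%:R `^ (4 - 2 * beta)^-1 * dist w)%R]
    `<=` (\big[setU/set0]_(j < J) E j) `|` ~` eT.
  move=> w /= ew; have [eTw|] := pselect (eT w); last by right.
  left; have dD : dist w <= Delta by apply: enorm_le_diam => //; exact: theta_hat_in.
  have [j jJ [lo hi]] := hJ _ ew dD.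
  have kE : k_ j - 1 = K_eps eps + j%:Z by rewrite /k_ /K; ring.
  (* A shell that contains the estimator has its inner radius below the diameter, so its index
     belongs to [peeling_indices]. *)
  have cj : cond j by rewrite /cond kE; apply: le_trans dD; exact: ltW.
  rewrite -bigcup_mkord; exists j => //; rewrite /E cj.
  have [edw|] := pselect (ed j w); last by left; left.
  have [eBw|] := pselect (eB j w); last by left; right.
  by right; have [_ _] := hD j; apply => //; rewrite kE.
have mL : measurable [set w | (eps < n%:R `^ (4 - 2 * beta)^-1 * dist w)%R].
  have -> : [set w | (eps < n%:R `^ (4 - 2 * beta)^-1 * dist w)%R] =
      theta_hat n @^-1` [set y | eps / n%:R `^ (4 - 2 * beta)^-1 < enorm (y - theta_star)].
    by apply/seteqP; split=> w /=; rewrite ltr_pdivrMr ?powR_gt0// mulrC.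
  by rewrite -[X in measurable X]setTI; apply: measurable_funPT => //; exact: measurable_enorm_gt.
pose aD k := P (~` event_delta Z Theta G theta_star beta n (delta_ k) (Num.sqrt 2 ^ k * b)).
pose aB k := P (~` event_B Z n (xi_bdelta L1 L2 (xi_ (delta_ k)) Mbar_lo beta
                     (Num.sqrt 2 ^ k * b)%R (delta_ k))).
have PE j : (P (E j) <= (if cond j then aD (k_ j) + aB (k_ j) else 0)
    + (4 * expR (- ((shell_level beta M1 Mb (k_ j) - r) / 32) ^+ 2))%:E)%E.
  have [_ PD _] := hD j.
  rewrite /E; case: ifP => _; last first.
    by rewrite measure0 add0e lee_fin mulr_ge0// expR_ge0.
  apply: le_trans (measureU2 _ _ _) _ => //.
    by apply: measurableU; exact: measurableC.
  by apply: leeD => //; apply: measureU2; exact: measurableC.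
have kinj : injective k_ by move=> i j; rewrite /k_ => /addrI [].
have kS j : cond j -> peeling_indices Delta beta n eps (k_ j).
  by move=> cj; split => //; rewrite /k_ lerDl.
have sD := sum_le_esum aD J kinj kS; have sB := sum_le_esum aB J kinj kS.
apply: le_trans (le_measure _ _ _ cover) _; rewrite ?inE//.
  apply: measurableU; last exact: measurableC.
  by apply: bigsetU_measurable => j _; exact: mE.
apply: le_trans (measureU2 _ _ _) _.
- by apply: bigsetU_measurable => j _; exact: mE.
- exact: measurableC.
apply: leeD => //.
apply: le_trans (Boole_inequality _ _) _; first by move=> j _; exact: mE.
apply: le_trans (lee_sum _ (fun (j : 'I_J) _ => PE j)) _.
rewrite big_split/= -big_mkcond/= big_split/= sumEFin [leLHS]addeC -[leRHS]addeA.
apply: leeD; last by apply: leeD; [exact: sD|exact: sB].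
rewrite lee_fin; apply: le_trans (P_1_ge _ _ _ _ _ _ _ _ _ _) => //.
exact: (peeling_sum beta_gt0 beta_le1 M1_gt0 Mb0 (ltW Mbar_up_gt0) r0 t_gt0 levelK).
Qed.
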